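(* Let $\omega$ be a nonzero real number. Consider the holomorphic system $$\dot x=i\omega x+y+f,\quad \dot y=i\omega y+z+g,\quad \dot z=i\omega z+h,$$ where $f,g,h$ are holomorphic near $0\in\mathbb{C}^3$ and vanish to order at least $2$. Then: 1) The system has a unique $x$-invariant holomorphic center manifold at the origin, and it contains an isochronous center family of period $2\pi/|\omega|$. 2) The system has no $y$-invariant and no $z$-invariant holomorphic center manifold at the origin.
   Context: An $x$-invariant (resp. $y$-, $z$-invariant) holomorphic center manifold at the origin is a germ at $0$ of a one-dimensional complex submanifold of $\mathbb{C}^3$ through $0$ that is invariant under the system and tangent at $0$ to the $x$-axis (resp. $y$-, $z$-axis). Such a manifold $S$ contains an isochronous center family of period $T$ if every real-time trajectory of the system starting at a point of $S\setminus\{0\}$ sufficiently close to $0$ is periodic of period $T$. *)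

(* Defs.v *)
From Stdlib Require Import Reals.
Open Scope R_scope.

Definition Cplx : Type := (R * R)%type.
Definition C0 : Cplx := (0, 0).
Definition RtoC (r : R) : Cplx := (r, 0).
Definition Ci : Cplx := (0, 1).
Definition Cadd (z w : Cplx) : Cplx := (fst z + fst w, snd z + snd w).
Definition Csub (z w : Cplx) : Cplx := (fst z - fst w, snd z - snd w).
Definition Cmul (z w : Cplx) : Cplx :=
  (fst z * fst w - snd z * snd w, fst z * snd w + snd z * fst w).
Definition Cnorm (z : Cplx) : R := sqrt (fst z ^ 2 + snd z ^ 2).

Definition C3 : Type := (Cplx * Cplx * Cplx)%type.
Definition c3x (p : C3) : Cplx := fst (fst p).
Definition c3y (p : C3) : Cplx := snd (fst p).
Definition c3z (p : C3) : Cplx := snd p.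
Definition mkC3 (a b c : Cplx) : C3 := (a, b, c).
Definition C3zero : C3 := mkC3 C0 C0 C0.
Definition C3add (p q : C3) : C3 :=
  mkC3 (Cadd (c3x p) (c3x q)) (Cadd (c3y p) (c3y q)) (Cadd (c3z p) (c3z q)).
Definition C3sub (p q : C3) : C3 :=
  mkC3 (Csub (c3x p) (c3x q)) (Csub (c3y p) (c3y q)) (Csub (c3z p) (c3z q)).
Definition C3scal (l : Cplx) (p : C3) : C3 :=
  mkC3 (Cmul l (c3x p)) (Cmul l (c3y p)) (Cmul l (c3z p)).
Definition C3norm (p : C3) : R :=
  sqrt (Cnorm (c3x p) ^ 2 + Cnorm (c3y p) ^ 2 + Cnorm (c3z p) ^ 2).

Definition C_differentiable3 (F : C3 -> Cplx) (p : C3) : Prop :=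
  exists a b c : Cplx, forall eps, 0 < eps -> exists delta, 0 < delta /\
    forall hv : C3, C3norm hv < delta ->
      Cnorm (Csub (Csub (F (C3add p hv)) (F p))
                  (Cadd (Cadd (Cmul a (c3x hv)) (Cmul b (c3y hv))) (Cmul c (c3z hv))))
      <= eps * C3norm hv.

Definition holomorphic_near0 (F : C3 -> Cplx) : Prop :=
  exists r, 0 < r /\ forall p, C3norm p < r -> C_differentiable3 F p.

Definition vanishes_order2 (F : C3 -> Cplx) : Prop :=
  F C3zero = C0 /\
  forall eps, 0 < eps -> exists delta, 0 < delta /\
    forall hv : C3, C3norm hv < delta -> Cnorm (F hv) <= eps * C3norm hv.

Definition field (w : R) (f g h : C3 -> Cplx) (p : C3) : C3 :=
  mkC3 (Cadd (Cadd (Cmul (Cmul Ci (RtoC w)) (c3x p)) (c3y p)) (f p))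
       (Cadd (Cadd (Cmul (Cmul Ci (RtoC w)) (c3y p)) (c3z p)) (g p))
       (Cadd (Cmul (Cmul Ci (RtoC w)) (c3z p)) (h p)).

Definition has_cderiv (gamma : Cplx -> C3) (t : Cplx) (v : C3) : Prop :=
  forall eps, 0 < eps -> exists delta, 0 < delta /\
    forall s : Cplx, Cnorm s < delta ->
      C3norm (C3sub (C3sub (gamma (Cadd t s)) (gamma t)) (C3scal s v))
      <= eps * Cnorm s.

(** gamma : D_rho -> Cplx^3 is a holomorphic embedding (injective immersion,
    homeomorphism onto its image) whose image is exactly S ∩ B_r, with
    gamma(0) = 0.  This says that near 0, S is a one-dimensional complex
    submanifold of Cplx^3 through 0, parametrized by gamma. *)
Definition curve_chart (S : C3 -> Prop) (gamma : Cplx -> C3) (rho r : R) : Prop :=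
  0 < rho /\ 0 < r /\ gamma C0 = C3zero /\
  (forall t, Cnorm t < rho -> exists v, has_cderiv gamma t v /\ v <> C3zero) /\
  (forall t1 t2, Cnorm t1 < rho -> Cnorm t2 < rho -> gamma t1 = gamma t2 -> t1 = t2) /\
  (forall t, Cnorm t < rho -> C3norm (gamma t) < r) /\
  (forall q, C3norm q < r -> (S q <-> exists t, Cnorm t < rho /\ gamma t = q)) /\
  (forall t0, Cnorm t0 < rho -> forall eps, 0 < eps -> exists delta, 0 < delta /\
     forall t, Cnorm t < rho -> C3norm (C3sub (gamma t) (gamma t0)) < delta ->
       Cnorm (Csub t t0) < eps).

Inductive axis : Type := AX | AY | AZ.

Definition on_axis (a : axis) (v : C3) : Prop :=
  match a with
  | AX => c3y v = C0 /\ c3z v = C0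
  | AY => c3x v = C0 /\ c3z v = C0
  | AZ => c3x v = C0 /\ c3y v = C0
  end.

(** S (as a germ at 0) is an a-invariant holomorphic center manifold of the
    vector field V: a one-dimensional complex submanifold germ through 0,
    tangent at 0 to the a-axis, and invariant (V is tangent to it). *)
Definition invariant_center_manifold (V : C3 -> C3) (a : axis) (S : C3 -> Prop) : Prop :=
  exists gamma rho r, curve_chart S gamma rho r /\
    (exists v, has_cderiv gamma C0 v /\ on_axis a v) /\
    (forall t, Cnorm t < rho -> exists v lam,
        has_cderiv gamma t v /\ V (gamma t) = C3scal lam v).

Definition real_solution (V : C3 -> C3) (p : R -> C3) : Prop :=
  forall t eps, 0 < eps -> exists delta, 0 < delta /\
    forall s, 0 < Rabs s < delta ->
      C3norm (C3sub (C3sub (p (t + s)) (p t)) (C3scal (RtoC s) (V (p t))))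
      <= eps * Rabs s.

Definition isochronous_center_family (V : C3 -> C3) (S : C3 -> Prop) (T : R) : Prop :=
  exists delta, 0 < delta /\
    forall q, S q -> q <> C3zero -> C3norm q < delta ->
      exists p, real_solution V p /\ p 0 = q /\
        (forall t, p (t + T) = p t) /\
        (forall t, 0 < t < T -> p t <> q).

(* Main.v *)
Require Import Defs.
From Stdlib Require Import Reals Lra ClassicalEpsilon IndefiniteDescription.
From Coquelicot Require Import Coquelicot.
Open Scope R_scope.

(** All eigenvalues of the linear part equal [i w], so a solution of [i w t gamma'(t) = V (gamma t)]
    with [gamma(t) = (t, 0, 0) + O(t^2)] is an invariant curve on which the real-time flow is the
    rotation [gamma(t) -> gamma(exp(i w s) t)], of period [2 pi / |w|]. In each coordinate this
    equation has the form [t Q' - Q = m], which is solved by [Q(t) = int_0^1 m(s t) / s^2 ds]; since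
    the nonlinear terms are quadratic, Picard iteration converges for the norm [sup |.| / |t|^2]
    on a small disk. For uniqueness, an invariant curve tangent to the x-axis is a graph
    [(y, z) = p(x)], and the quotient by [x] of the difference of two such graphs satisfies, along
    rays, a nilpotent linear system up to a perturbation of size [O(|x|)], which forces it to vanish.
    Finally [V(gamma t)] is proportional to [gamma'(t)]; dividing by [t] and letting [t] tend to 0,
    the tangent vector at 0 must be an eigenvector of the linear part, which rules out the y- and
    z-axes. Continuity of derivatives of merely complex differentiable functions, and the
    quadratic bounds, come from Goursat's theorem and the resulting Cauchy estimates. *)


(** * Complex and real derivatives of complex-valued functions *)

(** The homogeneous equation [t Q' = Q] has the linear solutions [Q = c t], so a linear term in [m]
    would be resonant and force a logarithm; a right-hand side of order two has no such term, and
    the integral converges at 0. The seed [(t, 0, 0)] is killed by the nilpotent part, so no linear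
    term ever arises, and the coupling is triangular: z is determined first, then y, then x. Only
    the nonlinear terms are iterated: their Lipschitz constant shrinks with the disk, whereas the
    linear coupling is not small on any disk. The same triangularity drives uniqueness. Pointwise
    differentiability is the only regularity that the definitions supply, so every smoothness fact
    is quantitative and goes back to one Cauchy estimate, with explicit constants that are not
    optimised. Derivatives keep the epsilon form of [has_cderiv], with a non-strict inequality that
    allows [s = 0], so that a statement about curves splits into its coordinates. Sequences converge
    at a geometric rate, and limits are taken through inequalities with an error [D / 2 ^ n]. *)

Definition cder (g : C -> C) (z v : C) : Prop :=
  forall eps, 0 < eps -> exists delta, 0 < delta /\
    forall s : C, Cmod s < delta ->
      Cmod (g (z + s) - g z - s * v)%C <= eps * Cmod s.

Definition rder (f : R -> C) (x : R) (v : C) : Prop :=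
  forall eps, 0 < eps -> exists delta, 0 < delta /\
    forall s : R, Rabs s < delta ->
      Cmod (f (x + s)%R - f x - s * v)%C <= eps * Rabs s.

Lemma Cmod_plus_le (a b : C) (A B : R) :
  Cmod a <= A -> Cmod b <= B -> Cmod (a + b)%C <= A + B.
Proof. intros; eapply Rle_trans; [apply Cmod_triangle | lra]. Qed.

Lemma Cmod_minus_le (a b : C) (A B : R) :
  Cmod a <= A -> Cmod b <= B -> Cmod (a - b)%C <= A + B.
Proof. intros; apply Cmod_plus_le; [|rewrite Cmod_opp]; auto. Qed.

Lemma Cmod_mult_le (a b : C) (A B : R) :
  Cmod a <= A -> Cmod b <= B -> Cmod (a * b)%C <= A * B.
Proof.
  intros; rewrite Cmod_mult; apply Rmult_le_compat; auto using Cmod_ge_0.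
Qed.

Lemma Cmod_triangle_inv (a b : C) : Cmod a - Cmod b <= Cmod (a - b)%C.
Proof.
  assert (H : Cmod (b + (a - b))%C <= Cmod b + Cmod (a - b)%C) by apply Cmod_triangle.
  replace (b + (a - b))%C with a in H by ring. lra.
Qed.

Lemma Cmod_Re_le (z : C) : Rabs (fst z) <= Cmod z.
Proof. eapply Rle_trans; [|apply Rmax_Cmod]; apply Rmax_l. Qed.

Lemma Cmod_Im_le (z : C) : Rabs (snd z) <= Cmod z.
Proof. eapply Rle_trans; [|apply Rmax_Cmod]; apply Rmax_r. Qed.

Lemma Cmod_le_Re_Im (z : C) : Cmod z <= Rabs (fst z) + Rabs (snd z).
Proof.
  destruct z as [x y]; simpl fst; simpl snd.
  replace (x, y) with (RtoC x + Ci * RtoC y)%C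
    by (apply injective_projections; simpl; ring).
  apply Cmod_plus_le.
  - rewrite Cmod_R; lra.
  - rewrite Cmod_mult, Cmod_Ci, Cmod_R; lra.
Qed.

Lemma Cmod_small_eq_0 (z : C) : (forall eps, 0 < eps -> Cmod z <= eps) -> z = 0%C.
Proof.
  intros H. apply Cmod_eq_0. destruct (Rle_lt_or_eq_dec 0 (Cmod z)) as [h|h]; auto.
  - apply Cmod_ge_0.
  - specialize (H (Cmod z / 2) ltac:(lra)). lra.
Qed.

Lemma cder_ext_loc (f g : C -> C) (z v : C) (d : R) :
  0 < d -> (forall s, Cmod s < d -> f (z + s)%C = g (z + s)%C) -> cder f z v -> cder g z v.
Proof.
  intros Hd E H eps He. destruct (H eps He) as (e & He0 & H').
  exists (Rmin d e); split; [now apply Rmin_pos|].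
  intros s Hs. rewrite <- E by (eapply Rlt_le_trans; [apply Hs|apply Rmin_l]).
  replace (g z) with (f z).
  - apply H'. eapply Rlt_le_trans; [apply Hs|apply Rmin_r].
  - specialize (E 0%C). rewrite Cmod_0 in E. replace (z + 0)%C with z in E by ring. auto.
Qed.

Lemma cder_ext (f g : C -> C) (z v : C) :
  (forall s, f s = g s) -> cder f z v -> cder g z v.
Proof. intros E. apply cder_ext_loc with 1; auto; lra. Qed.

Lemma cder_unique (g : C -> C) (z v w : C) : cder g z v -> cder g z w -> v = w.
Proof.
  intros H1 H2.
  assert (E : (v - w)%C = 0%C).
  { apply Cmod_small_eq_0. intros eps He.
    destruct (H1 (eps / 2)) as (d1 & Hd1 & K1); [lra|].
    destruct (H2 (eps / 2)) as (d2 & Hd2 & K2); [lra|].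
    set (s := Rmin d1 d2 / 2).
    assert (Hs : 0 < s) by (unfold s; assert (0 < Rmin d1 d2) by (now apply Rmin_pos); lra).
    assert (Hm : Cmod s = s) by (rewrite Cmod_R, Rabs_pos_eq; lra).
    assert (s < d1 /\ s < d2).
    { unfold s in *; pose proof (Rmin_l d1 d2); pose proof (Rmin_r d1 d2); lra. }
    specialize (K1 s ltac:(lra)). specialize (K2 s ltac:(lra)).
    assert (K : Cmod (s * (v - w))%C <= eps / 2 * s + eps / 2 * s).
    { replace (s * (v - w))%C
        with ((g (z + s) - g z - s * w) - (g (z + s) - g z - s * v))%C by ring.
      rewrite Hm in K1, K2. apply Cmod_minus_le; lra. }
    rewrite Cmod_mult, Hm in K. apply Rmult_le_reg_l with s; lra. }
  replace v with ((v - w) + w)%C by ring. rewrite E. ring.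
Qed.

(** Stands in for continuity: the definition with [eps = 1] already gives an explicit local
    Lipschitz constant. *)
Lemma cder_lip (g : C -> C) (z v : C) : cder g z v ->
  exists d, 0 < d /\ forall s, Cmod s < d -> Cmod (g (z + s) - g z)%C <= (Cmod v + 1) * Cmod s.
Proof.
  intros H. destruct (H 1) as (d & Hd & K); [lra|]. exists d; split; auto.
  intros s Hs. replace (g (z + s) - g z)%C with ((g (z + s) - g z - s * v) + s * v)%C by ring.
  replace ((Cmod v + 1) * Cmod s) with (1 * Cmod s + Cmod s * Cmod v) by ring.
  apply Cmod_plus_le; auto. rewrite Cmod_mult; lra.
Qed.

Lemma cder_const (c z : C) : cder (fun _ => c) z 0%C.
Proof.
  intros eps He. exists 1; split; [lra|]. intros s _; cbv beta.
  replace (c - c - s * 0)%C with (RtoC 0) by ring. rewrite Cmod_0.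
  apply Rmult_le_pos; [lra|apply Cmod_ge_0].
Qed.

Lemma cder_id (z : C) : cder (fun t => t) z 1%C.
Proof.
  intros eps He. exists 1; split; [lra|]. intros s _; cbv beta.
  replace (z + s - z - s * 1)%C with (RtoC 0) by ring. rewrite Cmod_0.
  apply Rmult_le_pos; [lra|apply Cmod_ge_0].
Qed.

Lemma cder_plus (f g : C -> C) (z u v : C) :
  cder f z u -> cder g z v -> cder (fun t => f t + g t)%C z (u + v)%C.
Proof.
  intros H1 H2 eps He.
  destruct (H1 (eps / 2)) as (d1 & Hd1 & K1); [lra|].
  destruct (H2 (eps / 2)) as (d2 & Hd2 & K2); [lra|].
  exists (Rmin d1 d2); split; [now apply Rmin_pos|]. intros s Hs; cbv beta.
  pose proof (Rmin_l d1 d2); pose proof (Rmin_r d1 d2).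
  specialize (K1 s ltac:(lra)). specialize (K2 s ltac:(lra)).
  replace (f (z + s) + g (z + s) - (f z + g z) - s * (u + v))%C
    with ((f (z + s) - f z - s * u) + (g (z + s) - g z - s * v))%C by ring.
  replace (eps * Cmod s) with (eps / 2 * Cmod s + eps / 2 * Cmod s) by field.
  now apply Cmod_plus_le.
Qed.

Lemma cder_mult (f g : C -> C) (z u v : C) :
  cder f z u -> cder g z v -> cder (fun t => f t * g t)%C z (u * g z + f z * v)%C.
Proof.
  intros H1 H2 eps He.
  pose proof (Cmod_ge_0 (f z)); pose proof (Cmod_ge_0 (g z));
  pose proof (Cmod_ge_0 u); pose proof (Cmod_ge_0 v).
  destruct (cder_lip _ _ _ H2) as (d3 & Hd3 & K3).
  destruct (H1 (eps / (3 * (Cmod (g z) + 1)))) as (d1 & Hd1 & K1);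
    [apply Rdiv_lt_0_compat; lra|].
  destruct (H2 (eps / (3 * (Cmod (f z) + 1)))) as (d2 & Hd2 & K2);
    [apply Rdiv_lt_0_compat; lra|].
  (* [d4] controls the cross term [s * u * (g (z + s) - g z)], and [d5] keeps [g (z + s)] within 1
     of [g z]; each of the three terms of the expansion then takes a third of [eps]. *)
  set (d4 := eps / (3 * ((Cmod u + 1) * (Cmod v + 1)))).
  set (d5 := / (Cmod v + 1)).
  assert (Hd4 : 0 < d4) by (apply Rdiv_lt_0_compat; nra).
  assert (Hd5 : 0 < d5) by (apply Rinv_0_lt_compat; lra).
  exists (Rmin (Rmin d1 d2) (Rmin d3 (Rmin d4 d5))). split.
  { repeat apply Rmin_pos; auto. }
  intros s Hs; cbv beta.
  pose proof (Rmin_l (Rmin d1 d2) (Rmin d3 (Rmin d4 d5))).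
  pose proof (Rmin_r (Rmin d1 d2) (Rmin d3 (Rmin d4 d5))).
  pose proof (Rmin_l d1 d2); pose proof (Rmin_r d1 d2).
  pose proof (Rmin_l d3 (Rmin d4 d5)); pose proof (Rmin_r d3 (Rmin d4 d5)).
  pose proof (Rmin_l d4 d5); pose proof (Rmin_r d4 d5).
  specialize (K1 s ltac:(lra)). specialize (K2 s ltac:(lra)). specialize (K3 s ltac:(lra)).
  pose proof (Cmod_ge_0 s).
  replace (f (z + s) * g (z + s) - f z * g z - s * (u * g z + f z * v))%C
    with ((f (z + s) - f z - s * u) * g (z + s) + f z * (g (z + s) - g z - s * v)
          + s * u * (g (z + s) - g z))%C by ring.
  replace (eps * Cmod s) with (eps * Cmod s / 3 + eps * Cmod s / 3 + eps * Cmod s / 3) by field.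
  assert (G1 : Cmod (g (z + s))%C <= Cmod (g z) + 1).
  { replace (g (z + s))%C with (g z + (g (z + s) - g z))%C by ring.
    apply Cmod_plus_le; [lra|]. eapply Rle_trans; [apply K3|].
    apply Rle_trans with ((Cmod v + 1) * d5); [|right; unfold d5; field; lra].
    apply Rmult_le_compat_l; lra. }
  repeat apply Cmod_plus_le.
  - replace (eps * Cmod s / 3) with (eps / (3 * (Cmod (g z) + 1)) * Cmod s * (Cmod (g z) + 1))
      by (field; lra).
    now apply Cmod_mult_le.
  - apply Rle_trans with ((Cmod (f z) + 1) * (eps / (3 * (Cmod (f z) + 1)) * Cmod s)).
    + apply Cmod_mult_le; [lra|auto].
    + right; field; lra.
  - apply Rle_trans with (Cmod s * (Cmod u + 1) * ((Cmod v + 1) * d4)).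
    + apply Cmod_mult_le; [apply Cmod_mult_le; lra|]. eapply Rle_trans; [apply K3|].
      apply Rmult_le_compat_l; lra.
    + right; unfold d4; field; lra.
Qed.

Lemma cder_scal (c : C) (f : C -> C) (z u : C) :
  cder f z u -> cder (fun t => c * f t)%C z (c * u)%C.
Proof.
  intros H. replace (c * u)%C with (0 * f z + c * u)%C by ring.
  apply (cder_mult (fun _ => c)); auto using cder_const.
Qed.

Lemma cder_minus (f g : C -> C) (z u v : C) :
  cder f z u -> cder g z v -> cder (fun t => f t - g t)%C z (u - v)%C.
Proof.
  intros Hf Hg. replace (u - v)%C with (u + - (1) * v)%C by ring.
  apply cder_ext with (fun t => f t + - (1) * g t)%C; [intros; ring|].
  apply cder_plus; auto using cder_scal.
Qed.

Lemma cder_eq (f : C -> C) (z u v : C) : cder f z u -> u = v -> cder f z v.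
Proof. now intros H <-. Qed.

Lemma cder_shift (z0 z : C) : cder (fun t => t - z0)%C z 1%C.
Proof.
  eapply cder_eq; [apply (cder_minus (fun t => t) (fun _ => z0))|].
  - apply cder_id.
  - apply cder_const.
  - ring.
Qed.

Lemma cder_affine (c v z0 z : C) : cder (fun t => c + (t - z0) * v)%C z v.
Proof.
  eapply cder_eq.
  - apply (cder_plus (fun _ => c) (fun t => (t - z0) * v)%C); [apply cder_const|].
    apply (cder_mult (fun t => t - z0)%C (fun _ => v)); [apply cder_shift|apply cder_const].
  - ring.
Qed.

Lemma cder_comp (g k : C -> C) (z u v : C) :
  cder k z u -> cder g (k z) v -> cder (fun t => g (k t)) z (u * v)%C.
Proof.
  intros H1 H2 eps He.
  pose proof (Cmod_ge_0 u); pose proof (Cmod_ge_0 v).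
  destruct (cder_lip _ _ _ H1) as (d1 & Hd1 & K1).
  destruct (H1 (eps / (2 * (Cmod v + 1)))) as (d2 & Hd2 & K2); [apply Rdiv_lt_0_compat; lra|].
  destruct (H2 (eps / (2 * (Cmod u + 1)))) as (d3 & Hd3 & K3); [apply Rdiv_lt_0_compat; lra|].
  set (d4 := d3 / (Cmod u + 1)).
  assert (Hd4 : 0 < d4) by (apply Rdiv_lt_0_compat; lra).
  exists (Rmin (Rmin d1 d2) d4). split; [repeat apply Rmin_pos; auto|].
  intros s Hs; cbv beta.
  pose proof (Rmin_l (Rmin d1 d2) d4); pose proof (Rmin_r (Rmin d1 d2) d4).
  pose proof (Rmin_l d1 d2); pose proof (Rmin_r d1 d2).
  specialize (K1 s ltac:(lra)). specialize (K2 s ltac:(lra)).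
  set (e := (k (z + s) - k z)%C) in *.
  assert (He' : Cmod e < d3).
  { eapply Rle_lt_trans; [apply K1|].
    apply Rlt_le_trans with ((Cmod u + 1) * d4); [apply Rmult_lt_compat_l; lra|].
    right; unfold d4; field; lra. }
  specialize (K3 e He').
  replace (k z + e)%C with (k (z + s))%C in K3 by (unfold e; ring).
  replace (g (k (z + s)) - g (k z) - s * (u * v))%C
    with ((g (k (z + s)) - g (k z) - e * v) + (e - s * u) * v)%C by ring.
  replace (eps * Cmod s) with (eps * Cmod s / 2 + eps * Cmod s / 2) by field.
  pose proof (Cmod_ge_0 s).
  apply Cmod_plus_le.
  - eapply Rle_trans; [apply K3|].
    apply Rle_trans with (eps / (2 * (Cmod u + 1)) * ((Cmod u + 1) * Cmod s)).
    + apply Rmult_le_compat_l; auto. left; apply Rdiv_lt_0_compat; lra.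
    + right; field; lra.
  - apply Rle_trans with (eps / (2 * (Cmod v + 1)) * Cmod s * (Cmod v + 1)).
    + apply Cmod_mult_le; [auto|lra].
    + right; field; lra.
Qed.

Lemma cder_inv (z : C) : z <> 0%C -> cder (fun t => / t)%C z (- / (z * z))%C.
Proof.
  intros Hz eps He. apply Cmod_gt_0 in Hz as Hm.
  set (m := Cmod z) in *.
  (* The remainder is [s ^ 2 / ((z + s) * z ^ 2)]. The first bound keeps [z + s] at distance [m / 2]
     from 0, so the remainder is at most [2 * |s| ^ 2 / m ^ 3], and the second bound makes this at
     most [eps * |s|]. *)
  exists (Rmin (m / 2) (eps * m ^ 3 / 2)). split.
  { apply Rmin_pos; [lra|]. assert (0 < m ^ 3) by (now apply pow_lt). nra. }
  intros s Hs; cbv beta.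
  pose proof (Rmin_l (m / 2) (eps * m ^ 3 / 2)); pose proof (Rmin_r (m / 2) (eps * m ^ 3 / 2)).
  assert (Hzs : m / 2 <= Cmod (z + s)%C).
  { pose proof (Cmod_triangle_inv z (- s)%C) as T. rewrite Cmod_opp in T.
    replace (z - - s)%C with (z + s)%C in T by ring. fold m in T. lra. }
  assert (Hne : (z + s)%C <> 0%C) by (apply Cmod_gt_0; lra).
  replace (/ (z + s) - / z - s * - / (z * z))%C with (s * s / ((z + s) * (z * z)))%C
    by (field; auto).
  assert (Hn2 : ((z + s) * (z * z))%C <> 0%C) by (repeat apply Cmult_neq_0; auto).
  rewrite Cmod_div, !Cmod_mult by auto. fold m.
  pose proof (Cmod_ge_0 s).
  apply Rle_trans with (Cmod s * Cmod s / (m / 2 * (m * m))).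
  - apply Rmult_le_compat_l; [nra|]. apply Rinv_le_contravar; [nra|].
    apply Rmult_le_compat_r; nra.
  - apply Rle_trans with (Cmod s * (eps * m ^ 3 / 2) / (m / 2 * (m * m))).
    + apply Rmult_le_compat_r; [left; apply Rinv_0_lt_compat; assert (0 < m * m) by nra; nra|].
      apply Rmult_le_compat_l; lra.
    + right; field; lra.
Qed.

(** * Real paths *)

Lemma rder_comp (g : C -> C) (k : R -> C) (x : R) (u v : C) :
  rder k x u -> cder g (k x) v -> rder (fun t => g (k t)) x (u * v)%C.
Proof.
  intros H1 H2 eps He.
  (* The real path is extended to a function of a complex variable that is complex differentiable at
     0: the imaginary direction is filled in with the slope [u]. The complex chain rule then
     applies, and restricting to real [s] gives the claim. *)
  assert (H1' : cder (fun t => k (x + fst t)%R + (t - fst t) * u)%C 0 u).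
  { intros e He0. destruct (H1 e He0) as (d & Hd & K). exists d; split; auto. intros s Hs; cbv beta.
    replace (fst (0 + s)%C) with (fst s) by (simpl; ring).
    replace (fst (RtoC 0)) with 0 by reflexivity.
    replace (k (x + fst s)%R + (0 + s - fst s) * u - (k (x + 0)%R + (0 - 0) * u) - s * u)%C
      with (k (x + fst s)%R - k (x + 0)%R - fst s * u)%C by ring.
    rewrite Rplus_0_r. pose proof (Cmod_Re_le s).
    eapply Rle_trans; [apply K; lra|]. apply Rmult_le_compat_l; lra. }
  assert (E : (k (x + fst (RtoC 0))%R + (0 - fst (RtoC 0)) * u)%C = k x).
  { simpl. rewrite Rplus_0_r. ring. }
  rewrite <- E in H2.
  destruct (cder_comp _ _ _ _ _ H1' H2 eps He) as (d & Hd & K).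
  exists d; split; auto. intros s Hs; cbv beta.
  specialize (K (RtoC s)). rewrite Cmod_R in K. specialize (K Hs).
  replace (fst (0 + s)%C) with s in K by (simpl; ring).
  replace (0 + s - s)%C with (RtoC 0) in K by ring.
  rewrite E in K. replace (k (x + s)%R + 0 * u)%C with (k (x + s)%R) in K by ring. exact K.
Qed.

Lemma rder_line (g : C -> C) (z w u : C) (x : R) :
  cder g (z + x * w)%C u -> rder (fun s => g (z + s * w)%C) x (w * u)%C.
Proof.
  intros H. apply (rder_comp g (fun s => z + s * w)%C); auto.
  intros eps He. exists 1; split; [lra|]. intros s _; cbv beta.
  replace (z + (x + s)%R * w - (z + x * w) - s * w)%C with (RtoC 0)
    by (rewrite RtoC_plus; ring).
  rewrite Cmod_0. apply Rmult_le_pos; [lra|apply Rabs_pos].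
Qed.

Lemma is_derive_eps (f : R -> R) (x l : R) :
  (forall eps, 0 < eps -> exists d, 0 < d /\ forall s, Rabs s < d ->
     Rabs (f (x + s) - f x - s * l) <= eps * Rabs s) -> is_derive f x l.
Proof.
  intros H. apply is_derive_Reals. intros eps He.
  destruct (H (eps / 2)) as (d & Hd & K); [lra|].
  exists (mkposreal d Hd). intros s Hs Hsd. simpl in Hsd.
  replace ((f (x + s) - f x) / s - l) with ((f (x + s) - f x - s * l) / s) by (field; auto).
  unfold Rdiv. rewrite Rabs_mult, Rabs_inv.
  assert (0 < Rabs s) by (now apply Rabs_pos_lt).
  apply Rle_lt_trans with (eps / 2); [|lra].
  apply Rmult_le_reg_r with (Rabs s); auto.
  rewrite Rmult_assoc, Rinv_l, Rmult_1_r by lra. auto.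
Qed.

Lemma rder_Re (f : R -> C) (x : R) (v : C) :
  rder f x v -> is_derive (fun s => fst (f s)) x (fst v).
Proof.
  intros H. apply is_derive_eps. intros eps He.
  destruct (H eps He) as (d & Hd & K). exists d; split; auto. intros s Hs; cbv beta.
  eapply Rle_trans; [|apply (K s Hs)].
  replace (fst (f (x + s)) - fst (f x) - s * fst v)
    with (fst (f (x + s)%R - f x - s * v)%C) by (simpl; ring).
  apply Cmod_Re_le.
Qed.

Lemma rder_scal (c : C) (f : R -> C) (x : R) (v : C) :
  rder f x v -> rder (fun s => c * f s)%C x (v * c)%C.
Proof.
  intros H. apply (rder_comp (fun z => c * z)%C); auto.
  pose proof (cder_scal c _ _ _ (cder_id (f x))) as K. rewrite Cmult_1_r in K. exact K.
Qed.

Lemma rder_Im (f : R -> C) (x : R) (v : C) :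
  rder f x v -> is_derive (fun s => snd (f s)) x (snd v).
Proof.
  intros H. apply (rder_scal (- Ci)%C) in H. apply rder_Re in H.
  replace (snd v) with (fst (v * - Ci)%C) by (simpl; ring).
  eapply is_derive_ext; [|apply H]. intros t; simpl; ring.
Qed.

(* Apply the real mean value theorem to the component of [f] along [f b - f a]. *)
Lemma rder_bound (f : R -> C) (a b K : R) : a <= b ->
  (forall s, a <= s <= b -> exists v, rder f s v /\ Cmod v <= K) ->
  Cmod (f b - f a)%C <= K * (b - a).
Proof.
  intros Hab H. set (u := (f b - f a)%C).
  set (p := fun s => fst (Cconj u * f s)%C).
  assert (Hp : forall s, a <= s <= b -> exists v, is_derive p s (fst (v * Cconj u)%C) /\ Cmod v <= K).
  { intros s Hs. destruct (H s Hs) as (v & Hv & Kv). exists v; split; auto.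
    apply (rder_Re (fun s => Cconj u * f s)%C). now apply rder_scal. }
  destruct (MVT_gen p a b (Derive p)) as (c & Hc & E).
  - rewrite Rmin_left, Rmax_right by auto. intros x Hx.
    destruct (Hp x) as (v & Hv & _); [lra|]. apply Derive_correct. eexists; apply Hv.
  - rewrite Rmin_left, Rmax_right by auto. intros x Hx.
    destruct (Hp x) as (v & Hv & _); [lra|].
    apply derivable_continuous_pt. exists (fst (v * Cconj u)%C).
    now apply is_derive_Reals.
  - rewrite Rmin_left, Rmax_right in Hc by auto.
    destruct (Hp c Hc) as (v & Hv & Kv). apply is_derive_unique in Hv. rewrite Hv in E.
    assert (Eu : p b - p a = Cmod u * Cmod u).
    { unfold p. replace (fst (Cconj u * f b)%C - fst (Cconj u * f a)%C)
        with (Re (u * Cconj u)%C) by (unfold u, Cconj; simpl; ring).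
      rewrite <- Cmod2_conj. change (Cmod u ^ 2 = Cmod u * Cmod u). ring. }
    rewrite Eu in E.
    assert (B : fst (v * Cconj u)%C <= K * Cmod u).
    { eapply Rle_trans; [apply Rle_abs|]. eapply Rle_trans; [apply Cmod_Re_le|].
      apply Cmod_mult_le; auto. rewrite Cmod_conj; lra. }
    destruct (Rle_lt_or_eq_dec 0 (Cmod u) (Cmod_ge_0 u)) as [h|h].
    + apply Rmult_le_reg_l with (Cmod u); auto.
      rewrite E. replace (Cmod u * (K * (b - a))) with (K * Cmod u * (b - a)) by ring.
      apply Rmult_le_compat_r; lra.
    + rewrite <- h. pose proof (Cmod_ge_0 v). nra.
Qed.

Lemma cder_bound (g : C -> C) (z w : C) (K : R) :
  (forall s : R, 0 <= s <= 1 -> exists v, cder g (z + s * w)%C v /\ Cmod v <= K) ->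
  Cmod (g (z + w) - g z)%C <= K * Cmod w.
Proof.
  intros H.
  assert (B : Cmod (g (z + RtoC 1 * w) - g (z + RtoC 0 * w))%C <= (Cmod w * K) * (1 - 0)).
  { apply (rder_bound (fun s => g (z + RtoC s * w)%C)); [lra|].
    intros s Hs. destruct (H s Hs) as (v & Hv & Kv).
    exists (w * v)%C; split; [now apply rder_line|]. apply Cmod_mult_le; lra. }
  replace (z + RtoC 1 * w)%C with (z + w)%C in B by ring.
  replace (z + RtoC 0 * w)%C with z in B by ring. lra.
Qed.
(** * Goursat's theorem on rectangles *)

Definition rcont (f : R -> C) (x : R) : Prop :=
  forall eps, 0 < eps -> exists d, 0 < d /\ forall s, Rabs s < d -> Cmod (f (x + s)%R - f x)%C <= eps.

Lemma rder_rcont (f : R -> C) (x : R) (v : C) : rder f x v -> rcont f x.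
Proof.
  intros H eps He. destruct (H 1) as (d & Hd & K); [lra|].
  pose proof (Cmod_ge_0 v).
  exists (Rmin d (eps / (Cmod v + 1))). split.
  { apply Rmin_pos; auto. apply Rdiv_lt_0_compat; lra. }
  intros s Hs.
  pose proof (Rmin_l d (eps / (Cmod v + 1))); pose proof (Rmin_r d (eps / (Cmod v + 1))).
  specialize (K s ltac:(lra)).
  replace (f (x + s)%R - f x)%C with ((f (x + s)%R - f x - s * v) + s * v)%C by ring.
  apply Rle_trans with (1 * Rabs s + Rabs s * Cmod v).
  - apply Cmod_plus_le; auto. rewrite Cmod_mult, Cmod_R; lra.
  - replace eps with (eps / (Cmod v + 1) * (Cmod v + 1)) by (field; lra). nra.
Qed.

Lemma continuous_eps (f : R -> R) (x : R) :
  (forall eps, 0 < eps -> exists d, 0 < d /\ forall s, Rabs s < d -> Rabs (f (x + s) - f x) <= eps) ->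
  continuous f x.
Proof.
  intros H. apply continuity_pt_filterlim. intros eps He.
  destruct (H (eps / 2)) as (d & Hd & K); [lra|].
  exists d; split; auto. intros y [_ Hy]. simpl in *. unfold R_dist in *.
  specialize (K (y - x) Hy). replace (x + (y - x)) with y in K by ring. lra.
Qed.

Lemma rcont_Re (f : R -> C) (x : R) : rcont f x -> continuous (fun s => fst (f s)) x.
Proof.
  intros H. apply continuous_eps. intros eps He. destruct (H eps He) as (d & Hd & K).
  exists d; split; auto. intros s Hs. eapply Rle_trans; [|apply (K s Hs)].
  apply (Cmod_Re_le (f (x + s)%R - f x)%C).
Qed.

Lemma rcont_Im (f : R -> C) (x : R) : rcont f x -> continuous (fun s => snd (f s)) x.
Proof.
  intros H. apply continuous_eps. intros eps He. destruct (H eps He) as (d & Hd & K).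
  exists d; split; auto. intros s Hs. eapply Rle_trans; [|apply (K s Hs)].
  apply (Cmod_Im_le (f (x + s)%R - f x)%C).
Qed.

Definition Cint (f : R -> C) (a b : R) : C :=
  (RInt (fun x => fst (f x)) a b, RInt (fun x => snd (f x)) a b).

Lemma rcont_ex_RInt (f : R -> C) (a b : R) : a <= b ->
  (forall x, a <= x <= b -> rcont f x) ->
  ex_RInt (fun x => fst (f x)) a b /\ ex_RInt (fun x => snd (f x)) a b.
Proof.
  intros Hab H.
  split; apply (@ex_RInt_continuous R_CompleteNormedModule);
    rewrite Rmin_left, Rmax_right by auto; intros; [apply rcont_Re|apply rcont_Im]; auto.
Qed.

Lemma Cint_ext (f g : R -> C) (a b : R) : a <= b ->
  (forall x, a < x < b -> f x = g x) -> Cint f a b = Cint g a b.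
Proof.
  intros Hab H. unfold Cint. f_equal; apply RInt_ext; rewrite Rmin_left, Rmax_right by auto;
    intros x Hx; rewrite H; auto.
Qed.

(** The factor 2 comes from bounding the real and imaginary parts separately. It reappears as the 2
    of [cauchy_estimate] and as half of the 4 in [Qop_bound]. *)
Lemma Cint_bound (f : R -> C) (a b M : R) : a <= b ->
  (forall x, a <= x <= b -> rcont f x) -> (forall x, a <= x <= b -> Cmod (f x) <= M) ->
  Cmod (Cint f a b) <= 2 * M * (b - a).
Proof.
  intros Hab Hc HM. destruct (rcont_ex_RInt f a b Hab Hc) as [I1 I2].
  eapply Rle_trans; [apply Cmod_le_Re_Im|]. unfold Cint; simpl fst; simpl snd.
  replace (2 * M * (b - a)) with ((b - a) * M + (b - a) * M) by ring.
  apply Rplus_le_compat; apply abs_RInt_le_const; auto;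
    intros t Ht; (eapply Rle_trans; [|apply HM, Ht]); [apply Cmod_Re_le|apply Cmod_Im_le].
Qed.

Lemma Cint_minus (f g : R -> C) (a b : R) : a <= b ->
  (forall x, a <= x <= b -> rcont f x) -> (forall x, a <= x <= b -> rcont g x) ->
  Cint (fun x => f x - g x)%C a b = (Cint f a b - Cint g a b)%C.
Proof.
  intros Hab Hf Hg. destruct (rcont_ex_RInt f a b Hab Hf) as [E1 E2].
  destruct (rcont_ex_RInt g a b Hab Hg) as [E3 E4].
  unfold Cint. apply injective_projections; simpl.
  - exact (RInt_minus (fun x => fst (f x)) (fun x => fst (g x)) a b E1 E3).
  - exact (RInt_minus (fun x => snd (f x)) (fun x => snd (g x)) a b E2 E4).
Qed.

Lemma Cint_Chasles (f : R -> C) (a b c : R) : a <= b <= c ->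
  (forall x, a <= x <= c -> rcont f x) ->
  Cint f a c = (Cint f a b + Cint f b c)%C.
Proof.
  intros Hab Hf.
  destruct (rcont_ex_RInt f a b) as [E1 E2]; [lra|intros; apply Hf; lra|].
  destruct (rcont_ex_RInt f b c) as [E3 E4]; [lra|intros; apply Hf; lra|].
  unfold Cint. apply injective_projections; simpl; symmetry.
  - exact (RInt_Chasles (fun x => fst (f x)) a b c E1 E3).
  - exact (RInt_Chasles (fun x => snd (f x)) a b c E2 E4).
Qed.

Lemma Cint_derive (F f : R -> C) (a b : R) : a <= b ->
  (forall x, a <= x <= b -> rder F x (f x)) -> (forall x, a <= x <= b -> rcont f x) ->
  Cint f a b = (F b - F a)%C.
Proof.
  intros Hab HF Hf. unfold Cint. apply injective_projections; simpl; apply is_RInt_unique;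
    [apply (is_RInt_derive (fun x => fst (F x)))|apply (is_RInt_derive (fun x => snd (F x)))];
    rewrite Rmin_left, Rmax_right by auto; intros x Hx.
  - apply (rder_Re F x (f x)); auto.
  - now apply rcont_Re, Hf.
  - apply (rder_Im F x (f x)); auto.
  - now apply rcont_Im, Hf.
Qed.

Lemma rder_horizontal (h : C -> C) (x y : R) (v : C) :
  cder h (x, y) v -> rder (fun s => h (s, y)) x v.
Proof.
  intros H. replace v with (1 * v)%C by ring. apply (rder_comp h (fun s => (s, y))); auto.
  intros eps He. exists 1; split; [lra|]. intros s _.
  replace ((x + s)%R, y) with ((x, y) + s)%C by (apply injective_projections; simpl; ring).
  replace ((x, y) + s - (x, y) - s * 1)%C with (RtoC 0) by ring.
  rewrite Cmod_0. apply Rmult_le_pos; [lra|apply Rabs_pos].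
Qed.

Lemma rder_vertical (h : C -> C) (x y : R) (v : C) :
  cder h (x, y) v -> rder (fun s => h (x, s)) y (Ci * v)%C.
Proof.
  intros H. apply (rder_comp h (fun s => (x, s))); auto.
  intros eps He. exists 1; split; [lra|]. intros s _.
  replace (x, (y + s)%R) with ((x, y) + s * Ci)%C by (apply injective_projections; simpl; ring).
  replace ((x, y) + s * Ci - (x, y) - s * Ci)%C with (RtoC 0) by ring.
  rewrite Cmod_0. apply Rmult_le_pos; [lra|apply Rabs_pos].
Qed.

(** The integral of [h dz] counterclockwise around the rectangle with real side [[a, b]] and
    imaginary side [[c, d]]; the factor [Ci] is [dz = i dy] on the vertical sides. *)
Definition bdry (h : C -> C) (a b c d : R) : C :=
  (Cint (fun x => h (x, c)) a b + Ci * Cint (fun y => h (b, y)) c d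
   - Cint (fun x => h (x, d)) a b - Ci * Cint (fun y => h (a, y)) c d)%C.

Definition holo_rect (h : C -> C) (a b c d : R) : Prop :=
  forall x y, a <= x <= b -> c <= y <= d -> exists v, cder h (x, y) v.

Lemma holo_rcont_h (h : C -> C) (a b c d y : R) : holo_rect h a b c d -> c <= y <= d ->
  forall x, a <= x <= b -> rcont (fun s => h (s, y)) x.
Proof.
  intros H Hy x Hx. destruct (H x y Hx Hy) as [v Hv].
  eapply rder_rcont. apply rder_horizontal, Hv.
Qed.

Lemma holo_rcont_v (h : C -> C) (a b c d x : R) : holo_rect h a b c d -> a <= x <= b ->
  forall y, c <= y <= d -> rcont (fun s => h (x, s)) y.
Proof.
  intros H Hx y Hy. destruct (H x y Hx Hy) as [v Hv].
  eapply rder_rcont. apply rder_vertical, Hv.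
Qed.

Lemma bdry_primitive (P h : C -> C) (a b c d : R) : a <= b -> c <= d ->
  (forall z, cder P z (h z)) -> holo_rect h a b c d -> bdry h a b c d = 0%C.
Proof.
  intros Hab Hcd HP Hh. unfold bdry.
  assert (Hhor : forall y, c <= y <= d -> Cint (fun x => h (x, y)) a b = (P (b, y) - P (a, y))%C).
  { intros y Hy. apply (Cint_derive (fun x => P (x, y))); auto.
    - intros x Hx. now apply rder_horizontal.
    - eapply holo_rcont_h; eauto. }
  assert (Hver : forall x, a <= x <= b ->
    Cint (fun y => h (x, y)) c d = (- Ci * P (x, d) - - Ci * P (x, c))%C).
  { intros x Hx. apply (Cint_derive (fun y => - Ci * P (x, y))%C); auto.
    - intros y Hy. assert (E : h (x, y) = (Ci * h (x, y) * - Ci)%C).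
      { replace (Ci * h (x, y) * - Ci)%C with (- (Ci * Ci) * h (x, y))%C by ring.
        replace (- (Ci * Ci))%C with (RtoC 1) by (apply injective_projections; simpl; ring). ring. }
      rewrite E. apply rder_scal, rder_vertical; auto.
    - eapply holo_rcont_v; eauto. }
  rewrite !Hhor, !Hver by lra.
  assert (E : (Ci * Ci)%C = (- (1))%C) by (apply injective_projections; simpl; ring).
  transitivity (P (b, c) - P (a, c) - (Ci * Ci) * (P (b, d) - P (b, c))
    - (P (b, d) - P (a, d)) + (Ci * Ci) * (P (a, d) - P (a, c)))%C; [ring|].
  rewrite E. ring.
Qed.

Lemma bdry_minus (h k : C -> C) (a b c d : R) : a <= b -> c <= d ->
  holo_rect h a b c d -> holo_rect k a b c d ->
  bdry (fun z => h z - k z)%C a b c d = (bdry h a b c d - bdry k a b c d)%C.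
Proof.
  intros Hab Hcd Hh Hk. unfold bdry.
  assert (Hhor : forall y, c <= y <= d -> Cint (fun x => h (x, y) - k (x, y))%C a b =
    (Cint (fun x => h (x, y)) a b - Cint (fun x => k (x, y)) a b)%C).
  { intros y Hy. apply (Cint_minus (fun x => h (x, y)) (fun x => k (x, y))); auto;
    eapply holo_rcont_h; eauto. }
  assert (Hver : forall x, a <= x <= b -> Cint (fun y => h (x, y) - k (x, y))%C c d =
    (Cint (fun y => h (x, y)) c d - Cint (fun y => k (x, y)) c d)%C).
  { intros x Hx. apply (Cint_minus (fun y => h (x, y)) (fun y => k (x, y))); auto;
    eapply holo_rcont_v; eauto. }
  rewrite !Hhor, !Hver by lra. ring.
Qed.

Lemma bdry_bound (h : C -> C) (a b c d M : R) : a <= b -> c <= d ->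
  holo_rect h a b c d ->
  (forall x y, a <= x <= b -> c <= y <= d -> Cmod (h (x, y)) <= M) ->
  Cmod (bdry h a b c d) <= 4 * M * ((b - a) + (d - c)).
Proof.
  intros Hab Hcd Hh HM. unfold bdry.
  assert (Hhor : forall y, c <= y <= d -> Cmod (Cint (fun x => h (x, y)) a b) <= 2 * M * (b - a)).
  { intros y Hy. apply Cint_bound; auto. eapply holo_rcont_h; eauto. }
  assert (Hver : forall x, a <= x <= b ->
    Cmod (Ci * Cint (fun y => h (x, y)) c d)%C <= 2 * M * (d - c)).
  { intros x Hx. rewrite Cmod_mult, Cmod_Ci, Rmult_1_l. apply Cint_bound; auto.
    eapply holo_rcont_v; eauto. }
  replace (4 * M * (b - a + (d - c))) with
    (2 * M * (b - a) + 2 * M * (d - c) + 2 * M * (b - a) + 2 * M * (d - c)) by ring.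
  repeat first [apply Cmod_minus_le | apply Cmod_plus_le]; (apply Hhor || apply Hver); lra.
Qed.

Lemma holo_rect_sub (h : C -> C) (a b c d a' b' c' d' : R) :
  a <= a' -> b' <= b -> c <= c' -> d' <= d -> holo_rect h a b c d -> holo_rect h a' b' c' d'.
Proof. intros ? ? ? ? H x y Hx Hy. apply H; lra. Qed.

Lemma bdry_split (h : C -> C) (a m b c n d : R) : a <= m <= b -> c <= n <= d ->
  holo_rect h a b c d ->
  bdry h a b c d = (bdry h a m c n + bdry h m b c n + (bdry h a m n d + bdry h m b n d))%C.
Proof.
  intros Hm Hn Hh. unfold bdry.
  assert (Hhor : forall y, c <= y <= d -> Cint (fun x => h (x, y)) a b =
    (Cint (fun x => h (x, y)) a m + Cint (fun x => h (x, y)) m b)%C).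
  { intros y Hy. apply Cint_Chasles; auto. eapply holo_rcont_h; eauto. }
  assert (Hver : forall x, a <= x <= b -> Cint (fun y => h (x, y)) c d =
    (Cint (fun y => h (x, y)) c n + Cint (fun y => h (x, y)) n d)%C).
  { intros x Hx. apply Cint_Chasles; auto. eapply holo_rcont_v; eauto. }
  rewrite !Hhor, !Hver by lra. ring.
Qed.

(** Provides the limit points twice: where the bisected rectangles of [goursat] meet, and for
    sequences with geometric increments in [Rseq_geom]. *)
Lemma nested_intervals (a b : nat -> R) :
  (forall n, a n <= a (S n)) -> (forall n, b (S n) <= b n) -> (forall n, a n <= b n) ->
  exists x, forall n, a n <= x <= b n.
Proof.
  intros Ha Hb Hab.
  assert (Ha' : forall n k, a n <= a (n + k)%nat).
  { intros n k; induction k; [rewrite Nat.add_0_r; lra|rewrite Nat.add_succ_r].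
    eapply Rle_trans; eauto. }
  assert (Hb' : forall n k, b (n + k)%nat <= b n).
  { intros n k; induction k; [rewrite Nat.add_0_r; lra|rewrite Nat.add_succ_r].
    eapply Rle_trans; eauto. }
  assert (H : forall n m, a n <= b m).
  { intros n m. apply Rle_trans with (a (n + m)%nat); auto.
    apply Rle_trans with (b (n + m)%nat); auto. rewrite Nat.add_comm; auto. }
  destruct (completeness (fun x => exists n, x = a n)) as [x [U L]].
  - exists (b 0%nat). intros y [n ->]; auto.
  - exists (a 0%nat); eauto.
  - exists x. intros n; split; [apply U; eauto|]. apply L. intros y [k ->]; auto.
Qed.

Definition rect : Type := ((R * R) * (R * R))%type.
Definition bdry_r (h : C -> C) (q : rect) : C :=
  bdry h (fst (fst q)) (snd (fst q)) (fst (snd q)) (snd (snd q)).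
Definition half_interval (i j : R * R) : Prop :=
  fst i <= fst j /\ snd j <= snd i /\ snd j - fst j = (snd i - fst i) / 2.
Definition quarter (q r : rect) : Prop :=
  half_interval (fst q) (fst r) /\ half_interval (snd q) (snd r).

Lemma goursat_step (h : C -> C) (q : rect) :
  fst (fst q) <= snd (fst q) -> fst (snd q) <= snd (snd q) ->
  holo_rect h (fst (fst q)) (snd (fst q)) (fst (snd q)) (snd (snd q)) ->
  exists r, quarter q r /\ Cmod (bdry_r h q) <= 4 * Cmod (bdry_r h r).
Proof.
  destruct q as [[a b] [c d]]; unfold bdry_r; simpl. intros Hab Hcd Hh.
  set (m := (a + b) / 2). set (n := (c + d) / 2).
  assert (Hm : a <= m <= b) by (unfold m; lra). assert (Hn : c <= n <= d) by (unfold n; lra).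
  rewrite (bdry_split h a m b c n d) by auto.
  set (j1 := bdry h a m c n). set (j2 := bdry h m b c n).
  set (j3 := bdry h a m n d). set (j4 := bdry h m b n d).
  assert (T : Cmod (j1 + j2 + (j3 + j4))%C <= Cmod j1 + Cmod j2 + (Cmod j3 + Cmod j4)).
  { repeat apply Cmod_plus_le; lra. }
  set (j := Cmod (j1 + j2 + (j3 + j4))%C) in *.
  assert (Q : j <= 4 * Cmod j1 \/ j <= 4 * Cmod j2 \/ j <= 4 * Cmod j3 \/ j <= 4 * Cmod j4) by lra.
  destruct Q as [Q|[Q|[Q|Q]]];
    [exists ((a, m), (c, n))|exists ((m, b), (c, n))|exists ((a, m), (n, d))|exists ((m, b), (n, d))];
    (split; [unfold quarter, half_interval, m, n; simpl; lra|exact Q]).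
Qed.

Theorem goursat (h : C -> C) (a b c d : R) : a <= b -> c <= d ->
  holo_rect h a b c d -> bdry h a b c d = 0%C.
Proof.
  intros Hab Hcd Hh.
  (* The choice is meaningful only where [goursat_step] applies. [Inv] therefore carries along that
     each rectangle lies in the original one and is not reversed. *)
  set (step := fun q => epsilon (inhabits q)
     (fun r => quarter q r /\ Cmod (bdry_r h q) <= 4 * Cmod (bdry_r h r))).
  set (q := fun n => Nat.iter n step ((a, b), (c, d))).
  set (A := fun n => fst (fst (q n))). set (B := fun n => snd (fst (q n))).
  set (D := fun n => fst (snd (q n))). set (E := fun n => snd (snd (q n))).
  assert (Inv : forall n, (a <= A n /\ B n <= b /\ B n - A n = (b - a) / 2 ^ n) /\
    (c <= D n /\ E n <= d /\ E n - D n = (d - c) / 2 ^ n) /\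
    quarter (q n) (q (S n)) /\ Cmod (bdry h a b c d) <= 4 ^ n * Cmod (bdry_r h (q n))).
  { assert (St : forall n, (a <= A n /\ B n <= b /\ B n - A n = (b - a) / 2 ^ n) ->
      (c <= D n /\ E n <= d /\ E n - D n = (d - c) / 2 ^ n) ->
      quarter (q n) (q (S n)) /\ Cmod (bdry_r h (q n)) <= 4 * Cmod (bdry_r h (q (S n)))).
    { intros n H1 H2. change (q (S n)) with (step (q n)). unfold step.
      apply epsilon_spec. assert (P : 0 < / 2 ^ n) by (apply Rinv_0_lt_compat, pow_lt; lra).
      unfold Rdiv in *.
      assert (0 <= (b - a) * / 2 ^ n) by (apply Rmult_le_pos; lra).
      assert (0 <= (d - c) * / 2 ^ n) by (apply Rmult_le_pos; lra).
      apply goursat_step; fold (A n) (B n) (D n) (E n); try lra.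
      eapply holo_rect_sub; [| | | |apply Hh]; lra. }
    induction n.
    - assert (I1 : a <= A 0%nat /\ B 0%nat <= b /\ B 0%nat - A 0%nat = (b - a) / 2 ^ 0)
        by (unfold A, B; simpl; lra).
      assert (I2 : c <= D 0%nat /\ E 0%nat <= d /\ E 0%nat - D 0%nat = (d - c) / 2 ^ 0)
        by (unfold D, E; simpl; lra).
      destruct (St 0%nat I1 I2) as [S1 S2]. repeat split; try apply I1; try apply I2; try apply S1.
      unfold bdry_r; simpl. lra.
    - destruct IHn as (I1 & I2 & [Q1 Q2] & I3).
      destruct (St n I1 I2) as [_ Sn].
      unfold half_interval in Q1, Q2. fold (A n) (B n) (D n) (E n) in Q1, Q2.
      fold (A (S n)) (B (S n)) (D (S n)) (E (S n)) in Q1, Q2.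
      assert (P : 0 < 2 ^ n) by (apply pow_lt; lra).
      assert (I1' : a <= A (S n) /\ B (S n) <= b /\ B (S n) - A (S n) = (b - a) / 2 ^ (S n)).
      { replace ((b - a) / 2 ^ S n) with ((b - a) / 2 ^ n / 2) by (simpl; field; lra). lra. }
      assert (I2' : c <= D (S n) /\ E (S n) <= d /\ E (S n) - D (S n) = (d - c) / 2 ^ (S n)).
      { replace ((d - c) / 2 ^ S n) with ((d - c) / 2 ^ n / 2) by (simpl; field; lra). lra. }
      destruct (St (S n) I1' I2') as [S1 S2].
      split; [apply I1'|]. split; [apply I2'|]. split; [apply S1|].
      eapply Rle_trans; [apply I3|]. change (4 ^ S n) with (4 * 4 ^ n).
      assert (0 < 4 ^ n) by (apply pow_lt; lra).
      replace (4 * 4 ^ n * Cmod (bdry_r h (q (S n)))) with (4 ^ n * (4 * Cmod (bdry_r h (q (S n)))))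
        by ring.
      apply Rmult_le_compat_l; lra. }
  assert (Pn : forall n, 0 < / 2 ^ n) by (intros; apply Rinv_0_lt_compat, pow_lt; lra).
  assert (La : forall n, A n <= B n).
  { intros n. destruct (Inv n) as (I1 & _). specialize (Pn n). unfold Rdiv in I1.
    assert (0 <= (b - a) * / 2 ^ n) by (apply Rmult_le_pos; lra). lra. }
  assert (Lc : forall n, D n <= E n).
  { intros n. destruct (Inv n) as (_ & I1 & _). specialize (Pn n). unfold Rdiv in I1.
    assert (0 <= (d - c) * / 2 ^ n) by (apply Rmult_le_pos; lra). lra. }
  destruct (nested_intervals A B) as [x Hx]; auto.
  { intros n. destruct (Inv n) as (_ & _ & [[Q _] _] & _). exact Q. }
  { intros n. destruct (Inv n) as (_ & _ & [[_ [Q _]] _] & _). exact Q. }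
  destruct (nested_intervals D E) as [y Hy]; auto.
  { intros n. destruct (Inv n) as (_ & _ & [_ [Q _]] & _). exact Q. }
  { intros n. destruct (Inv n) as (_ & _ & [_ [_ [Q _]]] & _). exact Q. }
  assert (Hx0 : a <= x <= b) by (specialize (Hx 0%nat); unfold A, B in Hx; simpl in Hx; lra).
  assert (Hy0 : c <= y <= d) by (specialize (Hy 0%nat); unfold D, E in Hy; simpl in Hy; lra).
  destruct (Hh x y Hx0 Hy0) as [v Hv].
  set (l := (b - a) + (d - c)). assert (Hl : 0 <= l) by (unfold l; lra).
  apply Cmod_small_eq_0. intros eps He.
  (* Diameter and perimeter of the n-th rectangle both shrink like [l / 2 ^ n], which cancels the
     factor [4 ^ n] and leaves the bound [4 * e * l ^ 2]. The [+ 1] covers a rectangle reduced to a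
     point. *)
  set (e := eps / (4 * (l * l + 1))).
  assert (He' : 0 < e) by (apply Rdiv_lt_0_compat; nra).
  destruct (Hv e He') as (delta & Hd & K).
  assert (Hn : exists n, l / 2 ^ n < delta).
  { destruct (pow_lt_1_zero (/ 2)) with (y := delta / (l + 1)) as [n Hn].
    - rewrite Rabs_pos_eq; lra.
    - apply Rdiv_lt_0_compat; lra.
    - exists n. specialize (Hn n (le_n n)). rewrite pow_inv in Hn. specialize (Pn n).
      rewrite Rabs_pos_eq in Hn by lra. unfold Rdiv.
      apply Rle_lt_trans with ((l + 1) * / 2 ^ n); [nra|].
      replace delta with ((l + 1) * (delta / (l + 1))) by (field; lra).
      apply Rmult_lt_compat_l; lra. }
  destruct Hn as [n Hn]. destruct (Inv n) as (I1 & I2 & _ & I3).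
  specialize (La n). specialize (Lc n). specialize (Hx n). specialize (Hy n). specialize (Pn n).
  set (z0 := (x, y) : C).
  (* The affine part of [h] at the limit point has a primitive, so it contributes nothing to the
     boundary integral; only the remainder, of size [e * |z - z0|], is left. *)
  set (p := fun z => (h z0 + (z - z0) * v)%C).
  assert (Hp : forall z, cder p z v).
  { intros z. apply cder_affine. }
  assert (Hpr : holo_rect p (A n) (B n) (D n) (E n)) by (intros ? ? _ _; eauto).
  assert (Hhr : holo_rect h (A n) (B n) (D n) (E n))
    by (eapply holo_rect_sub; [| | | |apply Hh]; lra).
  assert (Zp : bdry p (A n) (B n) (D n) (E n) = 0%C).
  { apply (bdry_primitive (fun z => (h z0 * z + (/ 2 * v) * ((z - z0) * (z - z0))))%C); auto.
    intros z. eapply cder_eq.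
    - apply (cder_plus (fun z => h z0 * z)%C);
        [apply (cder_scal _ (fun z => z)), cder_id|].
      apply (cder_scal _ (fun z => (z - z0) * (z - z0))%C).
      apply (cder_mult (fun z => z - z0)%C); apply cder_shift.
    - unfold p. field. }
  assert (Zh : bdry_r h (q n) = bdry (fun z => h z - p z)%C (A n) (B n) (D n) (E n)).
  { rewrite bdry_minus, Zp by auto. unfold bdry_r. fold (A n) (B n) (D n) (E n). ring. }
  set (L := l / 2 ^ n) in *.
  assert (HL : (B n - A n) + (E n - D n) = L) by (unfold L, l, Rdiv in *; lra).
  assert (Bd : Cmod (bdry_r h (q n)) <= 4 * (e * L) * ((B n - A n) + (E n - D n))).
  { rewrite Zh. apply bdry_bound; auto.
    - intros x' y' Hx' Hy'. destruct (Hhr x' y' Hx' Hy') as [u Hu].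
      exists (u - v)%C. now apply cder_minus.
    - intros x' y' Hx' Hy'.
      set (s := ((x' - x)%R, (y' - y)%R) : C).
      assert (Hs : Cmod s <= L).
      { eapply Rle_trans; [apply Cmod_le_Re_Im|]. unfold s; simpl.
        assert (Rabs (x' - x) <= B n - A n) by (apply Rabs_le; lra).
        assert (Rabs (y' - y) <= E n - D n) by (apply Rabs_le; lra). lra. }
      replace (x', y') with (z0 + s)%C
        by (apply injective_projections; unfold z0, s; simpl; ring).
      unfold p. replace (h (z0 + s) - (h z0 + (z0 + s - z0) * v))%C
        with (h (z0 + s) - h z0 - s * v)%C by ring.
      eapply Rle_trans; [apply K; lra|]. apply Rmult_le_compat_l; lra. }
  rewrite HL in Bd. eapply Rle_trans; [apply I3|].
  assert (P4 : 0 < 4 ^ n) by (apply pow_lt; lra).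
  apply Rle_trans with (4 ^ n * (4 * (e * L) * L)); [apply Rmult_le_compat_l; lra|].
  replace (4 ^ n) with (2 ^ n * 2 ^ n) by (rewrite <- Rpow_mult_distr; f_equal; lra).
  assert (P2 : 0 < 2 ^ n) by (apply pow_lt; lra).
  replace (2 ^ n * 2 ^ n * (4 * (e * L) * L)) with (4 * e * (l * l)) by (unfold L; field; lra).
  replace eps with (4 * e * (l * l + 1)) by (unfold e; field; nra). nra.
Qed.
(** * Cauchy estimates *)

Definition cexp (z : C) : C := (exp (fst z) * cos (snd z), exp (fst z) * sin (snd z)).

Lemma cexp_plus (z w : C) : cexp (z + w)%C = (cexp z * cexp w)%C.
Proof.
  unfold cexp; apply injective_projections; simpl;
    rewrite exp_plus, ?cos_plus, ?sin_plus; ring.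
Qed.

Lemma cexp_0 : cexp 0%C = 1%C.
Proof.
  unfold cexp; apply injective_projections; simpl; rewrite exp_0, ?cos_0, ?sin_0; ring.
Qed.

Lemma Cmod_cexp (z : C) : Cmod (cexp z) = exp (fst z).
Proof.
  unfold Cmod, cexp; simpl fst; simpl snd.
  replace ((exp (fst z) * cos (snd z)) ^ 2 + (exp (fst z) * sin (snd z)) ^ 2)
    with (exp (fst z) * exp (fst z) * (Rsqr (sin (snd z)) + Rsqr (cos (snd z))))
    by (unfold Rsqr; ring).
  rewrite sin2_cos2, Rmult_1_r. apply sqrt_square. left; apply exp_pos.
Qed.

Lemma cexp_opp_r (z : C) : (cexp z * cexp (- z))%C = 1%C.
Proof. rewrite <- cexp_plus. replace (z + - z)%C with (RtoC 0) by ring. apply cexp_0. Qed.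

Lemma derivable_pt_lim_eps (f : R -> R) (x l : R) : derivable_pt_lim f x l ->
  forall eps, 0 < eps -> exists d, 0 < d /\ forall s, Rabs s < d ->
    Rabs (f (x + s) - f x - s * l) <= eps * Rabs s.
Proof.
  intros H eps He. destruct (H eps He) as [d K]. exists d; split; [apply cond_pos|].
  intros s Hs. destruct (Req_dec s 0) as [->|Hn].
  - rewrite Rplus_0_r, Rabs_R0. replace (f x - f x - 0 * l) with 0 by ring.
    rewrite Rabs_R0; lra.
  - replace (f (x + s) - f x - s * l) with (((f (x + s) - f x) / s - l) * s) by (field; auto).
    rewrite Rabs_mult. apply Rmult_le_compat_r; [apply Rabs_pos|]. left; now apply K.
Qed.

Lemma Rabs_mult_le (a b A B : R) : Rabs a <= A -> Rabs b <= B -> Rabs (a * b) <= A * B.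
Proof. intros; rewrite Rabs_mult; apply Rmult_le_compat; auto using Rabs_pos. Qed.

Lemma Rabs_plus_le (a b A B : R) : Rabs a <= A -> Rabs b <= B -> Rabs (a + b) <= A + B.
Proof. intros; eapply Rle_trans; [apply Rabs_triang|lra]. Qed.

Lemma cder_cexp_0 : cder cexp 0%C 1%C.
Proof.
  (* The real and the imaginary part of the error split into three terms each, all at most [e * m]
     with [m = |s|]. The conditions [e <= 1] and [|s| < e / 2] serve to get [|sin y| <= e]. *)
  intros eps He. set (e := Rmin (eps / 6) 1).
  assert (He0 : 0 < e) by (apply Rmin_pos; lra).
  assert (He1 : e <= 1) by apply Rmin_r. assert (He6 : e <= eps / 6) by apply Rmin_l.
  destruct (derivable_pt_lim_eps _ _ _ (derivable_pt_lim_exp 0) e He0) as (d1 & Hd1 & K1).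
  destruct (derivable_pt_lim_eps _ _ _ (derivable_pt_lim_sin 0) e He0) as (d2 & Hd2 & K2).
  destruct (derivable_pt_lim_eps _ _ _ (derivable_pt_lim_cos 0) e He0) as (d3 & Hd3 & K3).
  exists (Rmin (Rmin d1 d2) (Rmin d3 (e / 2))); split; [repeat apply Rmin_pos; lra|].
  intros s Hs.
  pose proof (Rmin_l (Rmin d1 d2) (Rmin d3 (e / 2))).
  pose proof (Rmin_r (Rmin d1 d2) (Rmin d3 (e / 2))).
  pose proof (Rmin_l d1 d2); pose proof (Rmin_r d1 d2).
  pose proof (Rmin_l d3 (e / 2)); pose proof (Rmin_r d3 (e / 2)).
  pose proof (Cmod_Re_le s) as Hx. pose proof (Cmod_Im_le s) as Hy.
  pose proof (Rabs_pos (fst s)); pose proof (Rabs_pos (snd s)).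
  specialize (K1 (fst s) ltac:(lra)). specialize (K2 (snd s) ltac:(lra)).
  specialize (K3 (snd s) ltac:(lra)).
  rewrite exp_0 in K1. rewrite sin_0, cos_0 in K2. rewrite cos_0, sin_0 in K3.
  rewrite Rplus_0_l in *.
  rewrite cexp_0. replace (cexp (0 + s)%C) with (cexp s) by (f_equal; ring).
  destruct s as [x y]; simpl fst in *; simpl snd in *.
  set (m := Cmod (x, y)) in *.
  assert (B1 : Rabs (exp x - 1 - x * 1) <= e * m) by nra.
  assert (B2 : Rabs (sin y - 0 - y * 1) <= e * m) by nra.
  assert (B3 : Rabs (cos y - 1 - y * - 0) <= e * m) by nra.
  assert (B3' : Rabs (cos y - 1 - y * - 0) <= e) by nra.
  assert (B2' : Rabs (sin y) <= e).
  { replace (sin y) with ((sin y - 0 - y * 1) + y) by ring.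
    apply Rle_trans with (e * (e / 2) + e / 2); [|nra].
    apply Rabs_plus_le; [|lra]. eapply Rle_trans; [apply K2|].
    apply Rmult_le_compat_l; lra. }
  assert (C1 : Rabs (cos y) <= 1) by (apply Rabs_le, COS_bound).
  assert (C2 : Rabs (sin y) <= 1) by (apply Rabs_le, SIN_bound).
  assert (Hm : 0 <= m) by apply Cmod_ge_0.
  apply Rle_trans with (6 * e * m); [|nra].
  eapply Rle_trans; [apply Cmod_le_Re_Im|]. unfold cexp; simpl.
  replace (6 * e * m) with ((e * m * 1 + e * m + m * e) + (e * m * 1 + m * e + e * m)) by ring.
  apply Rplus_le_compat.
  - replace (exp x * cos y + - (1) + - (x * 1 - y * 0)) with
      ((exp x - 1 - x * 1) * cos y + (cos y - 1 - y * - 0) + x * (cos y - 1 - y * - 0)) by ring.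
    repeat apply Rabs_plus_le; try apply Rabs_mult_le; auto.
  - replace (exp x * sin y + - 0 + - (x * 0 + y * 1)) with
      ((exp x - 1 - x * 1) * sin y + x * sin y + (sin y - 0 - y * 1)) by ring.
    repeat apply Rabs_plus_le; try apply Rabs_mult_le; auto.
Qed.

Lemma cder_cexp (z : C) : cder cexp z (cexp z).
Proof.
  apply cder_ext with (fun t => cexp z * cexp (t - z))%C.
  { intros s. rewrite <- cexp_plus. f_equal. ring. }
  eapply cder_eq.
  - apply (cder_scal (cexp z) (fun t => cexp (t - z))%C).
    apply (cder_comp cexp (fun t => t - z)%C); [apply cder_shift|].
    replace (z - z)%C with (RtoC 0) by ring. apply cder_cexp_0.
  - ring.
Qed.

(* In logarithmic coordinates [z0 + cexp zeta] the circle averages of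
   [(G z - G z0) / (z - z0)] become the vertical sides of a rectangle whose horizontal
   sides cancel by periodicity, so they do not depend on the radius; letting the radius
   tend to 0 identifies them with [G' z0]. *)
Theorem cauchy_estimate (G : C -> C) (z0 v : C) (Rad r M : R) : 0 < r < Rad ->
  (forall z, Cmod (z - z0)%C < Rad -> exists v, cder G z v) ->
  (forall z, Cmod (z - z0)%C = r -> Cmod (G z - G z0)%C <= M) ->
  cder G z0 v -> Cmod v <= 2 * M / r.
Proof.
  intros Hr HG HM Hv.
  set (h := fun t => ((G (z0 + cexp t) - G z0) * cexp (- t))%C).
  assert (Hh : forall t, exp (fst t) < Rad -> exists u, cder h t u).
  { intros t Ht. destruct (HG (z0 + cexp t)%C) as [u Hu].
    { replace (z0 + cexp t - z0)%C with (cexp t) by ring. now rewrite Cmod_cexp. }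
    eexists. apply (cder_mult (fun t => G (z0 + cexp t) - G z0)%C (fun t => cexp (- t))%C).
    - apply (cder_minus (fun t => G (z0 + cexp t))%C (fun _ => G z0)); [|apply cder_const].
      apply (cder_comp G (fun t => z0 + cexp t)%C); [|apply Hu].
      apply (cder_plus (fun _ => z0) cexp); [apply cder_const|apply cder_cexp].
    - apply (cder_comp cexp (fun t => - t)%C); [|apply cder_cexp].
      apply cder_ext with (fun t => 0 - t)%C; [intros; ring|].
      apply (cder_minus (fun _ => RtoC 0) (fun t => t)); [apply cder_const|apply cder_id]. }
  pose proof PI_RGT_0 as HPI.
  assert (Hrc : forall x, exp x < Rad -> forall y, 0 <= y <= 2 * PI -> rcont (fun y => h (x, y)) y).
  { intros x Hx y _. destruct (Hh (x, y) Hx) as [u Hu].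
    eapply rder_rcont, rder_vertical, Hu. }
  set (I := fun x => Cint (fun y => h (x, y)) 0 (2 * PI)).
  assert (Hconst : forall a, a <= ln r -> I a = I (ln r)).
  { intros a Ha.
    assert (Z : bdry h a (ln r) 0 (2 * PI) = 0%C).
    { apply goursat; try lra. intros x y Hx Hy. apply Hh. simpl.
      apply Rle_lt_trans with r; [|lra]. rewrite <- (exp_ln r) by lra.
      destruct (Rle_lt_or_eq_dec x (ln r)) as [L|L]; try lra.
      - left; now apply exp_increasing.
      - rewrite L; lra. }
    unfold bdry in Z.
    replace (Cint (fun x => h (x, 2 * PI)) a (ln r)) with (Cint (fun x => h (x, 0)) a (ln r)) in Z.
    - fold (I a) (I (ln r)) in Z.
      assert (Z' : (Ci * (I (ln r) - I a))%C = 0%C) by (rewrite <- Z; ring).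
      apply (f_equal (fun z => - Ci * z)%C) in Z'.
      assert (E : (- Ci * (Ci * (I (ln r) - I a)))%C = (I (ln r) - I a)%C)
        by (apply injective_projections; simpl; ring).
      rewrite E in Z'. replace (I (ln r)) with (I a + (I (ln r) - I a))%C by ring.
      rewrite Z'. ring.
    - apply Cint_ext; auto. intros x _.
      assert (P1 : cexp (x, 2 * PI) = cexp (x, 0))
        by (unfold cexp; simpl; now rewrite cos_2PI, sin_2PI, cos_0, sin_0).
      assert (P2 : cexp (- (x, (2 * PI)%R))%C = cexp (- (x, 0%R))%C)
        by (unfold cexp; simpl; now rewrite Ropp_0, cos_neg, sin_neg, cos_2PI, sin_2PI, cos_0, sin_0, Ropp_0).
      unfold h. now rewrite P1, P2. }
  assert (HIr : Cmod (I (ln r)) <= 2 * (M / r) * (2 * PI - 0)).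
  { apply Cint_bound; try lra.
    - apply Hrc. rewrite exp_ln; lra.
    - intros y _. unfold h. unfold Rdiv. apply Cmod_mult_le.
      + apply HM. replace (z0 + cexp (ln r, y) - z0)%C with (cexp (ln r, y)) by ring.
        rewrite Cmod_cexp. simpl. rewrite exp_ln; lra.
      + rewrite Cmod_cexp. simpl. rewrite exp_Ropp, exp_ln; lra. }
  apply Rle_plus_epsilon. intros eps He.
  destruct (Hv (eps / 2)) as (d & Hd & K); [lra|].
  (* The circle of radius [exp a] lies inside the one of radius [r] and inside the disk where the
     difference quotient is within [eps / 2] of [v]. *)
  set (a := Rmin (ln r) (ln d) - 1).
  assert (Ha : a <= ln r) by (unfold a; pose proof (Rmin_l (ln r) (ln d)); lra).
  assert (Hed : exp a < d).
  { rewrite <- (exp_ln d) by lra. apply exp_increasing. unfold a.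
    pose proof (Rmin_r (ln r) (ln d)); lra. }
  assert (HeR : exp a < Rad).
  { apply Rle_lt_trans with (exp (ln r)); [|rewrite exp_ln; lra].
    left. apply exp_increasing. unfold a. pose proof (Rmin_l (ln r) (ln d)); lra. }
  assert (Hlin : forall x, rder (fun y => y * v)%C x v).
  { intros x e He'. exists 1; split; [lra|]. intros s _.
    rewrite RtoC_plus. replace ((x + s) * v - x * v - s * v)%C with (RtoC 0) by ring.
    rewrite Cmod_0. apply Rmult_le_pos; [lra|apply Rabs_pos]. }
  assert (Hcst : forall x, rcont (fun _ => v) x).
  { intros x e He'. exists 1; split; [lra|]. intros s _.
    replace (v - v)%C with (RtoC 0) by ring. rewrite Cmod_0; lra. }
  assert (Ic : Cint (fun _ => v) 0 (2 * PI) = (RtoC (2 * PI) * v)%C).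
  { rewrite (Cint_derive (fun y => y * v)%C); auto; [ring|lra]. }
  assert (B : Cmod (I a - RtoC (2 * PI) * v)%C <= 2 * (eps / 2) * (2 * PI - 0)).
  { rewrite <- Ic. unfold I.
    rewrite <- (Cint_minus (fun y => h (a, y)) (fun _ => v)); auto; [|lra].
    apply Cint_bound; try lra.
    - intros y _. destruct (Hh (a, y) HeR) as [u Hu].
      apply (rder_rcont _ _ (Ci * (u - 0))%C). apply (rder_vertical (fun t => h t - v)%C).
      apply (cder_minus h (fun _ => v)); auto using cder_const.
    - intros y _. set (t := (a, y) : C).
      replace (h t - v)%C with ((G (z0 + cexp t) - G z0 - cexp t * v) * cexp (- t))%C.
      2:{ unfold h. transitivity ((G (z0 + cexp t) - G z0) * cexp (- t)
             - (cexp t * cexp (- t)) * v)%C; [ring|rewrite cexp_opp_r; ring]. }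
      apply Rle_trans with (eps / 2 * exp a * exp (- a)).
      + apply Cmod_mult_le; [|rewrite Cmod_cexp; simpl; lra].
        specialize (K (cexp t)). rewrite Cmod_cexp in K. simpl in K. auto.
      + rewrite Rmult_assoc, <- exp_plus, Rplus_opp_r, exp_0. lra. }
  rewrite Hconst in B by auto.
  assert (E : Cmod (RtoC (2 * PI) * v)%C <= 2 * (M / r) * (2 * PI - 0) + 2 * (eps / 2) * (2 * PI - 0)).
  { replace (RtoC (2 * PI) * v)%C with (I (ln r) - (I (ln r) - RtoC (2 * PI) * v))%C by ring.
    now apply Cmod_minus_le. }
  rewrite Cmod_mult, Cmod_R, Rabs_pos_eq in E by lra.
  apply Rmult_le_reg_l with (2 * PI); [lra|]. unfold Rdiv in *. nra.
Qed.

(** * Lipschitz and second-order Taylor bounds on a disk *)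

Section Taylor.
Context (G : C -> C) (z0 : C) (Rad M : R).
Hypothesis HR : 0 < Rad.
Hypothesis HG : forall z, Cmod (z - z0)%C < Rad -> exists v, cder G z v.
Hypothesis HM : forall z, Cmod (z - z0)%C < Rad -> Cmod (G z) <= M.

(** The disk of radius [Rad / 2] about [z] stays in the domain; the Cauchy estimate on the circle of
    radius [Rad / 4], where [G] differs from [G z] by at most [2 * M], gives
    [2 * (2 * M) / (Rad / 4)]. *)
Lemma cder_le (z v : C) : Cmod (z - z0)%C <= Rad / 2 -> cder G z v -> Cmod v <= 16 * M / Rad.
Proof.
  intros Hz Hv.
  assert (Hin : forall t, Cmod (t - z)%C < Rad / 2 -> Cmod (t - z0)%C < Rad).
  { intros t Ht. replace (t - z0)%C with ((t - z) + (z - z0))%C by ring.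
    eapply Rle_lt_trans; [apply Cmod_triangle|]. lra. }
  replace (16 * M / Rad) with (2 * (M + M) / (Rad / 4)) by (field; lra).
  apply cauchy_estimate with G z (Rad / 2); auto; [lra|].
  intros t Ht. apply Cmod_minus_le; apply HM.
  - apply Hin; lra.
  - apply Hin. replace (z - z)%C with (RtoC 0) by ring. rewrite Cmod_0; lra.
Qed.

Lemma holo_lip (z w : C) : Cmod (z - z0)%C <= Rad / 2 -> Cmod (w - z0)%C <= Rad / 2 ->
  Cmod (G w - G z)%C <= 16 * M / Rad * Cmod (w - z)%C.
Proof.
  intros Hz Hw. replace w with (z + (w - z))%C at 1 by ring.
  apply cder_bound. intros s Hs.
  assert (Hin : Cmod (z + s * (w - z) - z0)%C <= Rad / 2).
  { replace (z + s * (w - z) - z0)%C with (RtoC (1 - s) * (z - z0) + s * (w - z0))%C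
      by (rewrite RtoC_minus; ring).
    eapply Rle_trans; [apply Cmod_triangle|].
    rewrite !Cmod_mult, !Cmod_R, !Rabs_pos_eq by lra. nra. }
  destruct (HG (z + s * (w - z))%C) as [v Hv]; [lra|].
  exists v; split; auto. now apply cder_le with (z + s * (w - z))%C.
Qed.

(* Apply the Cauchy estimate to the difference of [G] and a translate of [G]. *)
Lemma cder_lip_at (z v0 v : C) : Cmod (z - z0)%C < Rad / 4 -> cder G z0 v0 -> cder G z v ->
  Cmod (v - v0)%C <= 512 * M / Rad ^ 2 * Cmod (z - z0)%C.
Proof.
  intros Hz Hv0 Hv.
  set (k := fun t => (G (t + (z - z0)) - G t)%C).
  assert (Hk : forall t u u', cder G t u -> cder G (t + (z - z0))%C u' -> cder k t (u' - u)%C).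
  { intros t u u' Hu Hu'. apply (cder_minus (fun t => G (t + (z - z0)))%C G); auto.
    eapply cder_eq.
    - apply (cder_comp G (fun t => t + (z - z0))%C); [|apply Hu'].
      apply (cder_plus (fun t => t) (fun _ => z - z0)%C); [apply cder_id|apply cder_const].
    - ring. }
  assert (Hin : forall t, Cmod (t - z0)%C < Rad / 4 -> Cmod (t + (z - z0) - z0)%C < Rad / 2).
  { intros t Ht. replace (t + (z - z0) - z0)%C with ((t - z0) + (z - z0))%C by ring.
    eapply Rle_lt_trans; [apply Cmod_triangle|]. lra. }
  set (L := 16 * M / Rad * Cmod (z - z0)%C).
  (* For [|t - z0| < Rad / 4] both [t] and its translate lie in the half disk, where [holo_lip]
     bounds [k] by [L]. The Cauchy estimate for [k] on the circle of radius [Rad / 8] gives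
     [32 * L / Rad], and [32 * 16 = 512]. *)
  replace (512 * M / Rad ^ 2 * Cmod (z - z0)%C) with (2 * (L + L) / (Rad / 8))
    by (unfold L; field; lra).
  apply cauchy_estimate with k z0 (Rad / 4); [lra| | |].
  - intros t Ht. destruct (HG t) as [u Hu]; [lra|].
    destruct (HG (t + (z - z0))%C) as [u' Hu']; [specialize (Hin t Ht); lra|].
    eexists; apply Hk; eauto.
  - intros t Ht.
    assert (HL : forall t, Cmod (t - z0)%C < Rad / 4 -> Cmod (k t) <= L).
    { intros t' Ht'. unfold k, L. specialize (Hin t' Ht').
      replace (z - z0)%C with (t' + (z - z0) - t')%C at 2 by ring.
      apply holo_lip; lra. }
    apply Cmod_minus_le; apply HL; [lra|].
    replace (z0 - z0)%C with (RtoC 0) by ring. rewrite Cmod_0; lra.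
  - apply Hk; auto. now replace (z0 + (z - z0))%C with z by ring.
Qed.

(** No second derivative is involved: by [cder_lip_at] the derivative of [G] minus its affine part
    is [O(|s|)] on the segment from [z0] to [z0 + s], and the mean value inequality contributes the
    other factor [|s|]. *)
Lemma taylor2 (s v : C) : cder G z0 v -> Cmod s < Rad / 4 ->
  Cmod (G (z0 + s) - G z0 - s * v)%C <= 512 * M / Rad ^ 2 * Cmod s ^ 2.
Proof.
  intros Hv Hs.
  set (k := fun t => (G t - (0 + (t - z0) * v))%C).
  replace (G (z0 + s) - G z0 - s * v)%C with (k (z0 + s) - k z0)%C by (unfold k; ring).
  replace (512 * M / Rad ^ 2 * Cmod s ^ 2) with ((512 * M / Rad ^ 2 * Cmod s) * Cmod s) by ring.
  apply cder_bound. intros x Hx.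
  assert (HM0 : 0 <= M).
  { eapply Rle_trans; [apply Cmod_ge_0|apply (HM z0)].
    replace (z0 - z0)%C with (RtoC 0) by ring. rewrite Cmod_0; lra. }
  assert (E : Cmod (z0 + x * s - z0)%C <= Cmod s).
  { replace (z0 + x * s - z0)%C with (x * s)%C by ring.
    rewrite Cmod_mult, Cmod_R, Rabs_pos_eq by lra. pose proof (Cmod_ge_0 s). nra. }
  destruct (HG (z0 + x * s)%C) as [u Hu]; [lra|].
  exists (u - v)%C; split.
  - apply (cder_minus G (fun t => 0 + (t - z0) * v)%C); auto. apply cder_affine.
  - eapply Rle_trans; [apply (cder_lip_at (z0 + x * s)%C); auto; lra|].
    apply Rmult_le_compat_l; auto. apply Rmult_le_pos; [lra|].
    left; apply Rinv_0_lt_compat, pow_lt; auto.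
Qed.
End Taylor.
(** * Limits of holomorphic functions *)

(** The passage to the limit used everywhere below; [D] may have any sign, so that no positivity has
    to be checked at each use. *)
Lemma le_add_geom (a b D : R) : (forall n, a <= b + D / 2 ^ n) -> a <= b.
Proof.
  intros H. apply Rle_plus_epsilon. intros eps He.
  destruct (pow_lt_1_zero (/ 2)) with (y := eps / (Rabs D + 1)) as [n Hn].
  - rewrite Rabs_pos_eq; lra.
  - pose proof (Rabs_pos D). apply Rdiv_lt_0_compat; lra.
  - specialize (Hn n (le_n n)). specialize (H n). rewrite pow_inv in Hn.
    assert (Pn : 0 < / 2 ^ n) by (apply Rinv_0_lt_compat, pow_lt; lra).
    rewrite Rabs_pos_eq in Hn by lra. unfold Rdiv in H.
    pose proof (Rle_abs D). pose proof (Rabs_pos D).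
    assert (D * / 2 ^ n <= eps); [|lra].
    apply Rle_trans with ((Rabs D + 1) * / 2 ^ n); [nra|].
    replace eps with ((Rabs D + 1) * (eps / (Rabs D + 1))) by (field; lra).
    apply Rmult_le_compat_l; lra.
Qed.

(** The tail of the increments after [n] sums to at most [2 * A / 2 ^ n], so the intervals of this
    radius around [u n] are nested; their common point is the limit, and the rate comes with it. *)
Lemma Rseq_geom (u : nat -> R) (A : R) : (forall n, Rabs (u (S n) - u n) <= A / 2 ^ n) ->
  exists l, forall n, Rabs (u n - l) <= 2 * A / 2 ^ n.
Proof.
  intros H.
  assert (E : forall n, 2 * A / 2 ^ n = A / 2 ^ n + 2 * A / 2 ^ S n).
  { intros n. simpl. field. apply pow_nonzero; lra. }
  assert (HA : forall n, 0 <= A / 2 ^ n).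
  { intros n. eapply Rle_trans; [apply Rabs_pos|apply H]. }
  destruct (nested_intervals (fun n => u n - 2 * A / 2 ^ n) (fun n => u n + 2 * A / 2 ^ n)) as [l Hl].
  - intros n. specialize (H n). apply Rabs_le_between in H.
    rewrite E. lra.
  - intros n. specialize (H n). apply Rabs_le_between in H. rewrite (E n). lra.
  - intros n. specialize (HA n). replace (2 * A / 2 ^ n) with (2 * (A / 2 ^ n)) by (unfold Rdiv; ring).
    lra.
  - exists l. intros n. specialize (Hl n). apply Rabs_le. lra.
Qed.

Lemma Cseq_geom (u : nat -> C) (A : R) : (forall n, Cmod (u (S n) - u n)%C <= A / 2 ^ n) ->
  exists l, forall n, Cmod (u n - l)%C <= 4 * A / 2 ^ n.
Proof.
  intros H.
  destruct (Rseq_geom (fun n => fst (u n)) A) as [x Hx].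
  { intros n. eapply Rle_trans; [|apply H]. apply (Cmod_Re_le (u (S n) - u n)%C). }
  destruct (Rseq_geom (fun n => snd (u n)) A) as [y Hy].
  { intros n. eapply Rle_trans; [|apply H]. apply (Cmod_Im_le (u (S n) - u n)%C). }
  exists (x, y). intros n. eapply Rle_trans; [apply Cmod_le_Re_Im|].
  specialize (Hx n). specialize (Hy n).
  replace (4 * A / 2 ^ n) with (2 * A / 2 ^ n + 2 * A / 2 ^ n) by (unfold Rdiv; ring).
  simpl. now apply Rplus_le_compat.
Qed.

Lemma cder_quadratic (g : C -> C) (z v : C) (r K : R) : 0 < r ->
  (forall s, Cmod s < r -> Cmod (g (z + s) - g z - s * v)%C <= K * Cmod s ^ 2) -> cder g z v.
Proof.
  intros Hr H eps He. pose proof (Rabs_pos K). pose proof (Rle_abs K).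
  exists (Rmin r (eps / (Rabs K + 1))). split.
  { apply Rmin_pos; auto. apply Rdiv_lt_0_compat; lra. }
  intros s Hs.
  pose proof (Rmin_l r (eps / (Rabs K + 1))). pose proof (Rmin_r r (eps / (Rabs K + 1))).
  eapply Rle_trans; [apply H; lra|]. pose proof (Cmod_ge_0 s).
  assert ((Rabs K + 1) * Cmod s <= eps); [|nra].
  replace eps with ((Rabs K + 1) * (eps / (Rabs K + 1))) by (field; lra).
  apply Rmult_le_compat_l; lra.
Qed.

(** Weierstrass's theorem with a geometric rate. The Cauchy estimate applied to [G (S n) - G n]
    makes the derivatives at [z0] converge geometrically, and the Taylor remainder, which is uniform
    in [n], survives in the limit. *)
Lemma holo_limit (G : nat -> C -> C) (g : C -> C) (z0 : C) (Rad M A : R) : 0 < Rad ->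
  (forall n z, Cmod (z - z0)%C < Rad -> exists v, cder (G n) z v) ->
  (forall n z, Cmod (z - z0)%C < Rad -> Cmod (G n z) <= M) ->
  (forall n z, Cmod (z - z0)%C < Rad -> Cmod (G n z - g z)%C <= A / 2 ^ n) ->
  exists v, cder g z0 v.
Proof.
  intros HR HG HM Hlim.
  assert (Hz0 : Cmod (z0 - z0)%C = 0).
  { replace (z0 - z0)%C with (RtoC 0) by ring. apply Cmod_0. }
  destruct (functional_choice (fun n v => cder (G n) z0 v)) as [v Hv].
  { intros n. apply HG. lra. }
  destruct (Cseq_geom v (16 * (2 * A) / Rad)) as [l Hl].
  { intros n. replace (16 * (2 * A) / Rad / 2 ^ n) with (16 * (2 * A / 2 ^ n) / Rad)
      by (field; split; [|apply pow_nonzero]; lra).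
    apply (cder_le (fun z => G (S n) z - G n z)%C z0 Rad (2 * A / 2 ^ n)) with z0; auto; try lra.
    - intros z Hz. destruct (HG n z Hz) as [a Ha]. destruct (HG (S n) z Hz) as [b Hb].
      exists (b - a)%C. now apply cder_minus.
    - intros z Hz. replace (G (S n) z - G n z)%C with ((G (S n) z - g z) - (G n z - g z))%C by ring.
      replace (2 * A / 2 ^ n) with (A / 2 ^ n + A / 2 ^ n) by (unfold Rdiv; ring).
      apply Cmod_minus_le; auto. eapply Rle_trans; [apply Hlim; auto|].
      assert (0 <= A / 2 ^ S n) by (eapply Rle_trans; [apply Cmod_ge_0|apply (Hlim _ z Hz)]).
      replace (A / 2 ^ n) with (A / 2 ^ S n + A / 2 ^ S n)
        by (simpl; field; apply pow_nonzero; lra).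
      lra.
    - now apply cder_minus. }
  exists l. apply cder_quadratic with (Rad / 4) (512 * M / Rad ^ 2); [lra|].
  intros s Hs. set (B := 4 * (16 * (2 * A) / Rad)) in *.
  apply le_add_geom with (2 * A + Cmod s * B). intros n.
  replace (g (z0 + s) - g z0 - s * l)%C with
    ((G n (z0 + s) - G n z0 - s * v n) - (G n (z0 + s) - g (z0 + s)) + (G n z0 - g z0)
      + s * (v n - l))%C by ring.
  replace (512 * M / Rad ^ 2 * Cmod s ^ 2 + (2 * A + Cmod s * B) / 2 ^ n) with
    (512 * M / Rad ^ 2 * Cmod s ^ 2 + A / 2 ^ n + A / 2 ^ n + Cmod s * (B / 2 ^ n))
    by (field; split; [apply pow_nonzero|]; lra).
  apply Cmod_plus_le; [apply Cmod_plus_le; [apply Cmod_minus_le|]|].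
  - apply taylor2; auto.
  - apply Hlim. replace (z0 + s - z0)%C with s by ring. lra.
  - apply Hlim. lra.
  - apply Cmod_mult_le; auto. lra.
Qed.

(** * Functions of three variables vanishing to second order *)

Lemma C3_eq (a b c a' b' c' : C) : a = a' -> b = b' -> c = c' -> (a, b, c) = (a', b', c') :> C3.
Proof. now intros -> -> ->. Qed.

Lemma C3norm_le_sum (x y z : C) : C3norm (x, y, z) <= Cmod x + Cmod y + Cmod z.
Proof.
  unfold C3norm, c3x, c3y, c3z; simpl fst; simpl snd. change Cnorm with Cmod.
  pose proof (Cmod_ge_0 x); pose proof (Cmod_ge_0 y); pose proof (Cmod_ge_0 z).
  rewrite <- (sqrt_square (Cmod x + Cmod y + Cmod z)) by lra. apply sqrt_le_1_alt.
  assert (0 <= Cmod x * Cmod y) by nra. assert (0 <= Cmod x * Cmod z) by nra.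
  assert (0 <= Cmod y * Cmod z) by nra. nra.
Qed.

Lemma C3norm_ge (x y z : C) :
  Cmod x <= C3norm (x, y, z) /\ Cmod y <= C3norm (x, y, z) /\ Cmod z <= C3norm (x, y, z).
Proof.
  unfold C3norm, c3x, c3y, c3z; simpl fst; simpl snd. change Cnorm with Cmod.
  pose proof (Cmod_ge_0 x); pose proof (Cmod_ge_0 y); pose proof (Cmod_ge_0 z).
  repeat split;
    match goal with |- Cmod ?a <= _ => rewrite <- (sqrt_square (Cmod a)) at 1 by auto end;
    apply sqrt_le_1_alt; nra.
Qed.

(** The chain rule for a curve. Along the curve [F] is split into the linear form of its
    differential, differentiated coordinatewise, and a remainder, which has derivative 0 because the
    coordinates are locally Lipschitz at [t]. *)
Lemma cder_curve (F : C3 -> C) (k1 k2 k3 : C -> C) (t u1 u2 u3 : C) :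
  cder k1 t u1 -> cder k2 t u2 -> cder k3 t u3 -> C_differentiable3 F (k1 t, k2 t, k3 t) ->
  exists v, cder (fun s => F (k1 s, k2 s, k3 s)) t v.
Proof.
  intros H1 H2 H3 (a & b & c & HF).
  set (lin := fun s => (a * k1 s + b * k2 s + c * k3 s)%C).
  assert (Hlin : cder lin t (a * u1 + b * u2 + c * u3)%C).
  { apply (cder_plus (fun s => a * k1 s + b * k2 s)%C (fun s => c * k3 s)%C);
      [apply (cder_plus (fun s => a * k1 s)%C (fun s => b * k2 s)%C)|]; now apply cder_scal. }
  exists (0 + (a * u1 + b * u2 + c * u3))%C.
  apply cder_ext with (fun s => (F (k1 s, k2 s, k3 s) - lin s) + lin s)%C; [intros; ring|].
  apply (cder_plus (fun s => F (k1 s, k2 s, k3 s) - lin s)%C); auto.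
  destruct (cder_lip _ _ _ H1) as (d1 & Hd1 & K1).
  destruct (cder_lip _ _ _ H2) as (d2 & Hd2 & K2).
  destruct (cder_lip _ _ _ H3) as (d3 & Hd3 & K3).
  pose proof (Cmod_ge_0 u1); pose proof (Cmod_ge_0 u2); pose proof (Cmod_ge_0 u3).
  set (L := Cmod u1 + 1 + (Cmod u2 + 1) + (Cmod u3 + 1)). assert (HL : 0 < L) by (unfold L; lra).
  intros eps He. destruct (HF (eps / L)) as (d & Hd & K); [apply Rdiv_lt_0_compat; lra|].
  exists (Rmin (Rmin d1 d2) (Rmin d3 (d / L))).
  assert (HdL : 0 < d / L) by (apply Rdiv_lt_0_compat; lra).
  split; [repeat apply Rmin_pos; auto|]. intros s Hs.
  pose proof (Rmin_l (Rmin d1 d2) (Rmin d3 (d / L))).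
  pose proof (Rmin_r (Rmin d1 d2) (Rmin d3 (d / L))).
  pose proof (Rmin_l d1 d2); pose proof (Rmin_r d1 d2).
  pose proof (Rmin_l d3 (d / L)); pose proof (Rmin_r d3 (d / L)).
  specialize (K1 s ltac:(lra)); specialize (K2 s ltac:(lra)); specialize (K3 s ltac:(lra)).
  set (e1 := (k1 (t + s) - k1 t)%C) in *. set (e2 := (k2 (t + s) - k2 t)%C) in *.
  set (e3 := (k3 (t + s) - k3 t)%C) in *.
  assert (Hn : C3norm (e1, e2, e3) <= L * Cmod s).
  { eapply Rle_trans; [apply C3norm_le_sum|]. unfold L. lra. }
  assert (Hn' : C3norm (e1, e2, e3) < d).
  { eapply Rle_lt_trans; [apply Hn|]. replace d with (L * (d / L)) by (field; lra).
    apply Rmult_lt_compat_l; lra. }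
  specialize (K (e1, e2, e3) Hn').
  replace (C3add (k1 t, k2 t, k3 t) (e1, e2, e3)) with ((k1 (t + s), k2 (t + s), k3 (t + s)) : C3)%C in K.
  2:{ unfold C3add, mkC3, c3x, c3y, c3z; simpl fst; simpl snd. change Cadd with Cplus.
      unfold e1, e2, e3. apply C3_eq; ring. }
  change (Cmod (F (k1 (t + s), k2 (t + s), k3 (t + s)) - F (k1 t, k2 t, k3 t)
    - (a * e1 + b * e2 + c * e3))%C <= eps / L * C3norm (e1, e2, e3)) in K.
  replace (F (k1 (t + s), k2 (t + s), k3 (t + s)) - lin (t + s) - (F (k1 t, k2 t, k3 t) - lin t) - s * 0)%C
    with (F (k1 (t + s), k2 (t + s), k3 (t + s)) - F (k1 t, k2 t, k3 t)
    - (a * e1 + b * e2 + c * e3))%C by (unfold lin, e1, e2, e3; ring).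
  eapply Rle_trans; [apply K|]. apply Rle_trans with (eps / L * (L * Cmod s)).
  - apply Rmult_le_compat_l; auto. left; apply Rdiv_lt_0_compat; lra.
  - right; field; lra.
Qed.

(** This norm dominates [C3norm] and each coordinate, and unlike [C3norm] it leads to estimates
    without square roots, which linear arithmetic can combine. *)
Definition sum3 (x y z : C) : R := Cmod x + Cmod y + Cmod z.

Lemma sum3_ge0 (x y z : C) : 0 <= sum3 x y z.
Proof. unfold sum3. pose proof (Cmod_ge_0 x); pose proof (Cmod_ge_0 y); pose proof (Cmod_ge_0 z). lra. Qed.

Lemma sum3_scal (s x y z : C) : sum3 (s * x) (s * y) (s * z) = Cmod s * sum3 x y z.
Proof. unfold sum3. rewrite !Cmod_mult. ring. Qed.

Lemma sum3_add (x y z x' y' z' : C) (A B : R) : sum3 x y z <= A -> sum3 x' y' z' <= B ->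
  sum3 (x + x') (y + y') (z + z') <= A + B.
Proof.
  unfold sum3; intros.
  pose proof (Cmod_triangle x x'); pose proof (Cmod_triangle y y'); pose proof (Cmod_triangle z z').
  lra.
Qed.

Lemma sum3_eq0 (x y z : C) : sum3 x y z = 0 -> x = 0%C /\ y = 0%C /\ z = 0%C.
Proof.
  unfold sum3; intros. pose proof (Cmod_ge_0 x); pose proof (Cmod_ge_0 y); pose proof (Cmod_ge_0 z).
  repeat split; apply Cmod_eq_0; lra.
Qed.

(** The quantitative form of holomorphy with vanishing to order two. In [o2_lip] the Lipschitz
    constant [K * m] is proportional to the size [m] of the two points; this makes the Picard map
    contract on a small disk and the perturbation in the uniqueness argument small. *)
Record order2_on (F : C3 -> C) (r K : R) : Prop := {
  o2_diff : forall x y z, sum3 x y z < r -> C_differentiable3 F (x, y, z);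
  o2_sq : forall x y z, sum3 x y z < r -> Cmod (F (x, y, z)) <= K * sum3 x y z ^ 2;
  o2_lip : forall x y z x' y' z' m, sum3 x y z <= m -> sum3 x' y' z' <= m -> m < r ->
    Cmod (F (x', y', z') - F (x, y, z))%C <= K * m * sum3 (x' - x) (y' - y) (z' - z) }.

Lemma order2_on_weaken (F : C3 -> C) (r K r' K' : R) :
  r' <= r -> K <= K' -> order2_on F r K -> order2_on F r' K'.
Proof.
  intros Hr HK [H1 H2 H3]. split.
  - intros; apply H1; lra.
  - intros. eapply Rle_trans; [apply H2; lra|]. apply Rmult_le_compat_r; auto. apply pow2_ge_0.
  - intros x y z x' y' z' m Hm Hm' Hmr.
    eapply Rle_trans; [apply (H3 x y z x' y' z' m); auto; lra|].
    pose proof (sum3_ge0 x y z). apply Rmult_le_compat_r; [apply sum3_ge0|].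
    apply Rmult_le_compat_r; lra.
Qed.

Lemma cder_line3 (F : C3 -> C) (x y z a b c s : C) :
  C_differentiable3 F (x + s * a, y + s * b, z + s * c)%C ->
  exists v, cder (fun s => F (x + s * a, y + s * b, z + s * c)%C) s v.
Proof.
  assert (L : forall p q, cder (fun s => p + s * q)%C s q).
  { intros p q. apply cder_ext with (fun s => p + (s - 0) * q)%C; [intros; ring|].
    apply cder_affine. }
  intros H. apply (cder_curve F (fun s => x + s * a)%C (fun s => y + s * b)%C (fun s => z + s * c)%C s a b c);
    auto.
Qed.

(** Restrict [F] to the complex line through 0 and the point: [G s = F (s x, s y, s z)] is
    holomorphic for [|s| < r / N], with [N = sum3 x y z], and has [G 0 = 0] and derivative 0 at 0.
    [taylor2] at [s = 1] gives [512 * r / (r / N) ^ 2]; the condition [N < r / 4] is what admits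
    [s = 1]. *)
Lemma order2_sq (F : C3 -> C) (r : R) : 0 < r ->
  (forall x y z, sum3 x y z < r -> C_differentiable3 F (x, y, z)) ->
  (forall x y z, sum3 x y z < r -> Cmod (F (x, y, z)) <= r) ->
  vanishes_order2 F ->
  forall x y z, sum3 x y z < r / 4 -> Cmod (F (x, y, z)) <= 512 / r * sum3 x y z ^ 2.
Proof.
  intros Hr HD HB [F0 HF] x y z Hp.
  destruct (Rle_lt_or_eq_dec 0 _ (sum3_ge0 x y z)) as [Hn|Hn].
  2:{ destruct (sum3_eq0 x y z) as (-> & -> & ->); auto.
      assert (E : Cmod (F (RtoC 0, RtoC 0, RtoC 0)) = 0)
        by exact (eq_trans (f_equal Cmod F0) Cmod_0).
      rewrite E.
      apply Rmult_le_pos; [|apply pow2_ge_0]. left; apply Rdiv_lt_0_compat; lra. }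
  set (N := sum3 x y z) in *.
  set (G := fun s : C => F (0 + s * x, 0 + s * y, 0 + s * z)%C).
  assert (Hin : forall s, Cmod (s - 0)%C < r / N -> sum3 (0 + s * x) (0 + s * y) (0 + s * z) < r).
  { intros s Hs. rewrite !Cplus_0_l, sum3_scal. replace (s - 0)%C with s in Hs by ring.
    fold N. replace r with (r / N * N) by (field; lra). apply Rmult_lt_compat_r; auto. }
  assert (HG0 : G 0%C = 0%C).
  { unfold G. replace (0 + 0 * x)%C with (RtoC 0) by ring. replace (0 + 0 * y)%C with (RtoC 0) by ring.
    replace (0 + 0 * z)%C with (RtoC 0) by ring. exact F0. }
  assert (T : Cmod (G (0 + 1) - G 0 - 1 * 0)%C <= 512 * r / (r / N) ^ 2 * Cmod 1 ^ 2).
  { apply taylor2.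
    - now apply Rdiv_lt_0_compat.
    - intros s Hs. apply cder_line3. auto.
    - intros s Hs. now apply HB, Hin.
    - intros eps He. destruct (HF (eps / N)) as (d & Hd & K); [now apply Rdiv_lt_0_compat|].
      exists (d / N); split; [now apply Rdiv_lt_0_compat|]. intros s Hs.
      rewrite HG0. replace (G (0 + s) - 0 - s * 0)%C with (G s)
        by (replace (0 + s)%C with s by ring; ring).
      assert (E : C3norm (0 + s * x, 0 + s * y, 0 + s * z)%C <= Cmod s * N).
      { eapply Rle_trans; [apply C3norm_le_sum|]. rewrite !Cplus_0_l.
        unfold N. rewrite <- sum3_scal. apply Rle_refl. }
      eapply Rle_trans; [apply K|].
      + eapply Rle_lt_trans; [apply E|]. replace d with (d / N * N) by (field; lra).
        apply Rmult_lt_compat_r; auto.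
      + replace (eps * Cmod s) with (eps / N * (Cmod s * N)) by (field; lra).
        apply Rmult_le_compat_l; auto. left; now apply Rdiv_lt_0_compat.
    - rewrite Cmod_1. apply Rmult_lt_reg_r with N; auto. unfold Rdiv.
      replace (r * / N * / 4 * N) with (r / 4) by (field; lra). lra. }
  rewrite HG0 in T. replace (G (0 + 1) - 0 - 1 * 0)%C with (F (x, y, z)) in T.
  2:{ unfold G. replace (0 + (0 + 1) * x)%C with x by ring.
      replace (0 + (0 + 1) * y)%C with y by ring. replace (0 + (0 + 1) * z)%C with z by ring. ring. }
  rewrite Cmod_1 in T. replace (512 / r * N ^ 2) with (512 * r / (r / N) ^ 2 * 1 ^ 2) by (field; lra).
  exact T.
Qed.

(** On the complex line through the two points, at distance [N], a parameter disk of radius [m / N]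
    about any point of the segment stays within size [2 * m < r], where [F] is at most
    [K * (2 * m) ^ 2]. [cder_le] then bounds the derivative by [16 * 4 * K * m ^ 2 * N / m]. *)
Lemma order2_lip (F : C3 -> C) (r K : R) : 0 < r -> 0 <= K ->
  (forall x y z, sum3 x y z < r -> C_differentiable3 F (x, y, z)) ->
  (forall x y z, sum3 x y z < r -> Cmod (F (x, y, z)) <= K * sum3 x y z ^ 2) ->
  forall x y z x' y' z' m, sum3 x y z <= m -> sum3 x' y' z' <= m -> m < r / 2 ->
    Cmod (F (x', y', z') - F (x, y, z))%C <= 64 * K * m * sum3 (x' - x) (y' - y) (z' - z).
Proof.
  intros Hr HK HD HB x y z x' y' z' m Hp Hq Hm.
  set (a := (x' - x)%C). set (b := (y' - y)%C). set (c := (z' - z)%C).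
  assert (Hm0 : 0 <= m) by (eapply Rle_trans; [apply (sum3_ge0 x y z)|auto]).
  destruct (Rle_lt_or_eq_dec 0 _ (sum3_ge0 a b c)) as [Hn|Hn].
  2:{ destruct (sum3_eq0 a b c) as (Ea & Eb & Ec); auto. rewrite <- Hn.
      replace x' with x by (replace x' with (x + a)%C by (unfold a; ring); rewrite Ea; ring).
      replace y' with y by (replace y' with (y + b)%C by (unfold b; ring); rewrite Eb; ring).
      replace z' with z by (replace z' with (z + c)%C by (unfold c; ring); rewrite Ec; ring).
      match goal with |- Cmod ?e <= _ => replace e with (RtoC 0) by ring end.
      rewrite Cmod_0; lra. }
  set (N := sum3 a b c) in *.
  assert (HN : N <= m + m).
  { unfold N, a, b, c, Cminus. apply sum3_add; auto. unfold sum3. rewrite !Cmod_opp. exact Hq || exact Hp. }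
  assert (Hmp : 0 < m) by lra.
  set (G := fun s : C => F (x + s * a, y + s * b, z + s * c)%C).
  replace (F (x', y', z') - F (x, y, z))%C with (G (0 + 1) - G 0)%C.
  2:{ assert (E1 : G (0 + 1)%C = F (x', y', z'))
        by (unfold G, a, b, c; apply (f_equal F), C3_eq; ring).
      assert (E0 : G 0%C = F (x, y, z)) by (unfold G, a, b, c; apply (f_equal F), C3_eq; ring).
      now rewrite E1, E0. }
  replace (64 * K * m * N) with (64 * K * m * N * Cmod 1) by (rewrite Cmod_1; ring).
  apply cder_bound. intros s Hs.
  assert (Hs0 : sum3 (x + s * a) (y + s * b) (z + s * c) <= m).
  { replace (x + s * a)%C with (RtoC (1 - s) * x + s * x')%C by (unfold a; rewrite RtoC_minus; ring).
    replace (y + s * b)%C with (RtoC (1 - s) * y + s * y')%C by (unfold b; rewrite RtoC_minus; ring).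
    replace (z + s * c)%C with (RtoC (1 - s) * z + s * z')%C by (unfold c; rewrite RtoC_minus; ring).
    eapply Rle_trans; [apply sum3_add; rewrite sum3_scal; apply Rle_refl|].
    rewrite !Cmod_R, !Rabs_pos_eq by lra. nra. }
  assert (Hin : forall t, Cmod (t - (0 + s * 1))%C < m / N ->
    sum3 (x + t * a) (y + t * b) (z + t * c) <= m + m).
  { intros t Ht. replace (t - (0 + s * 1))%C with (t - s)%C in Ht by ring.
    replace (x + t * a)%C with ((x + s * a) + (t - s) * a)%C by ring.
    replace (y + t * b)%C with ((y + s * b) + (t - s) * b)%C by ring.
    replace (z + t * c)%C with ((z + s * c) + (t - s) * c)%C by ring.
    apply sum3_add; auto. rewrite sum3_scal. fold N.
    replace m with (m / N * N) by (field; lra). apply Rmult_le_compat_r; lra. }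
  assert (HRad : 0 < m / N) by (now apply Rdiv_lt_0_compat).
  assert (HGd : forall t, Cmod (t - (0 + s * 1))%C < m / N -> exists v, cder G t v).
  { intros t Ht. apply cder_line3, HD. specialize (Hin t Ht). lra. }
  assert (Hc : Cmod (0 + s * 1 - (0 + s * 1))%C = 0).
  { match goal with |- Cmod ?e = _ => replace e with (RtoC 0) by ring end. apply Cmod_0. }
  destruct (HGd (0 + s * 1)%C) as [v Hv]; [lra|].
  exists v; split; auto.
  replace (64 * K * m * N) with (16 * (K * (m + m) ^ 2) / (m / N)) by (field; lra).
  apply (cder_le G (0 + s * 1)%C (m / N) (K * (m + m) ^ 2)) with (0 + s * 1)%C; auto; [|lra].
  intros t Ht. specialize (Hin t Ht). eapply Rle_trans; [apply HB; lra|].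
  apply Rmult_le_compat_l; auto. apply pow_incr. split; auto. apply sum3_ge0.
Qed.

Lemma order2_exists (F : C3 -> C) : holomorphic_near0 F -> vanishes_order2 F ->
  exists r K, 0 < r /\ 0 <= K /\ order2_on F r K.
Proof.
  intros (r0 & Hr0 & HD) HV. pose proof HV as [_ HF].
  destruct (HF 1) as (d & Hd & HB); [lra|].
  set (r := Rmin r0 d). assert (Hr : 0 < r) by (now apply Rmin_pos).
  assert (E1 : r <= r0) by apply Rmin_l. assert (E2 : r <= d) by apply Rmin_r.
  assert (HD' : forall x y z, sum3 x y z < r -> C_differentiable3 F (x, y, z)).
  { intros x y z H. apply HD. eapply Rle_lt_trans; [apply C3norm_le_sum|]. unfold sum3 in H. lra. }
  assert (HB' : forall x y z, sum3 x y z < r -> Cmod (F (x, y, z)) <= r).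
  { intros x y z H. pose proof (C3norm_le_sum x y z). unfold sum3 in H.
    specialize (HB (x, y, z) ltac:(lra)). change Cnorm with Cmod in HB. lra. }
  pose proof (order2_sq F r Hr HD' HB' HV) as HS.
  assert (HK : 0 < 512 / r) by (apply Rdiv_lt_0_compat; lra).
  (* [order2_sq] holds up to [r / 4] with constant [512 / r]; [order2_lip] halves the radius once
     more and multiplies the constant by 64. *)
  exists (r / 8), (64 * (512 / r)). split; [lra|]. split; [lra|]. split.
  - intros; apply HD'; lra.
  - intros. eapply Rle_trans; [apply HS; lra|]. apply Rmult_le_compat_r; [apply pow2_ge_0|lra].
  - intros. apply (order2_lip F (r / 4)); auto; try lra. intros; apply HD'; lra.
Qed.

Lemma order2_exists3 (f g h : C3 -> C) :
  holomorphic_near0 f -> holomorphic_near0 g -> holomorphic_near0 h ->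
  vanishes_order2 f -> vanishes_order2 g -> vanishes_order2 h ->
  exists r K, 0 < r /\ 0 <= K /\ order2_on f r K /\ order2_on g r K /\ order2_on h r K.
Proof.
  intros Hf Hg Hh Vf Vg Vh.
  destruct (order2_exists f) as (r1 & K1 & ? & ? & O1); auto.
  destruct (order2_exists g) as (r2 & K2 & ? & ? & O2); auto.
  destruct (order2_exists h) as (r3 & K3 & ? & ? & O3); auto.
  exists (Rmin r1 (Rmin r2 r3)), (K1 + K2 + K3).
  pose proof (Rmin_l r1 (Rmin r2 r3)); pose proof (Rmin_r r1 (Rmin r2 r3)).
  pose proof (Rmin_l r2 r3); pose proof (Rmin_r r2 r3).
  split; [repeat apply Rmin_pos; auto|]. split; [lra|].
  split; [|split]; (eapply order2_on_weaken; [| |eassumption]); lra.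
Qed.
(** * Solving t Q' - Q = m *)

Lemma Cint_scal (c : C) (f : R -> C) (a b : R) : a <= b ->
  (forall x, a <= x <= b -> rcont f x) -> Cint (fun x => c * f x)%C a b = (c * Cint f a b)%C.
Proof.
  intros Hab Hf. destruct (rcont_ex_RInt f a b Hab Hf) as [E1 E2].
  pose proof (RInt_correct _ _ _ E1) as I1. pose proof (RInt_correct _ _ _ E2) as I2.
  unfold Cint. apply injective_projections; simpl; apply is_RInt_unique.
  - exact (is_RInt_minus _ _ _ _ _ _ (is_RInt_scal _ _ _ (fst c) _ I1) (is_RInt_scal _ _ _ (snd c) _ I2)).
  - exact (is_RInt_plus _ _ _ _ _ _ (is_RInt_scal _ _ _ (fst c) _ I2) (is_RInt_scal _ _ _ (snd c) _ I1)).
Qed.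

Lemma rcont_minus (f g : R -> C) (x : R) : rcont f x -> rcont g x -> rcont (fun s => f s - g s)%C x.
Proof.
  intros Hf Hg eps He.
  destruct (Hf (eps / 2)) as (d1 & Hd1 & K1); [lra|].
  destruct (Hg (eps / 2)) as (d2 & Hd2 & K2); [lra|].
  exists (Rmin d1 d2); split; [now apply Rmin_pos|]. intros s Hs.
  pose proof (Rmin_l d1 d2); pose proof (Rmin_r d1 d2).
  replace (f (x + s)%R - g (x + s)%R - (f x - g x))%C
    with ((f (x + s)%R - f x) - (g (x + s)%R - g x))%C by ring.
  replace eps with (eps / 2 + eps / 2) by field.
  apply Cmod_minus_le; [apply K1|apply K2]; lra.
Qed.

Lemma rcont_scal (c : C) (f : R -> C) (x : R) : rcont f x -> rcont (fun s => c * f s)%C x.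
Proof.
  intros Hf eps He. pose proof (Cmod_ge_0 c).
  destruct (Hf (eps / (Cmod c + 1))) as (d & Hd & K); [apply Rdiv_lt_0_compat; lra|].
  exists d; split; auto. intros s Hs.
  replace (c * f (x + s)%R - c * f x)%C with (c * (f (x + s)%R - f x))%C by ring.
  replace eps with ((Cmod c + 1) * (eps / (Cmod c + 1))) by (field; lra).
  apply Cmod_mult_le; [lra|auto].
Qed.

Lemma rcont_at_0 (f : R -> C) (K d : R) : 0 < d -> f 0 = 0%C ->
  (forall s, Rabs s < d -> Cmod (f s) <= K * Rabs s) -> rcont f 0.
Proof.
  intros Hd H0 H eps He. pose proof (Rabs_pos K). pose proof (Rle_abs K).
  exists (Rmin d (eps / (Rabs K + 1))). split.
  { apply Rmin_pos; auto. apply Rdiv_lt_0_compat; lra. }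
  intros s Hs.
  pose proof (Rmin_l d (eps / (Rabs K + 1))); pose proof (Rmin_r d (eps / (Rabs K + 1))).
  rewrite H0, Rplus_0_l. replace (f s - 0)%C with (f s) by ring.
  eapply Rle_trans; [apply H; lra|]. pose proof (Rabs_pos s).
  replace eps with ((Rabs K + 1) * (eps / (Rabs K + 1))) by (field; lra). nra.
Qed.

Lemma rder_RtoC (x : R) : rder RtoC x 1%C.
Proof.
  intros eps He. exists 1; split; [lra|]. intros s _.
  rewrite RtoC_plus. replace (x + s - x - s * 1)%C with (RtoC 0) by ring.
  rewrite Cmod_0. apply Rmult_le_pos; [lra|apply Rabs_pos].
Qed.

(* The change of variable [s = sigma ^ 2] in [int_0^1 m (s t) / s ^ 2 ds] makes the integrand
   tend to 0 at 0, where Rocq's division by 0 also gives 0. *)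
Definition qint (m : C -> C) (t : C) (s : R) : C := (2 * m (s * s * t) / (s * s * s))%C.
Definition Qop (m : C -> C) (t : C) : C := Cint (qint m t) 0 1.

Definition quad_on (m : C -> C) (R0 K : R) : Prop :=
  (forall t, Cmod t < R0 -> exists v, cder m t v) /\
  (forall t, Cmod t < R0 -> Cmod (m t) <= K * Cmod t ^ 2).

Lemma RtoC_neq0 (s : R) : s <> 0 -> RtoC s <> 0%C.
Proof. intros H E. apply H. exact (f_equal fst E). Qed.

Lemma qint_0 (m : C -> C) (t : C) : m 0%C = 0%C -> qint m t 0 = 0%C.
Proof.
  intros H. unfold qint. replace (0 * 0 * t)%C with (RtoC 0) by ring. rewrite H.
  unfold Cdiv. ring.
Qed.

Lemma qint_bound (m : C -> C) (t : C) (s K : R) : m 0%C = 0%C -> Rabs s <= 1 ->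
  Cmod (m (s * s * t)%C) <= K * Cmod (s * s * t) ^ 2 ->
  Cmod (qint m t s) <= 2 * K * Cmod t ^ 2 * Rabs s.
Proof.
  intros H0 Hs HK. destruct (Req_dec s 0) as [->|Hn].
  - rewrite qint_0, Cmod_0, Rabs_R0 by auto. lra.
  - apply RtoC_neq0 in Hn as Hn'. unfold qint.
    rewrite Cmod_div by (repeat apply Cmult_neq_0; auto).
    rewrite !Cmod_mult, !Cmod_R in *. rewrite (Rabs_pos_eq 2) by lra.
    apply Rabs_pos_lt in Hn. set (a := Rabs s) in *.
    apply Rle_trans with (2 * (K * (a * a * Cmod t) ^ 2) / (a * a * a)).
    + apply Rmult_le_compat_r; [|lra]. left; apply Rinv_0_lt_compat. repeat apply Rmult_lt_0_compat; auto.
    + right; field; lra.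
Qed.

Lemma quad_on_0 (m : C -> C) (R0 K : R) : 0 < R0 -> quad_on m R0 K -> m 0%C = 0%C.
Proof.
  intros H [_ HK]. apply Cmod_eq_0. apply Rle_antisym; [|apply Cmod_ge_0].
  specialize (HK 0%C). rewrite Cmod_0 in HK. specialize (HK H). lra.
Qed.

Lemma Cmod_sst (s : R) (t : C) (R0 : R) : Rabs s <= 1 -> Cmod t < R0 -> Cmod (s * s * t)%C < R0.
Proof.
  intros Hs Ht. rewrite !Cmod_mult, !Cmod_R. pose proof (Rabs_pos s). pose proof (Cmod_ge_0 t).
  assert (0 <= Rabs s * Rabs s <= 1) by nra. nra.
Qed.

Lemma cder_sst (t z : C) : cder (fun z => z * z * t)%C z (2 * z * t)%C.
Proof.
  eapply cder_eq.
  - apply (cder_mult (fun z => z * z)%C (fun _ => t)); [|apply cder_const].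
    apply (cder_mult (fun z => z) (fun z => z)); apply cder_id.
  - ring.
Qed.

Section Q.
Context (m : C -> C) (R0 K : R) (HR : 0 < R0) (Hm : quad_on m R0 K).

Lemma qint_rcont (t : C) (s : R) : Cmod t < R0 -> 0 <= s <= 1 -> rcont (qint m t) s.
Proof.
  intros Ht Hs. pose proof (quad_on_0 m R0 K HR Hm) as H0. destruct Hm as [Hd HK].
  destruct (Req_dec s 0) as [->|Hn].
  - apply rcont_at_0 with (2 * K * Cmod t ^ 2) 1; [lra|now apply qint_0|].
    intros s Hs'. apply qint_bound; auto; [lra|]. apply HK, Cmod_sst; auto; lra.
  - apply RtoC_neq0 in Hn as Hn'.
    assert (H3 : (s * s * s)%C <> 0%C) by (repeat apply Cmult_neq_0; auto).
    destruct (Hd (s * s * t)%C) as [v Hv]; [apply Cmod_sst; auto; rewrite Rabs_pos_eq; lra|].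
    eapply rder_rcont.
    apply (rder_comp (fun z => 2 * m (z * z * t) / (z * z * z))%C RtoC); [apply rder_RtoC|].
    apply (cder_mult (fun z => 2 * m (z * z * t))%C (fun z => / (z * z * z))%C).
    + apply (cder_scal 2 (fun z => m (z * z * t))%C).
      apply (cder_comp m (fun z => z * z * t)%C); [apply cder_sst|apply Hv].
    + apply (cder_comp (fun z => / z)%C (fun z => z * z * z)%C); [|now apply cder_inv].
      apply (cder_mult (fun z => z * z)%C (fun z => z)); [|apply cder_id].
      apply (cder_mult (fun z => z) (fun z => z)); apply cder_id.
Qed.

Lemma Qop_bound (t : C) : Cmod t < R0 -> Cmod (Qop m t) <= 4 * K * Cmod t ^ 2.
Proof.
  intros Ht. pose proof (quad_on_0 m R0 K HR Hm) as H0.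
  replace (4 * K * Cmod t ^ 2) with (2 * (2 * K * Cmod t ^ 2) * (1 - 0)) by ring.
  apply Cint_bound; [lra| |].
  - intros; now apply qint_rcont.
  - intros s Hs.
    assert (E : 0 <= 2 * K * Cmod t ^ 2).
    { destruct Hm as [_ HK]. specialize (HK t Ht). pose proof (Cmod_ge_0 (m t)). lra. }
    apply Rle_trans with (2 * K * Cmod t ^ 2 * Rabs s).
    + apply qint_bound; auto; [rewrite Rabs_pos_eq; lra|]. apply Hm, Cmod_sst; auto.
      rewrite Rabs_pos_eq; lra.
    + rewrite Rabs_pos_eq by lra. nra.
Qed.

(** Differentiation under the integral is justified by a Taylor remainder uniform in [s], so the
    derivative is the integral of [dq s = 2 m'(s^2 t) / s]. The equation follows because
    [t * dq s - qint m t s] is the s-derivative of [m(s^2 t) / s^2]. *)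
Lemma Qop_solves (t : C) : Cmod t < R0 -> exists v, cder (Qop m) t v /\ (t * v - Qop m t)%C = m t.
Proof.
  intros Ht. pose proof (quad_on_0 m R0 K HR Hm) as H0. pose proof Hm as [Hd HK].
  assert (HK0 : forall t, Cmod t < R0 -> 0 <= K * Cmod t ^ 2).
  { intros z Hz. eapply Rle_trans; [apply Cmod_ge_0|apply HK; auto]. }
  assert (HKp : 0 <= K).
  { specialize (HK0 (RtoC (R0 / 2))). rewrite Cmod_R, Rabs_pos_eq in HK0 by lra.
    specialize (HK0 ltac:(lra)). assert (0 < (R0 / 2) ^ 2) by (apply pow_lt; lra). nra. }
  set (M := K * R0 ^ 2).
  assert (HM : forall z, Cmod z < R0 -> Cmod (m z) <= M).
  { intros z Hz. eapply Rle_trans; [apply HK; auto|]. apply Rmult_le_compat_l; auto.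
    apply pow_incr. split; [apply Cmod_ge_0|lra]. }
  destruct (functional_choice (fun t v => Cmod t < R0 -> cder m t v)) as [dm Hdm].
  { intros z. destruct (Rlt_dec (Cmod z) R0) as [h|h].
    - destruct (Hd z h) as [v Hv]. exists v; auto.
    - exists 0%C; intros; contradiction. }
  assert (Hdm0 : dm 0%C = 0%C).
  { apply (cder_unique m 0%C); [apply Hdm; rewrite Cmod_0; lra|].
    apply cder_quadratic with R0 K; auto. intros s Hs. rewrite H0, Cplus_0_l.
    replace (m s - 0 - s * 0)%C with (m s) by ring. auto. }
  set (Rad := fun z => R0 - Cmod z).
  assert (Hsub : forall z w, Cmod (w - z)%C < Rad z -> Cmod w < R0).
  { intros z w Hw. replace w with ((w - z) + z)%C by ring. unfold Rad in Hw.
    eapply Rle_lt_trans; [apply Cmod_triangle|]. lra. }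
  assert (Hlip : forall z w, Cmod z < R0 -> Cmod (w - z)%C < Rad z / 4 ->
    Cmod (dm w - dm z)%C <= 512 * M / Rad z ^ 2 * Cmod (w - z)%C).
  { intros z w Hz Hw. assert (0 < Rad z) by (unfold Rad; lra).
    assert (Cmod w < R0) by (apply (Hsub z); lra).
    apply (cder_lip_at m z (Rad z) M); auto; intros; [apply Hd|apply HM]; now apply (Hsub z). }
  (* At [s = 0] the numerator vanishes because [dm 0 = 0], so the value is 0 whatever the inverse of
     0 is. This agrees with the limit, since [dm] is Lipschitz at 0 and the numerator is
     [O(s^2)]. *)
  set (dq := fun s : R => (2 * dm (s * s * t) / s)%C).
  assert (Hdq0 : dq 0 = 0%C).
  { unfold dq. replace (0 * 0 * t)%C with (RtoC 0) by ring. rewrite Hdm0. unfold Cdiv. ring. }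
  assert (Hdq : forall s, 0 <= s <= 1 -> rcont dq s).
  { intros s Hs. destruct (Req_dec s 0) as [->|Hn].
    - set (d := Rmin 1 (R0 / (4 * (Cmod t + 1)))). pose proof (Cmod_ge_0 t) as Htp.
      assert (Hdp : 0 < d) by (apply Rmin_pos; [lra|apply Rdiv_lt_0_compat; lra]).
      apply rcont_at_0 with (2 * (512 * M / R0 ^ 2) * Cmod t) d; auto.
      intros s Hsd.
      assert (Hs1 : Rabs s < 1) by (eapply Rlt_le_trans; [apply Hsd|apply Rmin_l]).
      destruct (Req_dec s 0) as [->|Hn]; [rewrite Hdq0, Cmod_0, Rabs_R0; lra|].
      apply RtoC_neq0 in Hn as Hn'. apply Rabs_pos_lt in Hn.
      assert (Hsm : Cmod (s * s * t)%C < R0 / 4).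
      { rewrite !Cmod_mult, !Cmod_R.
        apply Rle_lt_trans with (Rabs s * (Cmod t + 1));
          [rewrite Rmult_assoc; apply Rmult_le_compat_l; [lra|nra]|].
        apply Rlt_le_trans with (R0 / (4 * (Cmod t + 1)) * (Cmod t + 1)).
        - apply Rmult_lt_compat_r; [lra|]. eapply Rlt_le_trans; [apply Hsd|apply Rmin_r].
        - right; field; lra. }
      assert (B : Cmod (dm (s * s * t)%C) <= 512 * M / R0 ^ 2 * Cmod (s * s * t)).
      { specialize (Hlip 0%C (s * s * t)%C). unfold Rad in Hlip. rewrite Cmod_0, Hdm0 in Hlip.
        rewrite Rminus_0_r in Hlip.
        replace (s * s * t - 0)%C with (s * s * t)%C in Hlip by ring.
        replace (dm (s * s * t) - 0)%C with (dm (s * s * t)%C) in Hlip by ring. now apply Hlip. }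
      unfold dq. rewrite Cmod_div, Cmod_mult, !Cmod_R by auto. rewrite (Rabs_pos_eq 2) by lra.
      rewrite !Cmod_mult, !Cmod_R in B.
      apply Rle_trans with (2 * (512 * M / R0 ^ 2 * (Rabs s * Rabs s * Cmod t)) / Rabs s).
      + apply Rmult_le_compat_r; [left; now apply Rinv_0_lt_compat|lra].
      + right; field; lra.
    - apply RtoC_neq0 in Hn as Hn'.
      assert (Hz : Cmod (s * s * t)%C < R0) by (apply Cmod_sst; auto; rewrite Rabs_pos_eq; lra).
      assert (C1 : rcont (fun s => dm (s * s * t)%C) s).
      { set (z := (s * s * t)%C) in *. specialize (Hlip z).
        set (L := 512 * M / Rad z ^ 2) in *.
        assert (HL : 0 <= L).
        { apply Rmult_le_pos.
          - apply Rmult_le_pos; [lra|]. apply Rmult_le_pos; [auto|apply pow2_ge_0].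
          - left; apply Rinv_0_lt_compat, pow_lt. unfold Rad; lra. }
        assert (Hc : rcont (fun s => s * s * t)%C s).
        { eapply rder_rcont. apply (rder_comp (fun z => z * z * t)%C RtoC);
            [apply rder_RtoC|apply cder_sst]. }
        intros eps He. set (e := Rmin (eps / (L + 1)) (Rad z / 8)).
        assert (HRz : 0 < Rad z) by (unfold Rad; lra).
        assert (He0 : 0 < e) by (apply Rmin_pos; [apply Rdiv_lt_0_compat|]; lra).
        destruct (Hc e He0) as (d & Hdp & Kd). exists d; split; auto. intros u Hu. cbv beta.
        specialize (Kd u Hu). cbv beta in Kd. fold z in Kd |- *.
        assert (e <= eps / (L + 1)) by apply Rmin_l. assert (e <= Rad z / 8) by apply Rmin_r.
        eapply Rle_trans; [apply Hlip; auto; lra|].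
        replace eps with ((L + 1) * (eps / (L + 1))) by (field; lra).
        apply Rmult_le_compat; try lra. apply Cmod_ge_0. }
      assert (C2 : exists v, rder (fun s => / RtoC s)%C s v).
      { eexists. apply (rder_comp (fun z => / z)%C RtoC); [apply rder_RtoC|now apply cder_inv]. }
      destruct C2 as [v2 Hv2]. apply rder_rcont in Hv2 as C2.
      set (a := fun s : R => (2 * dm (s * s * t))%C). set (b := fun s : R => (/ RtoC s)%C) in *.
      assert (Ca : rcont a s) by (now apply (rcont_scal 2%C (fun s => dm (s * s * t)%C))).
      change dq with (fun s => (a s * b s)%C).
      intros eps He. pose proof (Cmod_ge_0 (a s)). pose proof (Cmod_ge_0 (b s)).
      destruct (Ca (Rmin 1 (eps / (2 * (Cmod (b s) + 1))))) as (d1 & Hd1 & K1);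
        [apply Rmin_pos; [lra|apply Rdiv_lt_0_compat; lra]|].
      destruct (C2 (eps / (2 * (Cmod (a s) + 1)))) as (d2 & Hd2 & K2);
        [apply Rdiv_lt_0_compat; lra|].
      exists (Rmin d1 d2); split; [now apply Rmin_pos|]. intros u Hu. cbv beta.
      pose proof (Rmin_l d1 d2); pose proof (Rmin_r d1 d2).
      specialize (K1 u ltac:(lra)). specialize (K2 u ltac:(lra)).
      pose proof (Rmin_l 1 (eps / (2 * (Cmod (b s) + 1)))).
      pose proof (Rmin_r 1 (eps / (2 * (Cmod (b s) + 1)))).
      replace (a (s + u)%R * b (s + u)%R - a s * b s)%C with
        ((a s + (a (s + u)%R - a s)) * (b (s + u)%R - b s) + (a (s + u)%R - a s) * b s)%C by ring.
      replace eps with ((Cmod (a s) + 1) * (eps / (2 * (Cmod (a s) + 1)))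
        + eps / (2 * (Cmod (b s) + 1)) * (Cmod (b s) + 1)) by (field; lra).
      apply Cmod_plus_le; apply Cmod_mult_le; auto; try lra.
      apply Cmod_plus_le; lra. }
  assert (Hq : forall w, Cmod w < R0 -> forall s, 0 <= s <= 1 -> rcont (qint m w) s)
    by (intros; now apply qint_rcont).
  exists (Cint dq 0 1). split.
  - set (L := 512 * M / Rad t ^ 2).
    assert (HRt : 0 < Rad t) by (unfold Rad; lra).
    assert (HL : 0 <= L).
    { apply Rmult_le_pos.
      - apply Rmult_le_pos; [lra|]. apply Rmult_le_pos; [auto|apply pow2_ge_0].
      - left; apply Rinv_0_lt_compat, pow_lt; auto. }
    apply cder_quadratic with (Rad t / 4) (4 * L); [lra|]. intros e He.
    assert (Hte : Cmod (t + e)%C < R0).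
    { apply (Hsub t). replace (t + e - t)%C with e by ring. lra. }
    unfold Qop. rewrite <- (Cint_scal e dq) by (auto; lra).
    rewrite <- (Cint_minus (qint m (t + e)%C) (qint m t)) by (auto; lra).
    rewrite <- Cint_minus; [|lra| |].
    2:{ intros; apply rcont_minus; auto. }
    2:{ intros; apply rcont_scal; auto. }
    replace (4 * L * Cmod e ^ 2) with (2 * (2 * L * Cmod e ^ 2) * (1 - 0)) by ring.
    apply Cint_bound; [lra| |].
    { intros s Hs. apply rcont_minus; [apply rcont_minus|apply rcont_scal]; auto. }
    intros s Hs. destruct (Req_dec s 0) as [->|Hn].
    { rewrite !qint_0, Hdq0 by auto. replace (0 - 0 - e * 0)%C with (RtoC 0) by ring.
      rewrite Cmod_0. apply Rmult_le_pos; [lra|apply pow2_ge_0]. }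
    assert (Hs1 : Rabs s <= 1) by (rewrite Rabs_pos_eq; lra).
    apply RtoC_neq0 in Hn as Hn'. assert (Hsp : 0 < s) by lra.
    (* As [|s^2 t| <= |t|], the disk of radius [Rad t] about [s^2 t] also lies in the domain, and
       one constant [L] serves all [s]. The remainder carries [s^4], which outweighs the [s^3] in
       the denominator. *)
    assert (T : Cmod (m (s * s * t + s * s * e) - m (s * s * t) - (s * s * e) * dm (s * s * t))%C
      <= L * Cmod (s * s * e) ^ 2).
    { assert (Hin : forall z, Cmod (z - s * s * t)%C < Rad t -> Cmod z < R0).
      { intros z Hz. replace z with ((z - s * s * t) + s * s * t)%C by ring.
        eapply Rle_lt_trans; [apply Cmod_triangle|].
        assert (Cmod (s * s * t)%C <= Cmod t); [|unfold Rad in Hz; lra].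
        rewrite !Cmod_mult, !Cmod_R, Rabs_pos_eq by lra. pose proof (Cmod_ge_0 t).
        assert (0 <= s * s <= 1) by nra. nra. }
      apply taylor2; auto.
      - apply Hdm, Cmod_sst; auto.
      - apply Cmod_sst; auto. }
    replace (s * s * t + s * s * e)%C with (s * s * (t + e))%C in T by ring.
    replace (qint m (t + e) s - qint m t s - e * dq s)%C with
      (2 * (m (s * s * (t + e)) - m (s * s * t) - (s * s * e) * dm (s * s * t)) / (s * s * s))%C
      by (unfold qint, dq; field; auto).
    rewrite Cmod_div by (repeat apply Cmult_neq_0; auto).
    rewrite (Cmod_mult 2), !(Cmod_mult (s * s)%C), !Cmod_mult, !Cmod_R in *.
    rewrite (Rabs_pos_eq 2) by lra. rewrite (Rabs_pos_eq s) in * by lra.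
    apply Rle_trans with (2 * (L * (s * s * Cmod e) ^ 2) / (s * s * s)).
    + apply Rmult_le_compat_r; [|lra]. left; apply Rinv_0_lt_compat.
      repeat apply Rmult_lt_0_compat; auto.
    + replace (2 * (L * (s * s * Cmod e) ^ 2) / (s * s * s)) with (2 * L * Cmod e ^ 2 * s)
        by (field; lra).
      assert (0 <= 2 * L * Cmod e ^ 2) by (apply Rmult_le_pos; [lra|apply pow2_ge_0]). nra.
  (* The antiderivative of [t * dq s - qint m t s], with [E 1 = m t] and [E 0 = 0]. It is
     differentiable at 0 as well, with derivative 0, because [E e] is [O(e^2)]. *)
  - set (E := fun z => (m (z * z * t) / (z * z))%C).
    assert (HE : forall s, 0 <= s <= 1 -> rder (fun s => E (RtoC s)) s (t * dq s - qint m t s)%C).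
    { intros s Hs. rewrite <- (Cmult_1_l (t * dq s - qint m t s)%C).
      apply (rder_comp E RtoC); [apply rder_RtoC|].
      destruct (Req_dec s 0) as [->|Hn].
      - rewrite Hdq0, qint_0 by auto. replace (t * 0 - 0)%C with (RtoC 0) by ring.
        apply cder_quadratic with 1 (K * Cmod t ^ 2); [lra|]. intros e He.
        replace (E 0%C) with (RtoC 0).
        2:{ unfold E. replace (0 * 0 * t)%C with (RtoC 0) by ring. rewrite H0. unfold Cdiv. ring. }
        rewrite Cplus_0_l. replace (E e - 0 - e * 0)%C with (E e) by ring.
        destruct (Ceq_dec e 0%C) as [->|Hne].
        + unfold E. replace (0 * 0 * t)%C with (RtoC 0) by ring. rewrite H0.
          unfold Cdiv. rewrite Cmult_0_l, Cmod_0. lra.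
        + unfold E. apply Cmod_gt_0 in Hne as Hp.
          rewrite Cmod_div by (now apply Cmult_neq_0).
          assert (B : Cmod (m (e * e * t)%C) <= K * Cmod (e * e * t) ^ 2).
          { apply HK. rewrite !Cmod_mult. pose proof (Cmod_ge_0 t).
            assert (0 <= Cmod e * Cmod e <= 1) by nra. nra. }
          rewrite !Cmod_mult in *.
          apply Rle_trans with (K * (Cmod e * Cmod e * Cmod t) ^ 2 / (Cmod e * Cmod e)).
          * apply Rmult_le_compat_r; auto. left; apply Rinv_0_lt_compat. nra.
          * right; field; lra.
      - apply RtoC_neq0 in Hn as Hn'.
        eapply cder_eq.
        + apply (cder_mult (fun z => m (z * z * t))%C (fun z => / (z * z))%C).
          * apply (cder_comp m (fun z => z * z * t)%C); [apply cder_sst|].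
            apply Hdm, Cmod_sst; auto. rewrite Rabs_pos_eq; lra.
          * apply (cder_comp (fun z => / z)%C (fun z => z * z)%C);
              [|apply cder_inv; now apply Cmult_neq_0].
            apply (cder_mult (fun z => z) (fun z => z)); apply cder_id.
        + unfold dq, qint. field; auto. }
    assert (J : Cint (fun s => t * dq s - qint m t s)%C 0 1 = (E (RtoC 1) - E (RtoC 0))%C).
    { apply (Cint_derive (fun s => E (RtoC s))); auto; [lra|].
      intros; apply rcont_minus; auto. now apply rcont_scal, Hdq. }
    rewrite (Cint_minus (fun s => t * dq s)%C), Cint_scal in J; auto; try lra.
    2:{ intros; now apply rcont_scal, Hdq. }
    unfold Qop. rewrite J. unfold E.
    replace (0 * 0 * t)%C with (RtoC 0) by ring. replace (1 * 1 * t)%C with t by ring.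
    rewrite H0. unfold Cdiv. replace (1 * 1)%C with (RtoC 1) by ring.
    replace (/ 1)%C with (RtoC 1) by (field; apply RtoC_neq0; lra). ring.
Qed.
End Q.

Lemma Qop_lip (m1 m2 : C -> C) (R0 K d : R) (t : C) : 0 < R0 ->
  quad_on m1 R0 K -> quad_on m2 R0 K -> 0 <= d ->
  (forall t, Cmod t < R0 -> Cmod (m1 t - m2 t)%C <= d * Cmod t ^ 2) ->
  Cmod t < R0 -> Cmod (Qop m1 t - Qop m2 t)%C <= 4 * d * Cmod t ^ 2.
Proof.
  intros HR H1 H2 Hd H Ht. unfold Qop.
  assert (R1 : forall s, 0 <= s <= 1 -> rcont (qint m1 t) s)
    by (intros; now apply (qint_rcont m1 R0 K)).
  assert (R2 : forall s, 0 <= s <= 1 -> rcont (qint m2 t) s)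
    by (intros; now apply (qint_rcont m2 R0 K)).
  rewrite <- Cint_minus by (auto; lra).
  replace (4 * d * Cmod t ^ 2) with (2 * (2 * d * Cmod t ^ 2) * (1 - 0)) by ring.
  apply Cint_bound; [lra| |].
  - intros; apply rcont_minus; auto.
  - intros s Hs.
    replace (qint m1 t s - qint m2 t s)%C with (qint (fun z => m1 z - m2 z)%C t s)
      by (unfold qint, Cdiv; ring).
    apply Rle_trans with (2 * d * Cmod t ^ 2 * Rabs s).
    + apply (qint_bound (fun z => m1 z - m2 z)%C).
      * rewrite (quad_on_0 m1 R0 K), (quad_on_0 m2 R0 K) by auto. ring.
      * rewrite Rabs_pos_eq; lra.
      * apply H, Cmod_sst; auto. rewrite Rabs_pos_eq; lra.
    + rewrite Rabs_pos_eq by lra.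
      assert (0 <= 2 * d * Cmod t ^ 2) by (apply Rmult_le_pos; [lra|apply pow2_ge_0]). nra.
Qed.
(** * Existence of the invariant curve *)

Section Picard.
Context (f g h : C3 -> C) (r K : R) (b : C) (rho : R).
Context (Hf : order2_on f r K) (Hg : order2_on g r K) (Hh : order2_on h r K).
Context (HK : 0 <= K) (Hrho : 0 < rho) (Hrho_r : 2 * rho < r).

Let beta := Cmod b.
(** Quadratic bounds for the z-, y- and x-components of an iterate: a nonlinear term along a curve
    of size at most [2 |t|] contributes [4 * K], and each application of [bQ] multiplies by
    [4 * beta]. The hypothesis [HA] conversely keeps a curve with bound [A] in all components within
    size [2 |t|]. *)
Let A1 := 4 * beta * (4 * K).
Let A2 := 4 * beta * (A1 + 4 * K).
Let A3 := 4 * beta * (A2 + 4 * K).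
Let A := A1 + A2 + A3.
Context (HA : 3 * A * rho <= 1).
(** If two curves differ by [d * |t| ^ 2] in each of three coordinates, [o2_lip] with [m = 2 |t|]
    gives [K * 2 rho * 3 d]. [Hkappa] says that passing through z, y and x in turn halves the
    distance. *)
Let kappa := 6 * K * rho.
Context (Hkappa : 4 * beta * (1 + 4 * beta * (1 + 4 * beta)) * kappa <= 1 / 2).

Definition curve (P : C -> C3) (t : C) : C3 := ((t + c3x (P t))%C, c3y (P t), c3z (P t)).
Definition along (F : C3 -> C) (P : C -> C3) (t : C) : C := F (curve P t).
Definition bQ (m : C -> C) (t : C) : C := (b * Qop m t)%C.
(** With [b = 1 / (i w)]. The y-component uses the new z and the x-component the new y, so that the
    nilpotent coupling is solved exactly in each step; iterating it would bring in a factor that no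
    shrinking of the disk makes small. *)
Definition pic_z (P : C -> C3) : C -> C := bQ (along h P).
Definition pic_y (P : C -> C3) : C -> C := bQ (fun t => pic_z P t + along g P t)%C.
Definition pic_x (P : C -> C3) : C -> C := bQ (fun t => pic_y P t + along f P t)%C.
Definition pic (P : C -> C3) (t : C) : C3 := (pic_x P t, pic_y P t, pic_z P t).
Definition quad3 (P : C -> C3) (A : R) : Prop :=
  quad_on (fun t => c3x (P t)) rho A /\ quad_on (fun t => c3y (P t)) rho A /\
  quad_on (fun t => c3z (P t)) rho A.
Definition close (P P' : C -> C3) (d : R) : Prop :=
  forall t, Cmod t < rho ->
    Cmod (c3x (P t) - c3x (P' t))%C <= d * Cmod t ^ 2 /\
    Cmod (c3y (P t) - c3y (P' t))%C <= d * Cmod t ^ 2 /\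
    Cmod (c3z (P t) - c3z (P' t))%C <= d * Cmod t ^ 2.

Lemma quad_on_le (m : C -> C) (R0 K1 K2 : R) : K1 <= K2 -> quad_on m R0 K1 -> quad_on m R0 K2.
Proof.
  intros Hle [H1 H2]; split; auto. intros t Ht. eapply Rle_trans; [apply H2; auto|].
  apply Rmult_le_compat_r; auto. apply pow2_ge_0.
Qed.

Lemma quad_on_plus (m n : C -> C) (R0 K1 K2 : R) : quad_on m R0 K1 -> quad_on n R0 K2 ->
  quad_on (fun t => m t + n t)%C R0 (K1 + K2).
Proof.
  intros [H1 H2] [H3 H4]; split.
  - intros t Ht. destruct (H1 t Ht) as [u Hu]. destruct (H3 t Ht) as [v Hv].
    exists (u + v)%C. now apply cder_plus.
  - intros t Ht. rewrite Rmult_plus_distr_r. apply Cmod_plus_le; auto.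
Qed.

Lemma bQ_quad (m : C -> C) (Km : R) : quad_on m rho Km -> quad_on (bQ m) rho (4 * beta * Km).
Proof.
  intros H. split.
  - intros t Ht. destruct (Qop_solves m rho Km Hrho H t Ht) as (v & Hv & _).
    exists (b * v)%C. now apply cder_scal.
  - intros t Ht. replace (4 * beta * Km * Cmod t ^ 2) with (beta * (4 * Km * Cmod t ^ 2)) by ring.
    apply Cmod_mult_le; [apply Rle_refl|]. now apply (Qop_bound m rho Km).
Qed.

Lemma bQ_lip (m1 m2 : C -> C) (Km d : R) : quad_on m1 rho Km -> quad_on m2 rho Km -> 0 <= d ->
  (forall t, Cmod t < rho -> Cmod (m1 t - m2 t)%C <= d * Cmod t ^ 2) ->
  forall t, Cmod t < rho -> Cmod (bQ m1 t - bQ m2 t)%C <= 4 * beta * d * Cmod t ^ 2.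
Proof.
  intros H1 H2 Hd H t Ht. unfold bQ.
  replace (b * Qop m1 t - b * Qop m2 t)%C with (b * (Qop m1 t - Qop m2 t))%C by ring.
  replace (4 * beta * d * Cmod t ^ 2) with (beta * (4 * d * Cmod t ^ 2)) by ring.
  apply Cmod_mult_le; [apply Rle_refl|]. now apply (Qop_lip m1 m2 rho Km).
Qed.

Lemma bQ_solves (m : C -> C) (Km : R) (t : C) : quad_on m rho Km -> Cmod t < rho ->
  exists v, cder (bQ m) t v /\ (t * v - bQ m t)%C = (b * m t)%C.
Proof.
  intros H Ht. destruct (Qop_solves m rho Km Hrho H t Ht) as (v & Hv & E).
  exists (b * v)%C; split; [now apply cder_scal|]. rewrite <- E. unfold bQ. ring.
Qed.

Lemma curve_sum3 (P : C -> C3) (t : C) : quad3 P A -> Cmod t < rho ->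
  sum3 (t + c3x (P t)) (c3y (P t)) (c3z (P t)) <= 2 * Cmod t.
Proof.
  intros ([_ Hx] & [_ Hy] & [_ Hz]) Ht. unfold sum3.
  specialize (Hx t Ht); specialize (Hy t Ht); specialize (Hz t Ht).
  pose proof (Cmod_triangle t (c3x (P t))). pose proof (Cmod_ge_0 t).
  pose proof (Cmod_ge_0 (c3x (P t))).
  assert (HA' : 3 * A * Cmod t ^ 2 <= Cmod t).
  { assert (0 <= A * Cmod t ^ 2) by lra.
    destruct (Rle_lt_or_eq_dec 0 (Cmod t)) as [h0|h0]; auto.
    - assert (0 <= A).
      { apply Rmult_le_reg_r with (Cmod t ^ 2); [apply pow_lt; auto|lra]. }
      nra.
    - rewrite <- h0. nra. }
  lra.
Qed.

Lemma along_quad (F : C3 -> C) (P : C -> C3) : order2_on F r K -> quad3 P A ->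
  quad_on (along F P) rho (4 * K).
Proof.
  intros HF HP. pose proof HP as ([Hx _] & [Hy _] & [Hz _]). split.
  - intros t Ht. destruct (Hx t Ht) as [u1 Hu1]. destruct (Hy t Ht) as [u2 Hu2].
    destruct (Hz t Ht) as [u3 Hu3].
    apply (cder_curve F (fun s => s + c3x (P s))%C (fun s => c3y (P s)) (fun s => c3z (P s)) t
      (1 + u1)%C u2 u3); auto.
    + apply (cder_plus (fun s => s)); auto using cder_id.
    + apply (o2_diff _ _ _ HF). pose proof (curve_sum3 P t HP Ht). lra.
  - intros t Ht. pose proof (curve_sum3 P t HP Ht) as B. unfold along, curve.
    eapply Rle_trans; [apply (o2_sq _ _ _ HF); lra|].
    replace (4 * K * Cmod t ^ 2) with (K * (2 * Cmod t) ^ 2) by ring.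
    apply Rmult_le_compat_l; auto. apply pow_incr. split; auto. apply sum3_ge0.
Qed.

Lemma along_lip (F : C3 -> C) (P P' : C -> C3) (d : R) : order2_on F r K ->
  quad3 P A -> quad3 P' A -> 0 <= d -> close P P' d ->
  forall t, Cmod t < rho -> Cmod (along F P t - along F P' t)%C <= kappa * d * Cmod t ^ 2.
Proof.
  intros HF HP HP' Hd Hc t Ht. destruct (Hc t Ht) as (Hx & Hy & Hz). unfold along, curve.
  pose proof (Cmod_ge_0 t).
  eapply Rle_trans.
  - apply (o2_lip _ _ _ HF _ _ _ _ _ _ (2 * Cmod t)); try (now apply curve_sum3). lra.
  - replace (t + c3x (P t) - (t + c3x (P' t)))%C with (c3x (P t) - c3x (P' t))%C by ring.
    apply Rle_trans with (K * (2 * Cmod t) * (3 * d * Cmod t ^ 2)).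
    + apply Rmult_le_compat_l; [apply Rmult_le_pos; lra|]. unfold sum3. lra.
    + unfold kappa. replace (K * (2 * Cmod t) * (3 * d * Cmod t ^ 2))
        with (6 * K * d * Cmod t ^ 2 * Cmod t) by ring.
      replace (6 * K * rho * d * Cmod t ^ 2) with (6 * K * d * Cmod t ^ 2 * rho) by ring.
      apply Rmult_le_compat_l; [|lra]. apply Rmult_le_pos; [|apply pow2_ge_0].
      apply Rmult_le_pos; lra.
Qed.

Lemma A_pos : 0 <= A1 /\ 0 <= A2 /\ 0 <= A3.
Proof.
  assert (Hb : 0 <= beta) by apply Cmod_ge_0.
  assert (0 <= A1) by (unfold A1; apply Rmult_le_pos; lra).
  assert (0 <= A2) by (unfold A2; apply Rmult_le_pos; lra).
  assert (0 <= A3) by (unfold A3; apply Rmult_le_pos; lra). auto.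
Qed.

Lemma pic_quads (P : C -> C3) : quad3 P A ->
  quad_on (pic_z P) rho A1 /\ quad_on (pic_y P) rho A2 /\ quad_on (pic_x P) rho A3.
Proof.
  intros HP.
  assert (Qz : quad_on (pic_z P) rho A1) by (apply bQ_quad, along_quad; auto).
  assert (Qy : quad_on (pic_y P) rho A2)
    by (apply bQ_quad, quad_on_plus; auto; apply along_quad; auto).
  assert (Qx : quad_on (pic_x P) rho A3)
    by (apply bQ_quad, quad_on_plus; auto; apply along_quad; auto).
  auto.
Qed.

Lemma pic_quad (P : C -> C3) : quad3 P A -> quad3 (pic P) A.
Proof.
  intros HP. destruct (pic_quads P HP) as (Qz & Qy & Qx). pose proof A_pos.
  split; [|split]; eapply quad_on_le; [|apply Qx| |apply Qy| |apply Qz]; unfold A; lra.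
Qed.

Lemma pic_close (P P' : C -> C3) (d : R) : quad3 P A -> quad3 P' A -> 0 <= d -> close P P' d ->
  close (pic P) (pic P') (d / 2).
Proof.
  intros HP HP' Hd Hc.
  destruct (pic_quads P HP) as (Qz & Qy & Qx). destruct (pic_quads P' HP') as (Qz' & Qy' & Qx').
  assert (Hb : 0 <= beta) by apply Cmod_ge_0.
  assert (Hk : 0 <= kappa) by (unfold kappa; apply Rmult_le_pos; lra).
  set (d1 := 4 * beta * (kappa * d)). set (d2 := 4 * beta * (d1 + kappa * d)).
  set (d3 := 4 * beta * (d2 + kappa * d)).
  assert (Hkd : 0 <= kappa * d) by (now apply Rmult_le_pos).
  assert (Hd1 : 0 <= d1) by (unfold d1; apply Rmult_le_pos; lra).
  assert (Hd2 : 0 <= d2) by (unfold d2; apply Rmult_le_pos; lra).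
  assert (Cz : forall t, Cmod t < rho -> Cmod (pic_z P t - pic_z P' t)%C <= d1 * Cmod t ^ 2).
  { apply bQ_lip with (4 * K); auto; try (apply along_quad; auto). now apply along_lip. }
  assert (Cy : forall t, Cmod t < rho -> Cmod (pic_y P t - pic_y P' t)%C <= d2 * Cmod t ^ 2).
  { apply bQ_lip with (A1 + 4 * K); try (apply quad_on_plus; auto; apply along_quad; auto); [lra|].
    intros t Ht. rewrite Rmult_plus_distr_r.
    replace (pic_z P t + along g P t - (pic_z P' t + along g P' t))%C with
      ((pic_z P t - pic_z P' t) + (along g P t - along g P' t))%C by ring.
    apply Cmod_plus_le; auto. now apply along_lip. }
  assert (Cx : forall t, Cmod t < rho -> Cmod (pic_x P t - pic_x P' t)%C <= d3 * Cmod t ^ 2).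
  { apply bQ_lip with (A2 + 4 * K); try (apply quad_on_plus; auto; apply along_quad; auto); [lra|].
    intros t Ht. rewrite Rmult_plus_distr_r.
    replace (pic_y P t + along f P t - (pic_y P' t + along f P' t))%C with
      ((pic_y P t - pic_y P' t) + (along f P t - along f P' t))%C by ring.
    apply Cmod_plus_le; auto. now apply along_lip. }
  assert (E3 : d3 = (4 * beta * (1 + 4 * beta * (1 + 4 * beta)) * kappa) * d)
    by (unfold d3, d2, d1; ring).
  assert (Hbk : 0 <= 4 * beta * kappa * d).
  { repeat apply Rmult_le_pos; lra. }
  assert (Hbbk : 0 <= 4 * beta * (4 * beta * kappa * d)) by (apply Rmult_le_pos; lra).
  assert (Hbbbk : 0 <= 4 * beta * (4 * beta * (4 * beta * kappa * d))) by (apply Rmult_le_pos; lra).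
  assert (d3 <= d / 2) by (rewrite E3; unfold Rdiv; nra).
  assert (d2 <= d3) by (unfold d3, d2, d1 in *; nra).
  assert (d1 <= d2) by (unfold d2, d1 in *; nra).
  intros t Ht. pose proof (pow2_ge_0 (Cmod t)).
  split; [|split].
  - eapply Rle_trans; [exact (Cx t Ht)|]. apply Rmult_le_compat_r; lra.
  - eapply Rle_trans; [exact (Cy t Ht)|]. apply Rmult_le_compat_r; lra.
  - eapply Rle_trans; [exact (Cz t Ht)|]. apply Rmult_le_compat_r; lra.
Qed.

(** The fixed-point equation is expressed by distance 0, that is, equality on the disk only, since
    nothing is known about the functions outside it. *)
Lemma pic_fixpoint : exists P, quad3 P A /\ close P (pic P) 0.
Proof.
  destruct A_pos as (P1 & P2 & P3). assert (PA : 0 <= A) by (unfold A; lra).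
  set (P := fun n => Nat.iter n pic (fun _ => C3zero)).
  assert (Hquad0 : quad_on (fun _ => 0%C) rho A).
  { split; [intros t _; eexists; apply cder_const|]. intros t _. rewrite Cmod_0.
    apply Rmult_le_pos; [auto|apply pow2_ge_0]. }
  assert (PS : forall n, P (S n) = pic (P n)) by reflexivity.
  assert (HP : forall n, quad3 (P n) A).
  { induction n; [split; [|split]; exact Hquad0|]. now apply pic_quad. }
  assert (Hcl : forall n, close (P (S n)) (P n) (2 * A / 2 ^ n)).
  { induction n.
    - intros t Ht. destruct (HP 1%nat) as ([_ Hx] & [_ Hy] & [_ Hz]).
      destruct (HP 0%nat) as ([_ Hx0] & [_ Hy0] & [_ Hz0]).
      replace (2 * A / 2 ^ 0 * Cmod t ^ 2) with (A * Cmod t ^ 2 + A * Cmod t ^ 2) by (simpl; field).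
      split; [|split]; apply Cmod_minus_le; auto.
    - replace (2 * A / 2 ^ S n) with (2 * A / 2 ^ n / 2)
        by (simpl; field; apply pow_nonzero; lra).
      apply (pic_close (P (S n)) (P n)); auto. apply Rmult_le_pos; [lra|].
      left; apply Rinv_0_lt_compat, pow_lt; lra. }
  assert (Hlim : forall t, exists l : C3, Cmod t < rho -> forall n,
    Cmod (c3x (P n t) - c3x l)%C <= 4 * (2 * A * Cmod t ^ 2) / 2 ^ n /\
    Cmod (c3y (P n t) - c3y l)%C <= 4 * (2 * A * Cmod t ^ 2) / 2 ^ n /\
    Cmod (c3z (P n t) - c3z l)%C <= 4 * (2 * A * Cmod t ^ 2) / 2 ^ n).
  { intros t. destruct (Rlt_dec (Cmod t) rho) as [Ht|Ht]; [|exists C3zero; intros; contradiction].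
    assert (E : forall n, 2 * A / 2 ^ n * Cmod t ^ 2 = 2 * A * Cmod t ^ 2 / 2 ^ n)
      by (intros; unfold Rdiv; ring).
    destruct (Cseq_geom (fun n => c3x (P n t)) (2 * A * Cmod t ^ 2)) as [lx Hx];
      [intros n; rewrite <- E; exact (proj1 (Hcl n t Ht))|].
    destruct (Cseq_geom (fun n => c3y (P n t)) (2 * A * Cmod t ^ 2)) as [ly Hy];
      [intros n; rewrite <- E; exact (proj1 (proj2 (Hcl n t Ht)))|].
    destruct (Cseq_geom (fun n => c3z (P n t)) (2 * A * Cmod t ^ 2)) as [lz Hz];
      [intros n; rewrite <- E; exact (proj2 (proj2 (Hcl n t Ht)))|].
    exists (lx, ly, lz). intros _ n. repeat split; [apply Hx|apply Hy|apply Hz]. }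
  destruct (functional_choice _ Hlim) as [L HL].
  (* [holo_limit] concludes only at the centre of its disk, so it is applied about each [z] with
     radius [rho - |z|]. *)
  assert (Hquad : forall (k : nat -> C -> C) (l : C -> C),
    (forall n, quad_on (k n) rho A) ->
    (forall t, Cmod t < rho -> forall n, Cmod (k n t - l t)%C <= 4 * (2 * A * Cmod t ^ 2) / 2 ^ n) ->
    quad_on l rho A).
  { intros k l Hk Hl. split.
    - intros z Hz.
      assert (Hsub : forall w, Cmod (w - z)%C < rho - Cmod z -> Cmod w < rho).
      { intros w Hw. replace w with ((w - z) + z)%C by ring.
        eapply Rle_lt_trans; [apply Cmod_triangle|]. lra. }
      assert (Hsq : forall w, Cmod w < rho -> Cmod w ^ 2 <= rho ^ 2)
        by (intros w Hw; apply pow_incr; split; [apply Cmod_ge_0|lra]).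
      apply (holo_limit k l z (rho - Cmod z) (A * rho ^ 2) (4 * (2 * A * rho ^ 2))); [lra| | |].
      + intros n w Hw. apply (Hk n). auto.
      + intros n w Hw. apply Hsub in Hw. eapply Rle_trans; [apply (Hk n); auto|].
        apply Rmult_le_compat_l; auto.
      + intros n w Hw. apply Hsub in Hw. eapply Rle_trans; [apply Hl; auto|].
        apply Rmult_le_compat_r; [left; apply Rinv_0_lt_compat, pow_lt; lra|].
        specialize (Hsq w Hw). nra.
    - intros t Ht. apply le_add_geom with (4 * (2 * A * Cmod t ^ 2)). intros n.
      replace (l t) with (k n t - (k n t - l t))%C by ring.
      apply Cmod_minus_le; auto. now apply (Hk n). }
  assert (HLq : quad3 L A).
  { split; [|split].
    - apply (Hquad (fun n t => c3x (P n t))); [intros n; exact (proj1 (HP n))|]. intros t Ht n. exact (proj1 (HL t Ht n)).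
    - apply (Hquad (fun n t => c3y (P n t))); [intros n; exact (proj1 (proj2 (HP n)))|]. intros t Ht n. exact (proj1 (proj2 (HL t Ht n))).
    - apply (Hquad (fun n t => c3z (P n t))); [intros n; exact (proj2 (proj2 (HP n)))|]. intros t Ht n. exact (proj2 (proj2 (HL t Ht n))). }
  exists L; split; auto.
  assert (HPL : forall n, close (P n) L (8 * A / 2 ^ n)).
  { intros n t Ht. replace (8 * A / 2 ^ n * Cmod t ^ 2) with (4 * (2 * A * Cmod t ^ 2) / 2 ^ n)
      by (unfold Rdiv; ring). exact (HL t Ht n). }
  assert (Hpos : forall n, 0 <= 8 * A / 2 ^ n).
  { intros n. apply Rmult_le_pos; [lra|]. left; apply Rinv_0_lt_compat, pow_lt; lra. }
  intros t Ht. rewrite Rmult_0_l.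
  assert (Hd : forall n, 8 * A / 2 ^ S n * Cmod t ^ 2 + 8 * A / 2 ^ n / 2 * Cmod t ^ 2
    = 0 + 8 * A * Cmod t ^ 2 / 2 ^ n)
    by (intros n; simpl; field; apply pow_nonzero; lra).
  (* [P (S n)] is [pic (P n)], hence close to [pic L] by contraction and to [L] by convergence; as
     [n] grows, the two limits must agree. *)
  assert (HS : forall n, close (P (S n)) (pic L) (8 * A / 2 ^ n / 2))
    by (intros n; apply (pic_close (P n) L); auto).
  split; [|split]; apply le_add_geom with (8 * A * Cmod t ^ 2); intros n; rewrite <- Hd;
    destruct (HPL (S n) t Ht) as (a1 & a2 & a3); destruct (HS n t Ht) as (b1 & b2 & b3).
  - replace (c3x (L t) - c3x (pic L t))%C with
      ((c3x (P (S n) t) - c3x (pic L t)) - (c3x (P (S n) t) - c3x (L t)))%C by ring.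
    rewrite Rplus_comm. now apply Cmod_minus_le.
  - replace (c3y (L t) - c3y (pic L t))%C with
      ((c3y (P (S n) t) - c3y (pic L t)) - (c3y (P (S n) t) - c3y (L t)))%C by ring.
    rewrite Rplus_comm. now apply Cmod_minus_le.
  - replace (c3z (L t) - c3z (pic L t))%C with
      ((c3z (P (S n) t) - c3z (pic L t)) - (c3z (P (S n) t) - c3z (L t)))%C by ring.
    rewrite Rplus_comm. now apply Cmod_minus_le.
Qed.

(** With [b = 1 / (i w)], multiplying the three equations by [i w] gives
    [i w t gamma'(t) = V (gamma t)] for [gamma = (t + X, Y, Z)]. *)
Lemma picard_solution : exists X Y Z : C -> C,
  (quad_on X rho A /\ quad_on Y rho A /\ quad_on Z rho A) /\
  forall t, Cmod t < rho ->
    sum3 (t + X t) (Y t) (Z t) <= 2 * Cmod t /\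
    exists u1 u2 u3, cder (fun s => s + X s)%C t u1 /\ cder Y t u2 /\ cder Z t u3 /\
      (t * u1 = t + X t + b * (Y t + f (t + X t, Y t, Z t)))%C /\
      (t * u2 = Y t + b * (Z t + g (t + X t, Y t, Z t)))%C /\
      (t * u3 = Z t + b * h (t + X t, Y t, Z t))%C.
Proof.
  destruct pic_fixpoint as (P & HP & Hc).
  destruct (pic_quads P HP) as (Qz & Qy & _).
  assert (Hfix : forall t, Cmod t < rho -> c3x (P t) = pic_x P t /\ c3y (P t) = pic_y P t /\
    c3z (P t) = pic_z P t).
  { intros t Ht. destruct (Hc t Ht) as (Ex & Ey & Ez). rewrite Rmult_0_l in *.
    assert (E0 : forall a c : C, Cmod (a - c)%C <= 0 -> a = c).
    { intros a c Hac. replace a with ((a - c) + c)%C by ring.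
      rewrite (Cmod_eq_0 (a - c)%C); [ring|]. apply Rle_antisym; auto. apply Cmod_ge_0. }
    split; [|split]; now apply E0. }
  exists (fun t => c3x (P t)), (fun t => c3y (P t)), (fun t => c3z (P t)).
  split; [apply HP|]. intros t Ht. split; [now apply curve_sum3|].
  assert (Hext : forall (k l : C -> C) v, (forall s, Cmod s < rho -> k s = l s) ->
    cder l t v -> cder k t v).
  { intros k l v E H. apply cder_ext_loc with l (rho - Cmod t); auto; [lra|].
    intros s Hs. symmetry. apply E. eapply Rle_lt_trans; [apply Cmod_triangle|]. lra. }
  destruct (bQ_solves (along h P) (4 * K) t) as (u3 & Hu3 & E3); auto; [now apply along_quad|].
  destruct (bQ_solves (fun t => pic_z P t + along g P t)%C (A1 + 4 * K) t) as (u2 & Hu2 & E2); auto;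
    [apply quad_on_plus; auto; now apply along_quad|].
  destruct (bQ_solves (fun t => pic_y P t + along f P t)%C (A2 + 4 * K) t) as (u1 & Hu1 & E1); auto;
    [apply quad_on_plus; auto; now apply along_quad|].
  destruct (Hfix t Ht) as (Fx & Fy & Fz).
  cbv beta in E1, E2. fold (pic_z P) in E3. fold (pic_y P) in E2. fold (pic_x P) in E1.
  rewrite <- Fz in E3, E2. rewrite <- Fy in E2, E1. rewrite <- Fx in E1.
  change (along h P t) with (h ((t + c3x (P t))%C, c3y (P t), c3z (P t))) in E3.
  change (along g P t) with (g ((t + c3x (P t))%C, c3y (P t), c3z (P t))) in E2.
  change (along f P t) with (f ((t + c3x (P t))%C, c3y (P t), c3z (P t))) in E1.
  exists (1 + u1)%C, u2, u3. split; [|split; [|split; [|split; [|split]]]].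
  - apply (cder_plus (fun s => s)); [apply cder_id|].
    apply Hext with (pic_x P); auto. intros s Hs; now apply Hfix.
  - apply Hext with (pic_y P); auto. intros s Hs; now apply Hfix.
  - apply Hext with (pic_z P); auto. intros s Hs; now apply Hfix.
  - transitivity (t + c3x (P t) + (t * u1 - c3x (P t)))%C; [ring|]. now rewrite E1.
  - transitivity (c3y (P t) + (t * u2 - c3y (P t)))%C; [ring|]. now rewrite E2.
  - transitivity (c3z (P t) + (t * u3 - c3z (P t)))%C; [ring|]. now rewrite E3.
Qed.
End Picard.

(** * From coordinates to curves, and the rotation flow on the invariant curve *)

Lemma has_cderiv_intro (k1 k2 k3 : C -> C) (t u1 u2 u3 : C) :
  cder k1 t u1 -> cder k2 t u2 -> cder k3 t u3 ->
  has_cderiv (fun s => (k1 s, k2 s, k3 s)) t (u1, u2, u3).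
Proof.
  intros H1 H2 H3 eps He.
  destruct (H1 (eps / 3)) as (d1 & Hd1 & K1); [lra|].
  destruct (H2 (eps / 3)) as (d2 & Hd2 & K2); [lra|].
  destruct (H3 (eps / 3)) as (d3 & Hd3 & K3); [lra|].
  exists (Rmin d1 (Rmin d2 d3)); split; [repeat apply Rmin_pos; auto|]. intros s Hs.
  pose proof (Rmin_l d1 (Rmin d2 d3)); pose proof (Rmin_r d1 (Rmin d2 d3)).
  pose proof (Rmin_l d2 d3); pose proof (Rmin_r d2 d3). change Cnorm with Cmod in *.
  specialize (K1 s ltac:(lra)); specialize (K2 s ltac:(lra)); specialize (K3 s ltac:(lra)).
  change (C3norm ((k1 (t + s) - k1 t - s * u1), (k2 (t + s) - k2 t - s * u2),
    (k3 (t + s) - k3 t - s * u3))%C <= eps * Cmod s).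
  eapply Rle_trans; [apply C3norm_le_sum|]. lra.
Qed.

Lemma has_cderiv_elim (gamma : C -> C3) (t : C) (v : C3) : has_cderiv gamma t v ->
  cder (fun s => c3x (gamma s)) t (c3x v) /\ cder (fun s => c3y (gamma s)) t (c3y v) /\
  cder (fun s => c3z (gamma s)) t (c3z v).
Proof.
  intros H. split; [|split]; intros eps He; destruct (H eps He) as (d & Hd & K);
    exists d; (split; [auto|]); intros s Hs; (eapply Rle_trans; [|exact (K s Hs)]);
    apply C3norm_ge.
Qed.

Lemma real_solution_intro (V : C3 -> C3) (k1 k2 k3 : R -> C) :
  (forall t, rder k1 t (c3x (V (k1 t, k2 t, k3 t)))) ->
  (forall t, rder k2 t (c3y (V (k1 t, k2 t, k3 t)))) ->
  (forall t, rder k3 t (c3z (V (k1 t, k2 t, k3 t)))) ->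
  real_solution V (fun t => (k1 t, k2 t, k3 t)).
Proof.
  intros H1 H2 H3 t eps He.
  destruct (H1 t (eps / 3)) as (d1 & Hd1 & K1); [lra|].
  destruct (H2 t (eps / 3)) as (d2 & Hd2 & K2); [lra|].
  destruct (H3 t (eps / 3)) as (d3 & Hd3 & K3); [lra|].
  exists (Rmin d1 (Rmin d2 d3)); split; [repeat apply Rmin_pos; auto|]. intros s [_ Hs].
  pose proof (Rmin_l d1 (Rmin d2 d3)); pose proof (Rmin_r d1 (Rmin d2 d3)).
  pose proof (Rmin_l d2 d3); pose proof (Rmin_r d2 d3).
  specialize (K1 s ltac:(lra)); specialize (K2 s ltac:(lra)); specialize (K3 s ltac:(lra)).
  set (v := V (k1 t, k2 t, k3 t)) in *.
  change (C3norm ((k1 (t + s)%R - k1 t - s * c3x v), (k2 (t + s)%R - k2 t - s * c3y v),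
    (k3 (t + s)%R - k3 t - s * c3z v))%C <= eps * Rabs s).
  eapply Rle_trans; [apply C3norm_le_sum|]. lra.
Qed.

(** Gives minimality of the period; it follows from [cos x = 1 - 2 sin^2 (x / 2)] and positivity of
    the sine on [(0, PI)]. *)
Lemma cexp_inj_period (x : R) : 0 < Rabs x < 2 * PI -> cexp (x * Ci)%C <> 1%C.
Proof.
  intros Hx E. apply (f_equal fst) in E. unfold cexp in E; simpl in E.
  replace (x * 0 - 0 * 1) with 0 in E by ring. replace (x * 1 + 0 * 0) with x in E by ring.
  rewrite exp_0, Rmult_1_l in E.
  assert (E' : cos (Rabs x) = 1).
  { unfold Rabs. destruct (Rcase_abs x); [rewrite cos_neg|]; auto. }
  replace (Rabs x) with (2 * (Rabs x / 2)) in E' by field. rewrite cos_2a_sin in E'.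
  assert (0 < sin (Rabs x / 2)) by (apply sin_gt_0; lra). nra.
Qed.

Lemma cexp_period (x : R) : Rabs x = 2 * PI -> cexp (x * Ci)%C = 1%C.
Proof.
  intros Hx. unfold cexp; simpl.
  replace (x * 0 - 0 * 1) with 0 by ring. replace (x * 1 + 0 * 0) with x by ring.
  rewrite exp_0, !Rmult_1_l.
  unfold Rabs in Hx. destruct (Rcase_abs x).
  - replace x with (- (2 * PI)) by lra. now rewrite cos_neg, sin_neg, cos_2PI, sin_2PI, Ropp_0.
  - rewrite Hx. now rewrite cos_2PI, sin_2PI.
Qed.

Lemma Ciw_neq0 (w : R) : w <> 0 -> (Ci * w)%C <> 0%C.
Proof. intros Hw E. apply Hw. apply (f_equal snd) in E. simpl in E. lra. Qed.

Lemma exists_isochronous (w : R) (f g h : C3 -> C) (r K : R) : w <> 0 -> 0 < r -> 0 <= K ->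
  order2_on f r K -> order2_on g r K -> order2_on h r K ->
  exists S, invariant_center_manifold (field w f g h) AX S /\
            isochronous_center_family (field w f g h) S (2 * PI / Rabs w).
Proof.
  intros Hw Hr HK Hf Hg Hh. apply Ciw_neq0 in Hw as Hiw.
  set (b := (/ (Ci * w))%C). set (beta := Cmod b).
  set (A1 := 4 * beta * (4 * K)). set (A2 := 4 * beta * (A1 + 4 * K)).
  set (A3 := 4 * beta * (A2 + 4 * K)). set (A := A1 + A2 + A3).
  set (c := 4 * beta * (1 + 4 * beta * (1 + 4 * beta))).
  assert (Hb : 0 <= beta) by apply Cmod_ge_0.
  assert (HA1 : 0 <= A1) by (unfold A1; apply Rmult_le_pos; lra).
  assert (HA2 : 0 <= A2) by (unfold A2; apply Rmult_le_pos; lra).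
  assert (HA3 : 0 <= A3) by (unfold A3; apply Rmult_le_pos; lra).
  assert (HA : 0 <= A) by (unfold A; lra).
  assert (Hc : 0 <= c).
  { unfold c. apply Rmult_le_pos; [lra|].
    assert (0 <= 4 * beta * (1 + 4 * beta)) by (apply Rmult_le_pos; lra). lra. }
  (* One entry for each smallness condition of [picard_solution]: staying in the domain, size at
     most [2 |t|], and contraction by 1/2. The [+ 1] avoids dividing by 0. *)
  set (rho := Rmin (r / 4) (Rmin (/ (3 * A + 1)) (/ (12 * (c * K) + 1)))).
  assert (HcK : 0 <= c * K) by (now apply Rmult_le_pos).
  assert (Hrho : 0 < rho)
    by (repeat apply Rmin_pos; [lra|apply Rinv_0_lt_compat; lra|apply Rinv_0_lt_compat; lra]).
  assert (R1 : rho <= r / 4) by apply Rmin_l.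
  assert (R2 : rho <= / (3 * A + 1)) by (eapply Rle_trans; [apply Rmin_r|apply Rmin_l]).
  assert (R3 : rho <= / (12 * (c * K) + 1)) by (eapply Rle_trans; [apply Rmin_r|apply Rmin_r]).
  assert (C1 : 3 * A * rho <= 1).
  { apply Rle_trans with ((3 * A + 1) * / (3 * A + 1)); [|right; field; lra].
    apply Rmult_le_compat; lra. }
  assert (C2 : c * (6 * K * rho) <= 1 / 2).
  { replace (c * (6 * K * rho)) with (12 * (c * K) * rho / 2) by field.
    assert (12 * (c * K) * rho <= 1); [|lra].
    apply Rle_trans with ((12 * (c * K) + 1) * / (12 * (c * K) + 1)); [|right; field; lra].
    apply Rmult_le_compat; lra. }
  destruct (picard_solution f g h r K b rho Hf Hg Hh HK Hrho ltac:(lra) C1 C2)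
    as (X & Y & Z & ([HXd HX] & [_ HY] & [_ HZ]) & HP). fold beta A1 A2 A3 A in HX, HY, HZ.
  (* On the disk of radius [s0] the function [X] is at most [A * s0 ^ 2], so on the half disk its
     derivative is at most [16 * A * s0 <= 1 / 2]. Hence [t + X t] is injective there, with an
     inverse of Lipschitz constant 2 and a nonzero derivative. *)
  set (s0 := Rmin rho (/ (32 * A + 1))).
  assert (Hs0 : 0 < s0) by (apply Rmin_pos; [auto|apply Rinv_0_lt_compat; lra]).
  assert (Hs0r : s0 <= rho) by apply Rmin_l.
  assert (Hs0A : 32 * A * s0 <= 1).
  { apply Rle_trans with ((32 * A + 1) * / (32 * A + 1)); [|right; field; lra].
    apply Rmult_le_compat; try lra. apply Rmin_r. }
  set (gamma := fun t : C => ((t + X t, Y t, Z t)%C : C3)).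
  set (rho1 := s0 / 2). assert (Hrho1 : 0 < rho1) by (unfold rho1; lra).
  assert (Hr1 : rho1 < rho) by (unfold rho1; lra).
  assert (HdX : forall t v, Cmod t < rho1 -> cder X t v -> Cmod v <= 1 / 2).
  { intros t v Ht Hv. apply Rle_trans with (16 * (A * s0 ^ 2) / s0).
    - apply (cder_le X 0%C s0 (A * s0 ^ 2)) with t; auto.
      + intros z Hz. replace (z - 0)%C with z in Hz by ring. apply HXd. lra.
      + intros z Hz. replace (z - 0)%C with z in Hz by ring.
        eapply Rle_trans; [apply HX; lra|]. apply Rmult_le_compat_l; auto.
        apply pow_incr. split; [apply Cmod_ge_0|lra].
      + replace (t - 0)%C with t by ring. unfold rho1 in Ht; lra.
    - replace (16 * (A * s0 ^ 2) / s0) with (16 * A * s0) by (field; lra). lra. }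
  assert (HXlip : forall t1 t2, Cmod t1 < rho1 -> Cmod t2 < rho1 ->
    Cmod (X t1 - X t2)%C <= 1 / 2 * Cmod (t1 - t2)%C).
  { intros t1 t2 H1 H2. replace t1 with (t2 + (t1 - t2))%C at 1 by ring.
    apply cder_bound. intros s Hs.
    assert (Hin : Cmod (t2 + s * (t1 - t2))%C < rho1).
    { replace (t2 + s * (t1 - t2))%C with (RtoC (1 - s) * t2 + s * t1)%C
        by (rewrite RtoC_minus; ring).
      eapply Rle_lt_trans; [apply Cmod_triangle|].
      rewrite !Cmod_mult, !Cmod_R, !Rabs_pos_eq by lra.
      destruct (Rle_lt_dec s (1 / 2)); nra. }
    destruct (HXd (t2 + s * (t1 - t2))%C) as [v Hv]; [lra|]. exists v; split; auto.
    now apply HdX with (t2 + s * (t1 - t2))%C. }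
  assert (Hinv : forall t1 t2, Cmod t1 < rho1 -> Cmod t2 < rho1 ->
    Cmod (t1 - t2)%C <= 2 * Cmod (c3x (gamma t1) - c3x (gamma t2))%C).
  { intros t1 t2 H1 H2. pose proof (HXlip t1 t2 H1 H2) as L.
    assert (Cmod (t1 - t2)%C <= Cmod (c3x (gamma t1) - c3x (gamma t2))%C + Cmod (X t1 - X t2)%C);
      [|lra].
    replace (t1 - t2)%C with ((c3x (gamma t1) - c3x (gamma t2)) - (X t1 - X t2))%C at 1
      by (unfold gamma, c3x; simpl fst; ring).
    apply Cmod_minus_le; apply Rle_refl. }
  assert (Hinj : forall t1 t2, Cmod t1 < rho1 -> Cmod t2 < rho1 -> gamma t1 = gamma t2 -> t1 = t2).
  { intros t1 t2 H1 H2 E. pose proof (Hinv t1 t2 H1 H2) as L. rewrite E in L.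
    replace (c3x (gamma t2) - c3x (gamma t2))%C with (RtoC 0) in L by ring.
    rewrite Cmod_0 in L. replace t1 with ((t1 - t2) + t2)%C by ring.
    rewrite (Cmod_eq_0 (t1 - t2)%C); [ring|]. apply Rle_antisym; [lra|apply Cmod_ge_0]. }
  assert (HG0 : gamma 0%C = C3zero).
  { destruct (HP 0%C) as [B _]; [rewrite Cmod_0; lra|]. rewrite Cmod_0 in B.
    destruct (sum3_eq0 (0 + X 0%C)%C (Y 0%C) (Z 0%C)) as (E1 & E2 & E3).
    - apply Rle_antisym; [lra|apply sum3_ge0].
    - unfold gamma. now rewrite E1, E2, E3. }
  assert (Hq0 : forall k : C -> C,
    (forall t, Cmod t < rho -> Cmod (k t) <= A * Cmod t ^ 2) -> cder k 0%C 0%C).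
  { intros k Hk. apply cder_quadratic with rho A; auto. intros s Hs.
    assert (E : k 0%C = 0%C).
    { apply Cmod_eq_0. apply Rle_antisym; [|apply Cmod_ge_0].
      specialize (Hk 0%C). rewrite Cmod_0 in Hk. specialize (Hk Hrho). lra. }
    rewrite E, Cplus_0_l. replace (k s - 0 - s * 0)%C with (k s) by ring. auto. }
  assert (Hci : Ci <> RtoC 0) by (intros E; apply (f_equal snd) in E; simpl in E; lra).
  assert (Hwc : RtoC w <> RtoC 0) by (now apply RtoC_neq0).
  assert (Hder : forall t, Cmod t < rho1 -> exists v, has_cderiv gamma t v /\
    field w f g h (gamma t) = C3scal (Ci * w * t)%C v /\ c3x v <> RtoC 0).
  { intros t Ht1. assert (Ht : Cmod t < rho) by lra.
    destruct (HP t Ht) as (_ & u1 & u2 & u3 & D1 & D2 & D3 & E1 & E2 & E3).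
    exists (u1, u2, u3). split; [now apply has_cderiv_intro|]. split.
    - symmetry. apply C3_eq.
      + change (Ci * w * t * u1 = Ci * w * (t + X t) + Y t + f (gamma t))%C.
        transitivity (Ci * w * (t * u1))%C; [ring|]. rewrite E1. fold (gamma t).
        unfold b. field. auto.
      + change (Ci * w * t * u2 = Ci * w * Y t + Z t + g (gamma t))%C.
        transitivity (Ci * w * (t * u2))%C; [ring|]. rewrite E2. fold (gamma t).
        unfold b. field. auto.
      + change (Ci * w * t * u3 = Ci * w * Z t + h (gamma t))%C.
        transitivity (Ci * w * (t * u3))%C; [ring|]. rewrite E3. fold (gamma t).
        unfold b. field. auto.
    - change (u1 <> RtoC 0). intros E.
      destruct (HXd t Ht) as [v Hv].
      assert (Ev : u1 = (1 + v)%C).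
      { apply (cder_unique (fun s => s + X s)%C t); auto. apply (cder_plus (fun s => s)); auto.
        apply cder_id. }
      pose proof (HdX t v Ht1 Hv) as B.
      replace v with (- (1))%C in B by (rewrite <- (Cplus_0_l (- (1))%C), <- E, Ev; ring).
      rewrite Cmod_m1 in B. lra. }
  assert (Hnorm : forall t, Cmod t < rho1 -> C3norm (gamma t) < 2 * rho1).
  { intros t Ht. eapply Rle_lt_trans; [apply C3norm_le_sum|].
    destruct (HP t) as [B _]; [lra|]. unfold sum3 in B. lra. }
  (* The manifold is the image of [gamma] itself. The ball radius [2 * rho1] contains this whole
     image, so the description of [S] in the ball holds by definition. *)
  exists (fun q => exists t, Cmod t < rho1 /\ gamma t = q). split.
  - exists gamma, rho1, (2 * rho1). split; [|split].
    + split; auto. split; [lra|]. split; auto. split; [|split; [|split; [|split]]]; auto.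
      * intros t Ht. destruct (Hder t Ht) as (v & Hv & _ & Hn). exists v; split; auto.
        intros E. apply Hn. rewrite E. reflexivity.
      * intros q Hq. reflexivity.
      * intros t0 Ht0 eps He. exists (eps / 2); split; [lra|]. intros t Ht Hd.
        eapply Rle_lt_trans; [apply Hinv; auto|].
        assert (B : Cmod (c3x (gamma t) - c3x (gamma t0))%C <= C3norm (C3sub (gamma t) (gamma t0)))
          by apply C3norm_ge.
        lra.
    + destruct (Hder 0%C) as (v & Hv & E & Hn); [rewrite Cmod_0; auto|].
      exists v. split; auto. destruct (has_cderiv_elim _ _ _ Hv) as (_ & Vy & Vz).
      split; [apply (cder_unique Y 0%C)|apply (cder_unique Z 0%C)]; auto.
    + intros t Ht. destruct (Hder t Ht) as (v & Hv & E & _). exists v, (Ci * w * t)%C. auto.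
  (* Any positive radius will do: every point of the image other than 0 lies on a periodic orbit. *)
  - exists 1; split; [lra|]. intros q (t0 & Ht0 & Eq) Hq _.
    assert (Ht0n : t0 <> 0%C) by (intros E; apply Hq; rewrite <- Eq, E; auto).
    (* The rotation [exp(i w s) t0] solves [tau' = i w tau], so [gamma (tau s)] follows the field.
       Its modulus is constant, which keeps it in the chart for all real times; the [0 +] matches
       the form of [rder_line]. *)
    set (tau := fun s : R => (cexp (0 + s * (Ci * w)) * t0)%C).
    assert (Htau : forall s, tau s = (cexp (RtoC (w * s) * Ci) * t0)%C).
    { intros s. unfold tau. f_equal. f_equal. rewrite RtoC_mult. ring. }
    assert (Htau1 : forall s, Cmod (tau s) < rho1).
    { intros s. rewrite Htau, Cmod_mult, Cmod_cexp. simpl.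
      replace (w * s * 0 - 0 * 1) with 0 by ring. rewrite exp_0. lra. }
    assert (Hrd : forall (k : C -> C) s u, cder k (tau s) u ->
      rder (fun s => k (tau s)) s (Ci * w * tau s * u)%C).
    { intros k s u Hu. replace (Ci * w * tau s * u)%C with ((Ci * w) * (tau s * u))%C by ring.
      apply (rder_line (fun z => k (cexp z * t0)%C) 0%C (Ci * w)%C).
      apply (cder_comp k (fun z => cexp z * t0)%C); [|apply Hu].
      eapply cder_eq; [apply (cder_mult cexp (fun _ => t0)); [apply cder_cexp|apply cder_const]|].
      unfold tau. ring. }
    assert (H0 : tau 0 = t0).
    { rewrite Htau. rewrite Rmult_0_r, Cmult_0_l, cexp_0. ring. }
    exists (fun s => gamma (tau s)). split; [|split; [|split]].
    + apply (real_solution_intro _ (fun s => tau s + X (tau s))%C (fun s => Y (tau s))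
        (fun s => Z (tau s)));
      intros s; destruct (Hder (tau s) (Htau1 s)) as (v & Hv & E & _);
      destruct (has_cderiv_elim _ _ _ Hv) as (D1 & D2 & D3); fold (gamma (tau s)); rewrite E.
      * apply (Hrd (fun t => t + X t)%C); exact D1.
      * apply (Hrd Y); exact D2.
      * apply (Hrd Z); exact D3.
    + now rewrite H0.
    + intros s. f_equal. rewrite !Htau. f_equal.
      rewrite Rmult_plus_distr_l, RtoC_plus, Cmult_plus_distr_r, cexp_plus.
      rewrite (cexp_period (w * (2 * PI / Rabs w))); [ring|].
      pose proof PI_RGT_0. pose proof (Rabs_pos_lt w Hw).
      rewrite Rabs_mult, Rabs_div by lra. rewrite Rabs_Rabsolu, (Rabs_pos_eq (2 * PI)) by lra.
      field. lra.
    (* Injectivity of [gamma] turns a return to [q] into [exp(i w s) = 1], which is impossible for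
       [0 < |w s| < 2 PI]. *)
    + intros s Hs E. rewrite <- Eq in E. apply Hinj in E; auto.
      rewrite Htau in E.
      assert (E' : cexp (RtoC (w * s) * Ci)%C = 1%C).
      { transitivity ((cexp (RtoC (w * s) * Ci) * t0) / t0)%C; [field; auto|].
        rewrite E. field; auto. }
      apply cexp_inj_period in E'; auto. pose proof (Rabs_pos_lt w Hw).
      rewrite Rabs_mult, (Rabs_pos_eq s) by lra. split; [apply Rmult_lt_0_compat; lra|].
      replace (2 * PI) with (Rabs w * (2 * PI / Rabs w)) by (field; lra).
      apply Rmult_lt_compat_l; lra.
Qed.
(** * Invariant curves tangent to the x-axis are graphs *)

(** A quantitative inverse function theorem: on a small disk [x t - c t] is Lipschitz with constant
    [|c| / 2], which yields injectivity, solvability by iteration, and the differentiability of the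
    inverse. *)
Lemma local_inverse (x : C -> C) (rho M : R) (c : C) : 0 < rho ->
  (forall t, Cmod t < rho -> exists v, cder x t v) ->
  (forall t, Cmod t < rho -> Cmod (x t) <= M) ->
  x 0%C = 0%C -> cder x 0%C c -> c <> 0%C ->
  exists tau d (sigma : C -> C), 0 < tau /\ tau <= rho /\ 0 < d /\
    (forall t, Cmod t < tau -> Cmod (x t) < d -> sigma (x t) = t) /\
    forall X, Cmod X < d -> Cmod (sigma X) < tau /\ x (sigma X) = X /\
      Cmod (sigma X) <= 2 / Cmod c * Cmod X /\
      exists v, cder x (sigma X) v /\ Cmod c / 2 <= Cmod v /\ cder sigma X (/ v)%C.
Proof.
  intros Hrho Hd HM x0 Hc Hc0. apply Cmod_gt_0 in Hc0 as Hcp.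
  set (C0 := 512 * M / rho ^ 2).
  assert (HM0 : 0 <= M).
  { eapply Rle_trans; [apply Cmod_ge_0|apply (HM 0%C)]. rewrite Cmod_0; auto. }
  assert (HC0 : 0 <= C0).
  { apply Rmult_le_pos; [lra|]. left; apply Rinv_0_lt_compat, pow_lt; auto. }
  assert (E0 : forall t, (t - 0)%C = t) by (intros; ring).
  (* [rho / 4] is the range of [cder_lip_at]; the other bound forces the derivative of [x] to stay
     within [|c| / 2] of [c]. *)
  set (tau := Rmin (rho / 4) (Cmod c / (2 * (C0 + 1)))).
  assert (Htau : 0 < tau) by (apply Rmin_pos; [lra|apply Rdiv_lt_0_compat; lra]).
  assert (Ht4 : tau <= rho / 4) by apply Rmin_l.
  assert (Htc : (C0 + 1) * tau <= Cmod c / 2).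
  { replace (Cmod c / 2) with ((C0 + 1) * (Cmod c / (2 * (C0 + 1)))) by (field; lra).
    apply Rmult_le_compat_l; [lra|apply Rmin_r]. }
  assert (Hder : forall t v, Cmod t < tau -> cder x t v -> Cmod (v - c)%C <= Cmod c / 2).
  { intros t v Ht Hv. eapply Rle_trans.
    - apply (cder_lip_at x 0%C rho M) with (z := t); auto; try (intros z; rewrite E0; auto);
        rewrite ?E0; lra.
    - fold C0. rewrite E0. pose proof (Cmod_ge_0 t). nra. }
  assert (Hlip : forall t1 t2, Cmod t1 < tau -> Cmod t2 < tau ->
    Cmod (x t1 - x t2 - c * (t1 - t2))%C <= Cmod c / 2 * Cmod (t1 - t2)%C).
  { intros t1 t2 H1 H2.
    replace (x t1 - x t2 - c * (t1 - t2))%C with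
      ((x (t2 + (t1 - t2)) - c * (t2 + (t1 - t2))) - (x t2 - c * t2))%C
      by (replace (t2 + (t1 - t2))%C with t1 by ring; ring).
    apply (cder_bound (fun t => x t - c * t)%C). intros s Hs.
    assert (Hin : Cmod (t2 + s * (t1 - t2))%C < tau).
    { replace (t2 + s * (t1 - t2))%C with (RtoC (1 - s) * t2 + s * t1)%C
        by (rewrite RtoC_minus; ring).
      eapply Rle_lt_trans; [apply Cmod_triangle|].
      rewrite !Cmod_mult, !Cmod_R, !Rabs_pos_eq by lra.
      destruct (Rle_lt_dec s (1 / 2)); nra. }
    destruct (Hd (t2 + s * (t1 - t2))%C) as [v Hv]; [lra|].
    exists (v - c)%C; split; [|now apply Hder with (t2 + s * (t1 - t2))%C].
    apply (cder_minus x (fun t => c * t)%C); auto.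
    eapply cder_eq; [apply (cder_scal c (fun t => t)), cder_id|ring]. }
  assert (Hexp : forall t1 t2, Cmod t1 < tau -> Cmod t2 < tau ->
    Cmod c / 2 * Cmod (t1 - t2)%C <= Cmod (x t1 - x t2)%C).
  { intros t1 t2 H1 H2. specialize (Hlip t1 t2 H1 H2).
    assert (Cmod (c * (t1 - t2))%C <= Cmod (x t1 - x t2)%C + Cmod c / 2 * Cmod (t1 - t2)%C).
    { replace (c * (t1 - t2))%C with ((x t1 - x t2) - (x t1 - x t2 - c * (t1 - t2)))%C by ring.
      apply Cmod_minus_le; [apply Rle_refl|auto]. }
    rewrite Cmod_mult in *. lra. }
  (* The solution found below has modulus at most [2 |X| / |c|], which this choice keeps below
     [tau]. *)
  set (d := Cmod c * tau / 2). assert (Hdp : 0 < d) by (unfold d; nra).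
  assert (Hsol : forall X, exists t, Cmod X < d ->
    Cmod t < tau /\ x t = X /\ Cmod t <= 2 / Cmod c * Cmod X).
  { intros X. destruct (Rlt_dec (Cmod X) d) as [HX|HX]; [|exists 0%C; intros; contradiction].
    set (a := Cmod X / Cmod c). assert (Ha : 0 <= a).
    { apply Rmult_le_pos; [apply Cmod_ge_0|]. left; now apply Rinv_0_lt_compat. }
    assert (Ha2 : 2 * a < tau).
    { apply Rmult_lt_reg_l with (Cmod c); auto. unfold a, d in *.
      replace (Cmod c * (2 * (Cmod X / Cmod c))) with (2 * Cmod X) by (field; lra). lra. }
    (* Newton's iteration with the slope frozen at [c]; by [Hlip] it contracts by 1/2. The bound
       [2 a - 2 a / 2 ^ n] on [u n] is the partial geometric sum and keeps every iterate in the disk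
       where [Hlip] holds. *)
    set (T := fun t => (t + (X - x t) / c)%C).
    set (u := fun n => Nat.iter n T 0%C).
    assert (uS : forall n, u (S n) = T (u n)) by reflexivity.
    assert (Hu : forall n, Cmod (u n) <= 2 * a - 2 * a / 2 ^ n /\
      Cmod (u (S n) - u n)%C <= a / 2 ^ n).
    { assert (P : forall n, 0 <= a / 2 ^ n).
      { intros n. apply Rmult_le_pos; auto. left; apply Rinv_0_lt_compat, pow_lt; lra. }
      induction n.
      - split.
        + change (u 0%nat) with (RtoC 0). rewrite Cmod_0. simpl. lra.
        + rewrite uS. change (u 0%nat) with (RtoC 0). unfold T. rewrite x0.
          replace (0 + (X - 0) / c - 0)%C with (X / c)%C by (field; auto).
          rewrite Cmod_div by auto. simpl. unfold a. lra.
      - destruct IHn as [I1 I2].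
        assert (E : 2 * a / 2 ^ S n = a / 2 ^ n) by (simpl; field; apply pow_nonzero; lra).
        assert (E' : 2 * a / 2 ^ n = 2 * (a / 2 ^ n)) by (unfold Rdiv; ring).
        assert (E'' : a / 2 ^ S n = / 2 * (a / 2 ^ n)) by (simpl; field; apply pow_nonzero; lra).
        assert (I1' : Cmod (u (S n)) <= 2 * a - 2 * a / 2 ^ S n).
        { replace (u (S n)) with (u n + (u (S n) - u n))%C by ring.
          eapply Rle_trans; [apply Cmod_triangle|]. rewrite E. lra. }
        split; auto. rewrite E'' in *. specialize (P n).
        assert (HSn : Cmod (u (S n)) < tau) by (rewrite E in I1'; lra).
        rewrite (uS (S n)). rewrite (uS n) at 2. unfold T.
        replace (u (S n) + (X - x (u (S n))) / c - (u n + (X - x (u n)) / c))%C with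
          (- ((x (u (S n)) - x (u n) - c * (u (S n) - u n)) / c))%C by (field; auto).
        rewrite Cmod_opp, Cmod_div by auto.
        apply Rle_trans with (Cmod c / 2 * Cmod (u (S n) - u n)%C / Cmod c).
        + apply Rmult_le_compat_r; [left; now apply Rinv_0_lt_compat|]. apply Hlip; lra.
        + replace (Cmod c / 2 * Cmod (u (S n) - u n)%C / Cmod c)
            with (/ 2 * Cmod (u (S n) - u n)%C) by (field; lra). lra. }
    destruct (Cseq_geom u a) as [l Hl]; [intros n; apply Hu|].
    assert (Hl2 : Cmod l <= 2 * a).
    { apply le_add_geom with (4 * a). intros n.
      replace l with (u n - (u n - l))%C by ring. apply Cmod_minus_le; auto.
      destruct (Hu n) as [B _]. assert (0 <= 2 * a / 2 ^ n); [|lra].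
      apply Rmult_le_pos; [lra|]. left; apply Rinv_0_lt_compat, pow_lt; lra. }
    exists l. intros _. split; [lra|]. split.
    - transitivity (X - (X - x l))%C; [ring|].
      rewrite (Cmod_eq_0 (X - x l)%C); [ring|].
      apply Rle_antisym; [|apply Cmod_ge_0].
      apply le_add_geom with (Cmod c * a + (Cmod c / 2 + Cmod c) * (4 * a)). intros n.
      destruct (Hu n) as [B1 B2].
      assert (P : 0 <= 2 * a / 2 ^ n).
      { apply Rmult_le_pos; [lra|]. left; apply Rinv_0_lt_compat, pow_lt; lra. }
      replace (X - x l)%C with (c * (u (S n) - u n)
        + ((x (u n) - x l - c * (u n - l)) + c * (u n - l)))%C
        by (rewrite uS; unfold T; field; auto).
      replace (0 + (Cmod c * a + (Cmod c / 2 + Cmod c) * (4 * a)) / 2 ^ n) with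
        (Cmod c * (a / 2 ^ n) + (Cmod c / 2 * (4 * a / 2 ^ n) + Cmod c * (4 * a / 2 ^ n)))
        by (field; apply pow_nonzero; lra).
      apply Cmod_plus_le; [apply Cmod_mult_le; [lra|auto]|].
      apply Cmod_plus_le; [|apply Cmod_mult_le; [lra|auto]].
      eapply Rle_trans; [apply Hlip; lra|]. apply Rmult_le_compat_l; auto. lra.
    - unfold a in Hl2. replace (2 / Cmod c * Cmod X) with (2 * (Cmod X / Cmod c))
        by (unfold Rdiv; ring). auto. }
  destruct (functional_choice _ Hsol) as [sigma Hs].
  exists tau, d, sigma. split; auto. split; [lra|]. split; auto. split.
  - intros t Ht Hxt. destruct (Hs (x t) Hxt) as (S1 & S2 & _).
    pose proof (Hexp (sigma (x t)) t S1 Ht) as B. rewrite S2 in B.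
    replace (x t - x t)%C with (RtoC 0) in B by ring. rewrite Cmod_0 in B.
    pose proof (Cmod_ge_0 (sigma (x t) - t)%C).
    replace (sigma (x t)) with ((sigma (x t) - t) + t)%C by ring.
    rewrite (Cmod_eq_0 (sigma (x t) - t)%C); [ring|]. nra.
  - intros X HX. destruct (Hs X HX) as (S1 & S2 & S3).
    split; auto. split; auto. split; auto.
    destruct (Hd (sigma X)) as [v Hv]; [lra|]. exists v. split; auto.
    assert (Hvc : Cmod c / 2 <= Cmod v).
    { pose proof (Hder (sigma X) v S1 Hv).
      assert (Cmod c <= Cmod v + Cmod c / 2); [|lra].
      replace c with (v - (v - c))%C at 1 by ring. apply Cmod_minus_le; [lra|auto]. }
    split; auto.
    assert (Hv0 : v <> 0%C) by (apply Cmod_gt_0; lra).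
    intros eps He. set (k := Cmod c / 2) in *. assert (Hk : 0 < k) by (unfold k; lra).
    destruct (Hv (eps * (k * k))) as (e & He0 & Ke);
      [apply Rmult_lt_0_compat; [|apply Rmult_lt_0_compat]; auto|].
    exists (Rmin (d - Cmod X) (k * e)); split.
    { apply Rmin_pos; [lra|]. now apply Rmult_lt_0_compat. }
    intros s Hsm.
    assert (Cmod s < d - Cmod X) by (eapply Rlt_le_trans; [apply Hsm|apply Rmin_l]).
    assert (Hske : Cmod s < k * e) by (eapply Rlt_le_trans; [apply Hsm|apply Rmin_r]).
    assert (HXs : Cmod (X + s)%C < d) by (eapply Rle_lt_trans; [apply Cmod_triangle|]; lra).
    destruct (Hs (X + s)%C HXs) as (S1' & S2' & _).
    pose proof (Hexp _ _ S1' S1) as B. rewrite S2, S2' in B.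
    replace (X + s - X)%C with s in B by ring.
    set (q := (sigma (X + s) - sigma X)%C) in *.
    assert (Hq : Cmod q < e) by (fold k in B; nra).
    specialize (Ke q Hq). replace (sigma X + q)%C with (sigma (X + s)%C) in Ke by (unfold q; ring).
    rewrite S2, S2' in Ke. replace (X + s - X)%C with s in Ke by ring.
    replace (q - s * / v)%C with (- ((s - q * v) / v))%C by (field; auto).
    rewrite Cmod_opp, Cmod_div by auto.
    apply Rle_trans with (eps * (k * k) * Cmod q / k).
    + unfold Rdiv. apply Rmult_le_compat; auto using Cmod_ge_0.
      * left; apply Rinv_0_lt_compat; lra.
      * apply Rinv_le_contravar; auto.
    + replace (eps * (k * k) * Cmod q / k) with (eps * (k * Cmod q)) by (field; lra).
      apply Rmult_le_compat_l; [lra|auto].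
Qed.

(** Invariance of the graph of [(p2, p3)] over the x-axis, as slope equations from which the
    proportionality factor is eliminated. The linear bound on the slopes encodes tangency to the
    x-axis. *)
Definition invariant_graph (V : C3 -> C3) (p2 p3 : C -> C) (d L : R) : Prop :=
  p2 0%C = 0%C /\ p3 0%C = 0%C /\
  forall X, Cmod X < d -> exists v2 v3,
    cder p2 X v2 /\ cder p3 X v3 /\ Cmod v2 <= L * Cmod X /\ Cmod v3 <= L * Cmod X /\
    (c3x (V (X, p2 X, p3 X)) * v2)%C = c3y (V (X, p2 X, p3 X)) /\
    (c3x (V (X, p2 X, p3 X)) * v3)%C = c3z (V (X, p2 X, p3 X)).

Lemma C3norm_ge_coord (q : C3) :
  Cmod (c3x q) <= C3norm q /\ Cmod (c3y q) <= C3norm q /\ Cmod (c3z q) <= C3norm q.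
Proof. destruct q as [[x y] z]. apply C3norm_ge. Qed.

Section Chart.
Context (V : C3 -> C3) (S : C3 -> Prop) (gamma : C -> C3) (rho r : R).
Context (Hch : curve_chart S gamma rho r).

Lemma chart_cder (t : C) : Cmod t < rho -> exists u1 u2 u3,
  cder (fun s => c3x (gamma s)) t u1 /\ cder (fun s => c3y (gamma s)) t u2 /\
  cder (fun s => c3z (gamma s)) t u3.
Proof.
  intros Ht. destruct Hch as (_ & _ & _ & Hd & _). destruct (Hd t Ht) as (v & Hv & _).
  exists (c3x v), (c3y v), (c3z v). now apply has_cderiv_elim.
Qed.

Lemma chart_bound (t : C) : Cmod t < rho ->
  Cmod (c3x (gamma t)) <= r /\ Cmod (c3y (gamma t)) <= r /\ Cmod (c3z (gamma t)) <= r.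
Proof.
  intros Ht. destruct Hch as (_ & _ & _ & _ & _ & Hn & _). specialize (Hn t Ht).
  destruct (C3norm_ge_coord (gamma t)) as (B1 & B2 & B3). lra.
Qed.

Lemma chart_deriv_nonzero (v : C3) : has_cderiv gamma C0 v -> v <> C3zero.
Proof.
  intros Hv E. destruct Hch as (Hrho & _ & _ & Hd & _).
  destruct (Hd C0) as (v' & Hv' & Hn); [change (Cmod 0%C < rho); rewrite Cmod_0; auto|].
  apply Hn. destruct (has_cderiv_elim _ _ _ Hv) as (A1 & A2 & A3).
  destruct (has_cderiv_elim _ _ _ Hv') as (B1 & B2 & B3).
  rewrite <- E. destruct v as [[a b] c], v' as [[a' b'] c'].
  apply C3_eq; eapply cder_unique; eassumption.
Qed.

(** The tangent vector at 0 is nonzero and on the x-axis, so the x-coordinate of [gamma] can be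
    inverted near 0; composing the other two coordinates with this inverse gives the graph. *)
Lemma chart_graph : (exists v, has_cderiv gamma C0 v /\ on_axis AX v) ->
  (forall t, Cmod t < rho -> exists v lam, has_cderiv gamma t v /\ V (gamma t) = C3scal lam v) ->
  exists p2 p3 d L r', 0 < d /\ 0 <= L /\ 0 < r' /\ invariant_graph V p2 p3 d L /\
    forall q, C3norm q < r' -> (S q <-> c3y q = p2 (c3x q) /\ c3z q = p3 (c3x q)).
Proof.
  intros (v & Hv & Hy & Hz) Hinv. pose proof (chart_deriv_nonzero v Hv) as Hv0.
  destruct (has_cderiv_elim _ _ _ Hv) as (D1 & D2 & D3). rewrite Hy in D2. rewrite Hz in D3.
  pose proof Hch as (Hrho & Hr & G0 & _ & _ & _ & HS & Hhom).
  set (x := fun s => c3x (gamma s)) in *. set (y := fun s => c3y (gamma s)) in *.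
  set (z := fun s => c3z (gamma s)) in *. set (c := c3x v) in *.
  assert (Hc : c <> RtoC 0).
  { intros E. apply Hv0. destruct v as [[a a'] a'']. apply C3_eq; [exact E|exact Hy|exact Hz]. }
  assert (z0 : x 0%C = RtoC 0 /\ y 0%C = RtoC 0 /\ z 0%C = RtoC 0).
  { unfold x, y, z. change (RtoC 0) with C0. rewrite G0. auto. }
  destruct z0 as (x0 & y0 & z0).
  destruct (local_inverse x rho r c) as (tau & d & sigma & Htau & Htr & Hd & Hs1 & Hs2); auto.
  { intros t Ht. destruct (chart_cder t Ht) as (u1 & _ & _ & H & _). eauto. }
  { intros t Ht. now apply chart_bound. }
  apply Cmod_gt_0 in Hc as Hcp. set (k := 2 / Cmod c) in *.
  assert (Hk : 0 < k) by (apply Rdiv_lt_0_compat; lra).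
  set (d1 := Rmin d (rho / (4 * k))).
  assert (Hd1 : 0 < d1) by (apply Rmin_pos; [auto|apply Rdiv_lt_0_compat; lra]).
  assert (Hdd : d1 <= d) by apply Rmin_l.
  assert (Hdk : k * d1 <= rho / 4).
  { replace (rho / 4) with (k * (rho / (4 * k))) by (field; lra).
    apply Rmult_le_compat_l; [lra|apply Rmin_r]. }
  set (L0 := 512 * r / rho ^ 2).
  assert (HL0 : 0 <= L0).
  { apply Rmult_le_pos; [lra|]. left; apply Rinv_0_lt_compat, pow_lt; auto. }
  assert (E0 : forall t, (t - 0)%C = t) by (intros; ring).
  assert (Hsm : forall (m : C -> C) t u, (forall t, Cmod t < rho -> exists v, cder m t v) ->
    (forall t, Cmod t < rho -> Cmod (m t) <= r) -> cder m 0%C 0%C ->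
    Cmod t < rho / 4 -> cder m t u -> Cmod u <= L0 * Cmod t).
  { intros m t u Hm1 Hm2 Hm0 Ht Hu.
    pose proof (cder_lip_at m 0%C rho r Hrho) as B. rewrite <- (E0 t), <- (E0 u).
    apply B; auto; try (intros w; rewrite E0; auto); rewrite E0; auto. }
  (* Here the homeomorphism clause of [curve_chart] enters: points of [S] near 0 have parameters
     below [tau], where [sigma] inverts [x]. Without it a distant part of the parameter disk could
     return close to 0. *)
  destruct (Hhom C0) with (eps := tau) as (e & He & Hhom'); auto.
  { change (Cmod 0%C < rho). rewrite Cmod_0; auto. }
  exists (fun X => y (sigma X)), (fun X => z (sigma X)), d1, (L0 * k * k), (Rmin (Rmin r e) d).
  split; auto. split; [apply Rmult_le_pos; [apply Rmult_le_pos|]; lra|].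
  split; [repeat apply Rmin_pos; auto|]. split.
  - assert (S0 : sigma 0%C = 0%C).
    { rewrite <- x0 at 1. apply Hs1; [rewrite Cmod_0|rewrite x0, Cmod_0]; auto. }
    split; [now rewrite S0|]. split; [now rewrite S0|].
    intros X HX. destruct (Hs2 X) as (T1 & T2 & T3 & w & Hw & Hwc & Hsw); [lra|].
    set (t := sigma X) in *.
    assert (Ht : Cmod t < rho / 4) by nra.
    assert (Hw0 : w <> 0%C) by (apply Cmod_gt_0; lra).
    destruct (Hinv t) as (v' & lam & Hv' & HV); [lra|].
    destruct (has_cderiv_elim _ _ _ Hv') as (F1 & F2 & F3).
    fold x in F1. fold y in F2. fold z in F3.
    set (w1 := c3x v' : C) in *. set (w2 := c3y v' : C) in *. set (w3 := c3z v' : C) in *.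
    assert (Ew : w1 = w) by (now apply (cder_unique x t)).
    assert (Hwi : Cmod (/ w)%C <= k).
    { rewrite Cmod_inv by auto. replace k with (/ (Cmod c / 2)) by (unfold k; field; lra).
      apply Rinv_le_contravar; lra. }
    assert (Hb : forall u, Cmod u <= L0 * Cmod t -> Cmod (/ w * u)%C <= L0 * k * k * Cmod X).
    { intros u Hu. replace (L0 * k * k * Cmod X) with (k * (L0 * (k * Cmod X))) by ring.
      apply Cmod_mult_le; auto. eapply Rle_trans; [apply Hu|]. apply Rmult_le_compat_l; auto. }
    assert (EG : gamma t = (X, y t, z t)).
    { unfold y, z. rewrite <- T2. unfold x. now destruct (gamma t) as [[? ?] ?]. }
    assert (Hkey : forall q, q = gamma t -> (c3x (V q) * (/ w * w2))%C = c3y (V q) /\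
      (c3x (V q) * (/ w * w3))%C = c3z (V q)).
    { intros q ->. rewrite HV. split.
      - change (lam * w1 * (/ w * w2) = lam * w2)%C. rewrite Ew. field; auto.
      - change (lam * w1 * (/ w * w3) = lam * w3)%C. rewrite Ew. field; auto. }
    exists (/ w * w2)%C, (/ w * w3)%C.
    split; [now apply (cder_comp y sigma)|]. split; [now apply (cder_comp z sigma)|].
    split; [|split; [|split]].
    + apply Hb, (Hsm y); auto.
      * intros s Hs. destruct (chart_cder s Hs) as (? & ? & ? & _ & ? & _). eauto.
      * intros s Hs. now apply chart_bound.
    + apply Hb, (Hsm z); auto.
      * intros s Hs. destruct (chart_cder s Hs) as (? & ? & ? & _ & _ & ?). eauto.
      * intros s Hs. now apply chart_bound.
    + apply Hkey. symmetry. exact EG.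
    + apply Hkey. symmetry. exact EG.
  - intros q Hq.
    pose proof (Rmin_l (Rmin r e) d); pose proof (Rmin_r (Rmin r e) d).
    pose proof (Rmin_l r e); pose proof (Rmin_r r e).
    destruct (C3norm_ge_coord q) as (B1 & _ & _). set (qx := c3x q : C) in *.
    rewrite HS by lra. split.
    + intros (t & Ht & E).
      assert (Ht' : Cmod t < tau).
      { rewrite <- (E0 t). apply (Hhom' t Ht). rewrite G0.
        replace (C3sub (gamma t) C3zero) with (gamma t); [rewrite E; lra|].
        destruct (gamma t) as [[a b] c']. apply C3_eq; symmetry; apply E0. }
      assert (Ex : x t = qx) by (unfold x; now rewrite E).
      rewrite <- Ex, Hs1; auto; [unfold y, z; now rewrite E|]. rewrite Ex. lra.
    + intros [Ey Ez]. destruct (Hs2 qx) as (T1 & T2 & _); [lra|].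
      exists (sigma qx). split; [change (Cmod (sigma qx) < rho); lra|].
      unfold x, y, z, qx in *.
      destruct (gamma (sigma (c3x q))) as [[a b] c'], q as [[qx' qy] qz]. now apply C3_eq.
Qed.
End Chart.
(** * Uniqueness *)

(** The mean value inequality from 0, although [phi] need not be differentiable or even vanish at 0:
    start from [s / 2 ^ n], where the a priori bound makes the initial value negligible. That
    bound's constant [L] disappears from the result. *)
Lemma ray_bound (phi : R -> C) (K L : R) :
  (forall s, 0 < s <= 1 -> exists v, rder phi s v /\ Cmod v <= K) ->
  (forall s, 0 < s <= 1 -> Cmod (phi s) <= L * s) ->
  forall s, 0 < s <= 1 -> Cmod (phi s) <= K * s.
Proof.
  intros HK HL s Hs. apply le_add_geom with (L * s). intros n.
  assert (P : 0 < / 2 ^ n) by (apply Rinv_0_lt_compat, pow_lt; lra).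
  assert (P1 : / 2 ^ n <= 1) by (rewrite <- Rinv_1; apply Rinv_le_contravar; [|apply pow_R1_Rle]; lra).
  set (a := s / 2 ^ n). assert (Ha : 0 < a <= s) by (unfold a, Rdiv; nra).
  replace (phi s) with ((phi s - phi a) + phi a)%C by ring.
  replace (L * s / 2 ^ n) with (L * a) by (unfold a, Rdiv; ring).
  destruct (HK s Hs) as (v & _ & Hv). assert (0 <= K) by (pose proof (Cmod_ge_0 v); lra).
  apply Cmod_plus_le; [|apply HL; lra].
  apply Rle_trans with (K * (s - a)); [|nra].
  apply rder_bound; [lra|]. intros u Hu. apply HK. lra.
Qed.

(* Along a ray, [e2 / X] and [e3 / X] satisfy a nilpotent linear system with a small
   perturbation, which halves any bound they satisfy. *)
Lemma graph_diff_zero (e2 e3 : C -> C) (b : C) (d L M : R) : 0 < d -> 0 <= L -> 0 <= M ->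
  (forall X, Cmod X < d -> Cmod (e2 X) <= L * Cmod X ^ 2 /\ Cmod (e3 X) <= L * Cmod X ^ 2) ->
  (forall X, Cmod X < d -> X <> 0%C -> exists v2 v3, cder e2 X v2 /\ cder e3 X v3 /\
    Cmod (X * v2 - e2 X - b * e3 X)%C <= M * Cmod X * (Cmod (e2 X) + Cmod (e3 X)) /\
    Cmod (X * v3 - e3 X)%C <= M * Cmod X * (Cmod (e2 X) + Cmod (e3 X))) ->
  exists d', 0 < d' /\ forall X, Cmod X < d' -> e2 X = 0%C /\ e3 X = 0%C.
Proof.
  intros Hd HL HM Hq Hv. pose proof (Cmod_ge_0 b) as Hb.
  (* A bound [B] on both quotients is improved to [2 * M * x * B * (1 + |b|)], which is at most
     [B / 2] once [N * x <= 1]. *)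
  set (N := 4 * M * (1 + Cmod b)). assert (HN : 0 <= N) by (unfold N; apply Rmult_le_pos; lra).
  exists (Rmin d (/ (N + 1))). split.
  { apply Rmin_pos; auto. apply Rinv_0_lt_compat; lra. }
  intros X0 HX0.
  assert (HXd : Cmod X0 < d) by (eapply Rlt_le_trans; [apply HX0|apply Rmin_l]).
  assert (HXN : Cmod X0 <= / (N + 1)) by (left; eapply Rlt_le_trans; [apply HX0|apply Rmin_r]).
  destruct (Ceq_dec X0 0%C) as [->|Hn0].
  { destruct (Hq 0%C HXd) as [B2 B3]. rewrite Cmod_0 in *.
    split; apply Cmod_eq_0, Rle_antisym; try apply Cmod_ge_0; lra. }
  apply Cmod_gt_0 in Hn0 as Hp. set (x := Cmod X0) in *.
  assert (HNx : N * x <= 1).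
  { apply Rle_trans with ((N + 1) * / (N + 1)); [|right; field; lra]. apply Rmult_le_compat; lra. }
  set (phi := fun (e : C -> C) (s : R) => (e (0 + s * X0) / (0 + s * X0))%C).
  assert (Hs0 : forall s : R, 0 < s <= 1 -> (0 + s * X0)%C <> 0%C /\ Cmod (0 + s * X0)%C = s * x /\
    Cmod (0 + s * X0)%C < d).
  { intros s Hs. assert (E : Cmod (0 + s * X0)%C = s * x).
    { rewrite Cplus_0_l, Cmod_mult, Cmod_R, Rabs_pos_eq; [auto|lra]. }
    split; [|split; [auto|rewrite E; nra]]. apply Cmod_gt_0. rewrite E. nra. }
  assert (Hphi : forall e s, 0 < s <= 1 -> Cmod (e (0 + s * X0)%C) = s * x * Cmod (phi e s)).
  { intros e s Hs. destruct (Hs0 s Hs) as (Hn & E & _). unfold phi.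
    rewrite Cmod_div, E by auto. field. assert (0 < s * x) by nra. lra. }
  assert (Hrd : forall e s v, 0 < s <= 1 -> cder e (0 + s * X0)%C v ->
    exists u, rder (phi e) s u /\
      Cmod u = x * Cmod ((0 + s * X0) * v - e (0 + s * X0))%C / (s * x * (s * x))).
  { intros e s v Hs He. destruct (Hs0 s Hs) as (Hn & E & _).
    exists (X0 * (v * / (0 + s * X0) + e (0 + s * X0) * (1 * - / ((0 + s * X0) * (0 + s * X0)))))%C.
    split.
    - apply (rder_line (fun z => e z / z)%C). apply (cder_mult e (fun z => / z)%C); auto.
      rewrite Cmult_1_l. now apply cder_inv.
    - set (z := (0 + s * X0)%C) in *.
      replace (X0 * (v * / z + e z * (1 * - / (z * z))))%C with (X0 * (z * v - e z) / (z * z))%C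
        by (field; auto).
      rewrite Cmod_div by (now apply Cmult_neq_0). rewrite !Cmod_mult, E. reflexivity. }
  assert (HphiL : forall e, (forall X, Cmod X < d -> Cmod (e X) <= L * Cmod X ^ 2) ->
    forall s, 0 < s <= 1 -> Cmod (phi e s) <= L * x * s).
  { intros e He s Hs. destruct (Hs0 s Hs) as (_ & E & Hin). specialize (He _ Hin).
    rewrite (Hphi e s Hs), E in He. assert (0 < s * x) by nra.
    apply Rmult_le_reg_l with (s * x); auto. replace (s * x * (L * x * s)) with (L * (s * x) ^ 2) by ring.
    auto. }
  assert (H2L := HphiL e2 (fun X h => proj1 (Hq X h))).
  assert (H3L := HphiL e3 (fun X h => proj2 (Hq X h))).
  assert (Hhalf : forall n s, 0 < s <= 1 ->
    Cmod (phi e2 s) <= L * x / 2 ^ n /\ Cmod (phi e3 s) <= L * x / 2 ^ n).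
  { assert (HLx : 0 <= L * x) by (apply Rmult_le_pos; lra).
    induction n.
    - intros s Hs. specialize (H2L s Hs). specialize (H3L s Hs). simpl. unfold Rdiv.
      rewrite Rinv_1, Rmult_1_r. nra.
    - set (B := L * x / 2 ^ n) in *.
      assert (HB : 0 <= B) by (apply Rmult_le_pos; auto; left; apply Rinv_0_lt_compat, pow_lt; lra).
      replace (L * x / 2 ^ S n) with (B / 2) by (unfold B; simpl; field; apply pow_nonzero; lra).
      (* [e3] comes first, since its equation has no linear coupling. The factor [s] gained here is
         essential: in the derivative of [phi e2] the term [b * e3] is divided by the square of the
         ray point, and this factor cancels the remaining [1 / s]. *)
      assert (H3 : forall s, 0 < s <= 1 -> Cmod (phi e3 s) <= (2 * M * x * B) * s).
      { apply ray_bound with (L * x); auto. intros s Hs.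
        destruct (Hs0 s Hs) as (Hn & E & Hin).
        destruct (Hv _ Hin Hn) as (v2 & v3 & _ & D3 & _ & I3).
        destruct (Hrd e3 s v3 Hs D3) as (u & Hu & Eu). exists u; split; auto. rewrite Eu.
        rewrite (Hphi e2 s Hs), (Hphi e3 s Hs), E in I3. destruct (IHn s Hs) as [J2 J3].
        assert (Hsx : 0 < s * x) by nra.
        apply Rle_trans with (x * (M * (s * x) * (s * x * (B + B))) / (s * x * (s * x))).
        - apply Rmult_le_compat_r; [left; apply Rinv_0_lt_compat; nra|].
          apply Rmult_le_compat_l; [lra|]. eapply Rle_trans; [apply I3|].
          apply Rmult_le_compat_l; [apply Rmult_le_pos; lra|].
          rewrite <- Rmult_plus_distr_l. apply Rmult_le_compat_l; lra.
        - right; field; lra. }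
      assert (H2 : forall s, 0 < s <= 1 ->
        Cmod (phi e2 s) <= (2 * M * x * B * (1 + Cmod b)) * s).
      { apply ray_bound with (L * x); auto. intros s Hs.
        destruct (Hs0 s Hs) as (Hn & E & Hin).
        destruct (Hv _ Hin Hn) as (v2 & v3 & D2 & _ & I2 & _).
        destruct (Hrd e2 s v2 Hs D2) as (u & Hu & Eu). exists u; split; auto. rewrite Eu.
        destruct (IHn s Hs) as [J2 J3]. specialize (H3 s Hs).
        assert (Hsx : 0 < s * x) by nra. set (z := (0 + s * X0)%C) in *.
        assert (I2' : Cmod (z * v2 - e2 z)%C <= M * (s * x) * (s * x * (B + B))
          + Cmod b * (s * x * (2 * M * x * B * s))).
        { replace (z * v2 - e2 z)%C with ((z * v2 - e2 z - b * e3 z) + b * e3 z)%C by ring.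
          apply Cmod_plus_le.
          - eapply Rle_trans; [apply I2|]. rewrite E. unfold z. rewrite (Hphi e2 s Hs), (Hphi e3 s Hs).
            apply Rmult_le_compat_l; [apply Rmult_le_pos; lra|].
            rewrite <- Rmult_plus_distr_l. apply Rmult_le_compat_l; lra.
          - apply Cmod_mult_le; [lra|]. unfold z. rewrite (Hphi e3 s Hs).
            apply Rmult_le_compat_l; lra. }
        apply Rle_trans with (x * (M * (s * x) * (s * x * (B + B))
          + Cmod b * (s * x * (2 * M * x * B * s))) / (s * x * (s * x))).
        - apply Rmult_le_compat_r; [left; apply Rinv_0_lt_compat; nra|].
          apply Rmult_le_compat_l; [lra|auto].
        - right; field; lra. }
      assert (HMB : 0 <= 2 * M * x * B) by (apply Rmult_le_pos; [apply Rmult_le_pos|]; lra).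
      assert (HNB : 2 * M * x * B * (1 + Cmod b) <= B / 2).
      { replace (2 * M * x * B * (1 + Cmod b)) with (N * x * B / 2) by (unfold N; field). nra. }
      assert (0 <= 2 * M * x * B * Cmod b) by (now apply Rmult_le_pos).
      intros s Hs. specialize (H2 s Hs). specialize (H3 s Hs). split.
      + eapply Rle_trans; [apply H2|]. nra.
      + eapply Rle_trans; [apply H3|]. nra. }
  assert (E1 : (0 + RtoC 1 * X0)%C = X0) by ring.
  assert (Hz : forall e, (forall n, Cmod (phi e 1) <= L * x / 2 ^ n) -> e X0 = 0%C).
  { intros e He. apply Cmod_eq_0. rewrite <- E1, Hphi by lra.
    assert (B : Cmod (phi e 1) <= 0) by (apply le_add_geom with (L * x); intros n; rewrite Rplus_0_l; auto).
    pose proof (Cmod_ge_0 (phi e 1)). nra. }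
  split; apply Hz; intros n; apply Hhalf; lra.
Qed.

Lemma invariant_graph_weaken (V : C3 -> C3) (p2 p3 : C -> C) (d L d' L' : R) :
  d' <= d -> L <= L' -> invariant_graph V p2 p3 d L -> invariant_graph V p2 p3 d' L'.
Proof.
  intros Hd HL (p20 & p30 & H). split; auto. split; auto. intros X HX.
  destruct (H X) as (v2 & v3 & D2 & D3 & B2 & B3 & E); [lra|]. exists v2, v3.
  pose proof (Cmod_ge_0 X). repeat split; auto; try apply E; nra.
Qed.

Lemma invariant_graph_sq (V : C3 -> C3) (p2 p3 : C -> C) (d L : R) : 0 <= L ->
  invariant_graph V p2 p3 d L ->
  forall X, Cmod X < d -> Cmod (p2 X) <= L * Cmod X ^ 2 /\ Cmod (p3 X) <= L * Cmod X ^ 2.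
Proof.
  intros HL (p20 & p30 & H) X HX.
  assert (G : forall p : C -> C, p 0%C = 0%C ->
    (forall X, Cmod X < d -> exists v, cder p X v /\ Cmod v <= L * Cmod X) ->
    Cmod (p X) <= L * Cmod X ^ 2).
  { intros p p0 Hp. replace (p X) with (p (0 + X)%C - p 0%C)%C
      by (rewrite p0; replace (0 + X)%C with X by ring; ring).
    replace (L * Cmod X ^ 2) with (L * Cmod X * Cmod X) by ring.
    apply cder_bound. intros s Hs.
    assert (E : Cmod (0 + s * X)%C <= Cmod X).
    { rewrite Cplus_0_l, Cmod_mult, Cmod_R, Rabs_pos_eq by lra. pose proof (Cmod_ge_0 X). nra. }
    destruct (Hp (0 + s * X)%C) as (v & Hv & B); [lra|]. exists v; split; auto.
    eapply Rle_trans; [apply B|]. now apply Rmult_le_compat_l. }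
  split; apply G; auto; intros Y HY; destruct (H Y HY) as (v2 & v3 & ? & ? & ? & ? & _); eauto.
Qed.

(** Subtracting the slope equations of the two graphs and replacing the x-component of the field by
    its leading part [i w X] brings the differences into the form treated by [graph_diff_zero], with
    [b = 1 / (i w)]. *)
Lemma invariant_graph_unique (w : R) (f g h : C3 -> C) (r K : R) (p2 p3 q2 q3 : C -> C) (d L : R) :
  w <> 0 -> 0 < r -> 0 <= K -> order2_on f r K -> order2_on g r K -> order2_on h r K ->
  0 < d -> 0 <= L ->
  invariant_graph (field w f g h) p2 p3 d L -> invariant_graph (field w f g h) q2 q3 d L ->
  exists d', 0 < d' /\ forall X, Cmod X < d' -> p2 X = q2 X /\ p3 X = q3 X.
Proof.
  intros Hw Hr HK Hf Hg Hh Hd HL Hp Hq.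
  pose proof (invariant_graph_sq _ _ _ _ _ HL Hp) as Sp.
  pose proof (invariant_graph_sq _ _ _ _ _ HL Hq) as Sq.
  destruct Hp as (_ & _ & Hp). destruct Hq as (_ & _ & Hq).
  set (a := Rabs w). assert (Ha : 0 < a) by (now apply Rabs_pos_lt).
  assert (Hiw : Cmod (Ci * w)%C = a) by (rewrite Cmod_mult, Cmod_Ci, Cmod_R; unfold a; ring).
  apply Ciw_neq0 in Hw as Hiw0.
  (* [c1] bounds the remainder [G - u * (V1 - W1)] by [c1 * x * E], and [c2] bounds [V1 - i w X] by
     [c2 * x ^ 2]. [M] combines the two after division by [i w], with [2 * (a + 2) / a] coming from
     the slope difference. *)
  set (c1 := 2 * K + 2 * L). set (c2 := L + 4 * K).
  assert (Hc1 : 0 <= c1) by (unfold c1; lra). assert (Hc2 : 0 <= c2) by (unfold c2; lra).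
  set (M := (c1 + c2 * (2 * (a + 2) / a)) / a).
  assert (HM : 0 <= M).
  { unfold M. apply Rmult_le_pos; [|left; now apply Rinv_0_lt_compat].
    apply Rplus_le_le_0_compat; auto. apply Rmult_le_pos; auto.
    apply Rmult_le_pos; [lra|left; now apply Rinv_0_lt_compat]. }
  (* [c1 * x <= 1] puts both graph points within size [2 x], which is below [r]; [c2 * x <= a / 2]
     yields [|V1| >= a x / 2]. *)
  set (d1 := Rmin (Rmin d (r / 4)) (Rmin (/ (c1 + 1)) (a / (2 * (c2 + 1))))).
  assert (Hd1 : 0 < d1).
  { apply Rmin_pos; apply Rmin_pos; auto; [lra|apply Rinv_0_lt_compat; lra|apply Rdiv_lt_0_compat; lra]. }
  set (e2 := fun X => (p2 X - q2 X)%C). set (e3 := fun X => (p3 X - q3 X)%C).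
  destruct (graph_diff_zero e2 e3 (/ (Ci * w))%C d1 (2 * L) M) as (d' & Hd' & HZ); auto; [lra| | |].
  - intros X HX. assert (HXd : Cmod X < d).
    { eapply Rlt_le_trans; [apply HX|]. eapply Rle_trans; apply Rmin_l. }
    destruct (Sp X HXd), (Sq X HXd). replace (2 * L * Cmod X ^ 2) with (L * Cmod X ^ 2 + L * Cmod X ^ 2) by ring.
    split; now apply Cmod_minus_le.
  - intros X HX HX0. apply Cmod_gt_0 in HX0 as Hx. set (x := Cmod X) in *.
    assert (R1 : x < Rmin d (r / 4)) by (eapply Rlt_le_trans; [apply HX|apply Rmin_l]).
    assert (R2 : x < Rmin (/ (c1 + 1)) (a / (2 * (c2 + 1))))
      by (eapply Rlt_le_trans; [apply HX|apply Rmin_r]).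
    pose proof (Rmin_l d (r / 4)); pose proof (Rmin_r d (r / 4)).
    pose proof (Rmin_l (/ (c1 + 1)) (a / (2 * (c2 + 1)))).
    pose proof (Rmin_r (/ (c1 + 1)) (a / (2 * (c2 + 1)))).
    assert (Hc1x : c1 * x <= 1).
    { apply Rle_trans with ((c1 + 1) * / (c1 + 1)); [|right; field; lra]. apply Rmult_le_compat; lra. }
    assert (Hc2x : c2 * x <= a / 2).
    { replace (a / 2) with ((c2 + 1) * (a / (2 * (c2 + 1)))) by (field; lra).
      apply Rmult_le_compat; lra. }
    assert (HKx : 2 * K * x <= 1) by (unfold c1 in Hc1x; nra).
    assert (HLx : 2 * L * x <= 1) by (unfold c1 in Hc1x; nra).
    destruct (Sp X) as [P2 P3]; [fold x; lra|]. destruct (Sq X) as [Q2 Q3]; [fold x; lra|].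
    fold x in P2, P3, Q2, Q3.
    destruct (Hp X) as (v2 & v3 & D2 & D3 & _ & _ & I2 & I3); [fold x; lra|].
    destruct (Hq X) as (u2 & u3 & F2 & F3 & B2 & B3 & J2 & J3); [fold x; lra|]. fold x in B2, B3.
    set (P := (X, p2 X, p3 X) : C3) in *. set (Q := (X, q2 X, q3 X) : C3) in *.
    change ((Ci * w * X + p2 X + f P) * v2 = Ci * w * p2 X + p3 X + g P)%C in I2.
    change ((Ci * w * X + p2 X + f P) * v3 = Ci * w * p3 X + h P)%C in I3.
    change ((Ci * w * X + q2 X + f Q) * u2 = Ci * w * q2 X + q3 X + g Q)%C in J2.
    change ((Ci * w * X + q2 X + f Q) * u3 = Ci * w * q3 X + h Q)%C in J3.
    assert (NP : sum3 X (p2 X) (p3 X) <= 2 * x) by (unfold sum3; fold x; nra).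
    assert (NQ : sum3 X (q2 X) (q3 X) <= 2 * x) by (unfold sum3; fold x; nra).
    set (E := Cmod (e2 X) + Cmod (e3 X)).
    assert (HE : 0 <= E) by (pose proof (Cmod_ge_0 (e2 X)); pose proof (Cmod_ge_0 (e3 X)); unfold E; lra).
    assert (HF : forall F, order2_on F r K -> Cmod (F P - F Q)%C <= 2 * K * x * E).
    { intros F OF. eapply Rle_trans; [apply (o2_lip _ _ _ OF) with (m := 2 * x); auto; lra|].
      replace (2 * K * x * E) with (K * (2 * x) * E) by ring.
      apply Rmult_le_compat_l; [apply Rmult_le_pos; lra|]. unfold sum3, E, e2, e3.
      replace (X - X)%C with (RtoC 0) by ring. rewrite Cmod_0. lra. }
    assert (HfP : Cmod (f P) <= 4 * K * x ^ 2).
    { eapply Rle_trans; [apply (o2_sq _ _ _ Hf); lra|].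
      replace (4 * K * x ^ 2) with (K * (2 * x) ^ 2) by ring.
      apply Rmult_le_compat_l; auto. apply pow_incr. split; auto using sum3_ge0. }
    set (V1 := (Ci * w * X + p2 X + f P)%C) in *.
    assert (HV1 : Cmod (V1 - Ci * w * X)%C <= c2 * x ^ 2).
    { replace (V1 - Ci * w * X)%C with (p2 X + f P)%C by (unfold V1; ring).
      unfold c2. rewrite Rmult_plus_distr_r. now apply Cmod_plus_le. }
    assert (HV1l : a * x / 2 <= Cmod V1).
    { assert (T : a * x <= Cmod V1 + c2 * x ^ 2).
      { unfold x at 1. rewrite <- Hiw, <- Cmod_mult.
        replace (Ci * w * X)%C with (V1 - (V1 - Ci * w * X))%C at 1 by ring.
        apply Cmod_minus_le; [lra|auto]. }
      nra. }
    set (W1 := (Ci * w * X + q2 X + f Q)%C) in *.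
    assert (HVW : Cmod (V1 - W1)%C <= 2 * E).
    { replace (V1 - W1)%C with (e2 X + (f P - f Q))%C by (unfold V1, W1, e2; ring).
      apply Rle_trans with (E + 2 * K * x * E); [|nra].
      apply Cmod_plus_le; [|now apply HF]. pose proof (Cmod_ge_0 (e3 X)). unfold E; lra. }
    assert (Hrem : forall u G, Cmod u <= L * x -> Cmod G <= 2 * K * x * E ->
      Cmod (G - u * (V1 - W1))%C <= c1 * x * E).
    { intros u G Hu HG. replace (c1 * x * E) with (2 * K * x * E + L * x * (2 * E)) by (unfold c1; ring).
      apply Cmod_minus_le; auto. now apply Cmod_mult_le. }
    (* Common to both components, [lin] being the linear part. The lower bound on [V1] first gives
       [v - u = O(E / x)]; replacing [V1] by [i w X] then costs only
       [c2 * x ^ 2 * O(E / x) = O(x E)]. *)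
    assert (Hkey : forall v u lin G, (V1 * (v - u) = lin + (G - u * (V1 - W1)))%C ->
      Cmod u <= L * x -> Cmod G <= 2 * K * x * E -> Cmod lin <= (a + 1) * E ->
      Cmod (X * (v - u) - lin / (Ci * w))%C <= M * x * E).
    { intros v u lin G Hvu Hu HG Hlin. specialize (Hrem u G Hu HG).
      set (D := (v - u)%C) in *. set (Rm := (G - u * (V1 - W1))%C) in *.
      assert (HD : Cmod D <= 2 * (a + 2) / a * E / x).
      { assert (T : Cmod V1 * Cmod D <= (a + 2) * E).
        { rewrite <- Cmod_mult, Hvu.
          apply Rle_trans with ((a + 1) * E + c1 * x * E); [now apply Cmod_plus_le|nra]. }
        pose proof (Cmod_ge_0 D).
        apply Rmult_le_reg_l with (a * x / 2); [nra|].
        replace (a * x / 2 * (2 * (a + 2) / a * E / x)) with ((a + 2) * E) by (field; lra).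
        nra. }
      replace (X * D - lin / (Ci * w))%C with ((Rm - (V1 - Ci * w * X) * D) / (Ci * w))%C.
      2:{ replace Rm with (V1 * D - lin)%C by (rewrite Hvu; ring). field.
          split; intros Z; apply Hiw0; rewrite Z; ring. }
      rewrite Cmod_div, Hiw by auto.
      replace (M * x * E) with ((c1 * x * E + c2 * x ^ 2 * (2 * (a + 2) / a * E / x)) / a)
        by (unfold M; field; lra).
      apply Rmult_le_compat_r; [left; now apply Rinv_0_lt_compat|].
      apply Cmod_minus_le; auto. now apply Cmod_mult_le. }
    exists (v2 - u2)%C, (v3 - u3)%C.
    split; [now apply cder_minus|]. split; [now apply cder_minus|].
    pose proof (Cmod_ge_0 (e2 X)); pose proof (Cmod_ge_0 (e3 X)).
    split.
    + replace (X * (v2 - u2) - e2 X - / (Ci * w) * e3 X)%C with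
        (X * (v2 - u2) - (Ci * w * e2 X + e3 X) / (Ci * w))%C
        by (field; split; intros Z; apply Hiw0; rewrite Z; ring).
      apply Hkey with (g P - g Q)%C; auto.
      * transitivity (V1 * v2 - W1 * u2 - u2 * (V1 - W1))%C; [ring|]. rewrite I2, J2. unfold e2, e3. ring.
      * apply Rle_trans with (a * Cmod (e2 X) + Cmod (e3 X)).
        -- apply Cmod_plus_le; [|lra]. apply Cmod_mult_le; lra.
        -- unfold E. nra.
    + replace (X * (v3 - u3) - e3 X)%C with (X * (v3 - u3) - (Ci * w * e3 X) / (Ci * w))%C
        by (field; split; intros Z; apply Hiw0; rewrite Z; ring).
      apply Hkey with (h P - h Q)%C; auto.
      * transitivity (V1 * v3 - W1 * u3 - u3 * (V1 - W1))%C; [ring|]. rewrite I3, J3. unfold e3. ring.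
      * apply Rle_trans with (a * Cmod (e3 X)).
        -- apply Cmod_mult_le; lra.
        -- unfold E. nra.
  - exists d'; split; auto. intros X HX. destruct (HZ X HX) as [Z2 Z3]. unfold e2, e3 in *. split.
    + replace (p2 X) with (q2 X + (p2 X - q2 X))%C by ring. rewrite Z2. ring.
    + replace (p3 X) with (q3 X + (p3 X - q3 X))%C by ring. rewrite Z3. ring.
Qed.
(** * Tangent directions *)

(** The function [v2 * W1 - v1 * W2] equals [W2 * (u1 - v1) - W1 * (u2 - v2)], a sum of products of
    two [O(t)] terms, so its derivative at 0 vanishes. Cross products avoid dividing by [t] or by
    the proportionality factor. *)
Lemma cross_product_limit (W1 W2 : C -> C) (a1 a2 v1 v2 : C) (d L : R) : 0 < d -> 0 <= L ->
  cder W1 0%C a1 -> cder W2 0%C a2 -> W1 0%C = 0%C -> W2 0%C = 0%C ->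
  (forall t, Cmod t < d -> exists u1 u2, Cmod (u1 - v1)%C <= L * Cmod t /\
     Cmod (u2 - v2)%C <= L * Cmod t /\ (W1 t * u2 = W2 t * u1)%C) ->
  (a1 * v2 = a2 * v1)%C.
Proof.
  intros Hd HL D1 D2 Z1 Z2 H.
  set (k := fun t => (v2 * W1 t - v1 * W2 t)%C).
  assert (Hk : cder k 0%C (v2 * a1 - v1 * a2)%C).
  { apply (cder_minus (fun t => v2 * W1 t)%C (fun t => v1 * W2 t)%C); now apply cder_scal. }
  assert (Hk0 : cder k 0%C 0%C).
  { destruct (cder_lip _ _ _ D1) as (d1 & Hd1 & K1).
    destruct (cder_lip _ _ _ D2) as (d2 & Hd2 & K2).
    apply cder_quadratic with (Rmin d (Rmin d1 d2)) ((Cmod a1 + 1) * L + (Cmod a2 + 1) * L).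
    { repeat apply Rmin_pos; auto. }
    intros t Ht.
    pose proof (Rmin_l d (Rmin d1 d2)); pose proof (Rmin_r d (Rmin d1 d2)).
    pose proof (Rmin_l d1 d2); pose proof (Rmin_r d1 d2).
    specialize (K1 t ltac:(lra)). specialize (K2 t ltac:(lra)).
    rewrite Cplus_0_l in *. rewrite Z1 in K1. rewrite Z2 in K2.
    replace (W1 t - 0)%C with (W1 t) in K1 by ring. replace (W2 t - 0)%C with (W2 t) in K2 by ring.
    destruct (H t) as (u1 & u2 & B1 & B2 & E); [lra|].
    replace (k t - k 0 - t * 0)%C with (W2 t * (u1 - v1) - W1 t * (u2 - v2))%C.
    2:{ unfold k. rewrite Z1, Z2. transitivity (W2 t * u1 - W1 t * u2 + (v2 * W1 t - v1 * W2 t))%C;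
          [ring|rewrite E; ring]. }
    replace (((Cmod a1 + 1) * L + (Cmod a2 + 1) * L) * Cmod t ^ 2) with
      ((Cmod a2 + 1) * Cmod t * (L * Cmod t) + (Cmod a1 + 1) * Cmod t * (L * Cmod t)) by ring.
    apply Cmod_minus_le; now apply Cmod_mult_le. }
  pose proof (cder_unique _ _ _ _ Hk Hk0) as E.
  replace (a1 * v2)%C with ((v2 * a1 - v1 * a2) + a2 * v1)%C by ring. rewrite E. ring.
Qed.

Lemma order2_curve (F : C3 -> C) (r K : R) (k1 k2 k3 : C -> C) (u1 u2 u3 : C) : 0 < r -> 0 <= K ->
  order2_on F r K -> k1 0%C = 0%C -> k2 0%C = 0%C -> k3 0%C = 0%C ->
  cder k1 0%C u1 -> cder k2 0%C u2 -> cder k3 0%C u3 ->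
  F (k1 0%C, k2 0%C, k3 0%C) = 0%C /\ cder (fun t => F (k1 t, k2 t, k3 t)) 0%C 0%C.
Proof.
  intros Hr HK HF Z1 Z2 Z3 D1 D2 D3.
  assert (F0 : F (k1 0%C, k2 0%C, k3 0%C) = 0%C).
  { apply Cmod_eq_0, Rle_antisym; [|apply Cmod_ge_0]. rewrite Z1, Z2, Z3.
    assert (S0 : sum3 0 0 0 = 0) by (unfold sum3; rewrite Cmod_0; ring).
    eapply Rle_trans; [apply (o2_sq _ _ _ HF); lra|]. rewrite S0. lra. }
  split; auto.
  destruct (cder_lip _ _ _ D1) as (d1 & Hd1 & K1).
  destruct (cder_lip _ _ _ D2) as (d2 & Hd2 & K2).
  destruct (cder_lip _ _ _ D3) as (d3 & Hd3 & K3).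
  pose proof (Cmod_ge_0 u1); pose proof (Cmod_ge_0 u2); pose proof (Cmod_ge_0 u3).
  set (L := (Cmod u1 + 1) + (Cmod u2 + 1) + (Cmod u3 + 1)). assert (HL : 0 < L) by (unfold L; lra).
  assert (HrL : 0 < r / L) by (now apply Rdiv_lt_0_compat).
  apply cder_quadratic with (Rmin (Rmin d1 d2) (Rmin d3 (r / L))) (K * L ^ 2).
  { apply Rmin_pos; apply Rmin_pos; auto. }
  intros s Hs.
  pose proof (Rmin_l (Rmin d1 d2) (Rmin d3 (r / L))).
  pose proof (Rmin_r (Rmin d1 d2) (Rmin d3 (r / L))).
  pose proof (Rmin_l d1 d2); pose proof (Rmin_r d1 d2).
  pose proof (Rmin_l d3 (r / L)); pose proof (Rmin_r d3 (r / L)).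
  specialize (K1 s ltac:(lra)); specialize (K2 s ltac:(lra)); specialize (K3 s ltac:(lra)).
  rewrite F0. rewrite Z1 in K1. rewrite Z2 in K2. rewrite Z3 in K3. rewrite Cplus_0_l in *.
  assert (M0 : forall z, (z - 0)%C = z) by (intros; ring). rewrite M0 in K1, K2, K3.
  replace (F (k1 s, k2 s, k3 s) - 0 - s * 0)%C with (F (k1 s, k2 s, k3 s)) by ring.
  assert (B : sum3 (k1 s) (k2 s) (k3 s) <= L * Cmod s) by (unfold sum3, L; lra).
  assert (B' : L * Cmod s < r).
  { replace r with (L * (r / L)) by (field; lra). apply Rmult_lt_compat_l; lra. }
  eapply Rle_trans; [apply (o2_sq _ _ _ HF); lra|].
  replace (K * L ^ 2 * Cmod s ^ 2) with (K * (L * Cmod s) ^ 2) by ring.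
  apply Rmult_le_compat_l; auto. apply pow_incr. split; auto using sum3_ge0.
Qed.

(** With [J] the linear part of the field, these are two of the three minors expressing that [J v]
    is parallel to [v]; one excludes the y-axis and the other the z-axis. *)
Lemma invariant_tangent (w : R) (f g h : C3 -> C) (r0 K : R) (S : C3 -> Prop) (gamma : C -> C3)
  (rho r : R) (v : C3) : 0 < r0 -> 0 <= K ->
  order2_on f r0 K -> order2_on g r0 K -> order2_on h r0 K ->
  curve_chart S gamma rho r -> has_cderiv gamma C0 v ->
  (forall t, Cmod t < rho -> exists u lam,
     has_cderiv gamma t u /\ field w f g h (gamma t) = C3scal lam u) ->
  ((Ci * w * c3x v + c3y v) * c3y v = (Ci * w * c3y v + c3z v) * c3x v)%C /\
  ((Ci * w * c3y v + c3z v) * c3z v = (Ci * w * c3z v) * c3y v)%C.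
Proof.
  intros Hr0 HK Hf Hg Hh Hch Hv Hinv.
  destruct (has_cderiv_elim _ _ _ Hv) as (D1 & D2 & D3).
  pose proof Hch as (Hrho & Hr & G0 & _).
  set (x := fun s => c3x (gamma s)) in *. set (y := fun s => c3y (gamma s)) in *.
  set (z := fun s => c3z (gamma s)) in *.
  assert (Z : x 0%C = RtoC 0 /\ y 0%C = RtoC 0 /\ z 0%C = RtoC 0).
  { unfold x, y, z. change (RtoC 0) with C0. rewrite G0. auto. }
  destruct Z as (Z1 & Z2 & Z3).
  set (v1 := c3x v : C) in *. set (v2 := c3y v : C) in *. set (v3 := c3z v : C) in *.
  destruct (order2_curve f r0 K x y z v1 v2 v3) as [f0 Df]; auto.
  change (f (x 0%C, y 0%C, z 0%C) = RtoC 0) in f0.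
  destruct (order2_curve g r0 K x y z v1 v2 v3) as [g0 Dg]; auto.
  change (g (x 0%C, y 0%C, z 0%C) = RtoC 0) in g0.
  destruct (order2_curve h r0 K x y z v1 v2 v3) as [h0 Dh]; auto.
  change (h (x 0%C, y 0%C, z 0%C) = RtoC 0) in h0.
  set (W1 := fun t => (Ci * w * x t + y t + f (x t, y t, z t))%C).
  set (W2 := fun t => (Ci * w * y t + z t + g (x t, y t, z t))%C).
  set (W3 := fun t => (Ci * w * z t + h (x t, y t, z t))%C).
  assert (DW1 : cder W1 0%C (Ci * w * v1 + v2)%C).
  { eapply cder_eq.
    - apply (cder_plus (fun t => Ci * w * x t + y t)%C (fun t => f (x t, y t, z t))); [|exact Df].
      apply (cder_plus (fun t => Ci * w * x t)%C y); [|exact D2].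
      apply cder_scal. exact D1.
    - ring. }
  assert (DW2 : cder W2 0%C (Ci * w * v2 + v3)%C).
  { eapply cder_eq.
    - apply (cder_plus (fun t => Ci * w * y t + z t)%C (fun t => g (x t, y t, z t))); [|exact Dg].
      apply (cder_plus (fun t => Ci * w * y t)%C z); [|exact D3].
      apply cder_scal. exact D2.
    - ring. }
  assert (DW3 : cder W3 0%C (Ci * w * v3)%C).
  { eapply cder_eq.
    - apply (cder_plus (fun t => Ci * w * z t)%C (fun t => h (x t, y t, z t))); [|exact Dh].
      apply cder_scal. exact D3.
    - ring. }
  assert (W10 : W1 0%C = RtoC 0) by (unfold W1; rewrite f0, Z1, Z2; ring).
  assert (W20 : W2 0%C = RtoC 0) by (unfold W2; rewrite g0, Z2, Z3; ring).
  assert (W30 : W3 0%C = RtoC 0) by (unfold W3; rewrite h0, Z3; ring).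
  set (L := 512 * r / rho ^ 2).
  assert (HL : 0 <= L).
  { apply Rmult_le_pos; [lra|]. left; apply Rinv_0_lt_compat, pow_lt; auto. }
  assert (E0 : forall t, (t - 0)%C = t) by (intros; ring).
  assert (Hsm : forall (m : C -> C) t u a, (forall t, Cmod t < rho -> exists v, cder m t v) ->
    (forall t, Cmod t < rho -> Cmod (m t) <= r) -> cder m 0%C a ->
    Cmod t < rho / 4 -> cder m t u -> Cmod (u - a)%C <= L * Cmod t).
  { intros m t u a Hm1 Hm2 Hm0 Ht Hu.
    pose proof (cder_lip_at m 0%C rho r Hrho) as B. rewrite <- (E0 t).
    apply B; auto; try (intros q; rewrite E0; auto); rewrite E0; auto. }
  assert (Hu : forall t, Cmod t < rho / 4 -> exists u1 u2 u3,
    Cmod (u1 - v1)%C <= L * Cmod t /\ Cmod (u2 - v2)%C <= L * Cmod t /\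
    Cmod (u3 - v3)%C <= L * Cmod t /\
    (W1 t * u2 = W2 t * u1)%C /\ (W2 t * u3 = W3 t * u2)%C).
  { intros t Ht. destruct (Hinv t) as (u & lam & Hut & HV); [lra|].
    destruct (has_cderiv_elim _ _ _ Hut) as (F1 & F2 & F3).
    fold x in F1. fold y in F2. fold z in F3.
    exists (c3x u), (c3y u), (c3z u).
    assert (EG : ((x t, y t, z t) : C3) = gamma t) by (unfold x, y, z; now destruct (gamma t) as [[? ?] ?]).
    assert (E1 : W1 t = (lam * c3x u)%C)
      by exact (eq_trans (f_equal (fun q => c3x (field w f g h q)) EG) (f_equal c3x HV)).
    assert (E2 : W2 t = (lam * c3y u)%C)
      by exact (eq_trans (f_equal (fun q => c3y (field w f g h q)) EG) (f_equal c3y HV)).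
    assert (E3 : W3 t = (lam * c3z u)%C)
      by exact (eq_trans (f_equal (fun q => c3z (field w f g h q)) EG) (f_equal c3z HV)).
    split; [|split; [|split; [|split]]].
    - apply (Hsm x); auto.
      + intros s Hs. destruct (chart_cder _ _ _ _ Hch s Hs) as (? & ? & ? & ? & _ & _). eauto.
      + intros s Hs. now apply (chart_bound _ _ _ _ Hch).
    - apply (Hsm y); auto.
      + intros s Hs. destruct (chart_cder _ _ _ _ Hch s Hs) as (? & ? & ? & _ & ? & _). eauto.
      + intros s Hs. now apply (chart_bound _ _ _ _ Hch).
    - apply (Hsm z); auto.
      + intros s Hs. destruct (chart_cder _ _ _ _ Hch s Hs) as (? & ? & ? & _ & _ & ?). eauto.
      + intros s Hs. now apply (chart_bound _ _ _ _ Hch).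
    - rewrite E1, E2. ring.
    - rewrite E2, E3. ring. }
  split.
  - apply (cross_product_limit W1 W2) with (rho / 4) L; auto; [lra|].
    intros t Ht. destruct (Hu t Ht) as (u1 & u2 & u3 & ? & ? & _ & ? & _). eauto.
  - apply (cross_product_limit W2 W3) with (rho / 4) L; auto; [lra|].
    intros t Ht. destruct (Hu t Ht) as (u1 & u2 & u3 & _ & ? & ? & _ & ?). eauto.
Qed.

Lemma Csquare_eq0 (c : C) : (c * c = 0)%C -> c = 0%C.
Proof.
  intros E. destruct (Ceq_dec c 0%C) as [H|H]; auto. now destruct (Cmult_neq_0 c c H H).
Qed.

Theorem theorem3p10 (w : R) (f g h : C3 -> Cplx) :
  w <> 0 ->
  holomorphic_near0 f -> holomorphic_near0 g -> holomorphic_near0 h ->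
  vanishes_order2 f -> vanishes_order2 g -> vanishes_order2 h ->
  ( (exists S, invariant_center_manifold (field w f g h) AX S /\
               isochronous_center_family (field w f g h) S (2 * PI / Rabs w)) /\
    (forall S1 S2, invariant_center_manifold (field w f g h) AX S1 ->
                   invariant_center_manifold (field w f g h) AX S2 ->
       exists r, 0 < r /\ forall q, C3norm q < r -> (S1 q <-> S2 q)) ) /\
  (forall S, ~ invariant_center_manifold (field w f g h) AY S) /\
  (forall S, ~ invariant_center_manifold (field w f g h) AZ S).
Proof.
  intros Hw Hf Hg Hh Vf Vg Vh.
  destruct (order2_exists3 f g h) as (r & K & Hr & HK & Of & Og & Oh); auto.
  split; [split|split].
  - now apply (exists_isochronous w f g h r K).
  - intros S1 S2 (g1 & rho1 & r1 & C1 & T1 & I1) (g2 & rho2 & r2 & C2 & T2 & I2).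
    destruct (chart_graph _ _ _ _ _ C1 T1 I1) as (p2 & p3 & d1 & L1 & e1 & Hd1 & HL1 & He1 & G1 & E1).
    destruct (chart_graph _ _ _ _ _ C2 T2 I2) as (q2 & q3 & d2 & L2 & e2 & Hd2 & HL2 & He2 & G2 & E2).
    apply (invariant_graph_weaken _ _ _ _ _ (Rmin d1 d2) (Rmax L1 L2)) in G1;
      [|apply Rmin_l|apply Rmax_l].
    apply (invariant_graph_weaken _ _ _ _ _ (Rmin d1 d2) (Rmax L1 L2)) in G2;
      [|apply Rmin_r|apply Rmax_r].
    destruct (invariant_graph_unique w f g h r K p2 p3 q2 q3 (Rmin d1 d2) (Rmax L1 L2))
      as (d & Hd & E); auto.
    { now apply Rmin_pos. }
    { eapply Rle_trans; [apply HL1|apply Rmax_l]. }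
    exists (Rmin d (Rmin e1 e2)). split; [repeat apply Rmin_pos; auto|]. intros q Hq.
    pose proof (Rmin_l d (Rmin e1 e2)); pose proof (Rmin_r d (Rmin e1 e2)).
    pose proof (Rmin_l e1 e2); pose proof (Rmin_r e1 e2).
    destruct (C3norm_ge_coord q) as (B & _).
    rewrite E1, E2 by lra. destruct (E (c3x q)) as [Ep Eq]; [lra|]. rewrite Ep, Eq. reflexivity.
  - intros S (gamma & rho & r1 & Hch & (v & Hv & Hx & Hz) & Hinv).
    (* For [v = (0, b, 0)] the first minor reads [b ^ 2 = 0], against [v <> 0]. *)
    destruct (invariant_tangent w f g h r K S gamma rho r1 v) as [E _]; auto.
    apply (chart_deriv_nonzero _ _ _ _ Hch v Hv). destruct v as [[a b] c].
    apply C3_eq; [exact Hx| |exact Hz]. change (a = RtoC 0) in Hx. change (c = RtoC 0) in Hz.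
    change ((Ci * w * a + b) * b = (Ci * w * b + c) * a)%C in E.
    apply Csquare_eq0. rewrite Hx in E. transitivity ((Ci * w * 0 + b) * b)%C; [ring|].
    rewrite E. ring.
  - intros S (gamma & rho & r1 & Hch & (v & Hv & Hx & Hy) & Hinv).
    (* For [v = (0, 0, c)] the first minor is trivially satisfied, and the second reads
       [c ^ 2 = 0]. *)
    destruct (invariant_tangent w f g h r K S gamma rho r1 v) as [_ E]; auto.
    apply (chart_deriv_nonzero _ _ _ _ Hch v Hv). destruct v as [[a b] c].
    apply C3_eq; [exact Hx|exact Hy|]. change (a = RtoC 0) in Hx. change (b = RtoC 0) in Hy.
    change ((Ci * w * b + c) * c = (Ci * w * c) * b)%C in E.
    apply Csquare_eq0. rewrite Hy in E. transitivity ((Ci * w * 0 + c) * c)%C; [ring|].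
    rewrite E. ring.
Qed.
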